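(* Let $\theta\in(0,\pi/2)$ and let $\omega\in(0,1/2]$ be a constant. Then for every integer $m\neq 0$ the fiber operator $\mathsf{F}^{[m]}_{\omega,\theta}$ satisfies \[ \inf\sigma(\mathsf{F}^{[m]}_{\omega,\theta})\ge 1 . \]
   Context: For $\theta\in(0,\pi/2)$ let \[ \mathsf{Gui}(\theta)=\Big\{(r,z)\in(0,+\infty)\times\mathbb{R} : -\tfrac{\pi}{\sin\theta}<z,\ \max(0,z\tan\theta)<r<z\tan\theta+\tfrac{\pi}{\cos\theta}\Big\}, \] $\mathsf{Lay}(\theta)=\mathsf{Gui}(\theta)\times\mathbb{S}^1$ and $L^2_{\mathsf{cyl}}(\mathsf{Lay}(\theta))=L^2(\mathsf{Gui}(\theta)\times\mathbb{S}^1;r\,dr\,dz\,d\phi)$. For a constant $\omega\in(0,1/2]$ let $Q_{\omega,\theta}$ be the closure in $L^2_{\mathsf{cyl}}(\mathsf{Lay}(\theta))$ of the closable form \[ u\mapsto\int_{\mathsf{Lay}(\theta)}\Big(|\partial_r u|^2+|\partial_z u|^2+\frac{|i\partial_\phi u-\omega u|^2}{r^2}\Big)\,r\,dr\,dz\,d\phi,\qquad u\in\mathcal{C}^\infty_0(\mathsf{Lay}(\theta)). \] For $m\in\mathbb{Z}$ let $v_m(\phi)=(2\pi)^{-1/2}e^{im\phi}$ and $(\pi^{[m]}u)(r,z)=\langle u(r,z,\cdot),v_m\rangle_{L^2(\mathbb{S}^1)}$ for $u\in L^2_{\mathsf{cyl}}(\mathsf{Lay}(\theta))$. The fiber $\mathsf{F}^{[m]}_{\omega,\theta}$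 is the self-adjoint operator in $L^2(\mathsf{Gui}(\theta);r\,dr\,dz)$ associated via the first representation theorem with the closed, densely defined, non-negative quadratic form \[ \mathfrak{f}^{[m]}_{\omega,\theta}[u]=\int_{\mathsf{Gui}(\theta)}\Big(|\partial_r u|^2+|\partial_z u|^2+\frac{(m-\omega)^2}{r^2}|u|^2\Big)r\,dr\,dz,\qquad \mathrm{dom}\,\mathfrak{f}^{[m]}_{\omega,\theta}=\pi^{[m]}(\mathrm{dom}\,Q_{\omega,\theta}). \] $\sigma(\cdot)$ denotes the spectrum. *)

(* Defs.v *)
From mathcomp Require Import all_boot all_order all_algebra.
From mathcomp Require Import complex.
From mathcomp Require Import all_classical all_reals all_analysis.

Set Implicit Arguments.
Unset Strict Implicit.
Unset Printing Implicit Defensive.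

Import Order.TTheory GRing.Theory Num.Theory.
Import numFieldNormedType.Exports.

Local Open Scope classical_set_scope.
Local Open Scope ring_scope.
Local Open Scope complex_scope.

Local Notation ReC := (@complex.Re _).
Local Notation ImC := (@complex.Im _).

Definition sqmod (R : realType) (z : R[i]) : R := ReC z ^+ 2 + ImC z ^+ 2.

Lemma mulcJ (R : realType) (z : R[i]) : z * z^* = (sqmod z)%:C.
Proof.
case: z => a b; apply/eqP; rewrite eq_complex /sqmod /=.
by rewrite !mulrN opprK -!expr2 eqxx /= [b * a]mulrC addNr.
Qed.

Lemma form_density (R : realType) (a b c : R[i]) (k w : R) :
  (a * a^* + b * b^* + k%:C * (c * c^*)) * w%:C =
  ((sqmod a + sqmod b + k * sqmod c) * w)%:C.
Proof. by rewrite !mulcJ -!rmorphM -!rmorphD -rmorphM. Qed.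

Section ComplexLebesgue.
Context {d : measure_display} {T : measurableType d} {R : realType}.
Variables (mu : {measure set T -> \bar R}) (D : set T).

Definition cmeasurable (u : T -> R[i]) : Prop :=
  measurable_fun D (ReC \o u) /\ measurable_fun D (ImC \o u).

Definition cintegrable (u : T -> R[i]) : Prop :=
  mu.-integrable D (EFin \o (ReC \o u)) /\
  mu.-integrable D (EFin \o (ImC \o u)).

Definition cintegral (u : T -> R[i]) : R[i] :=
  Rintegral mu D (ReC \o u) +i* Rintegral mu D (ImC \o u).

Definition aeeq (u v : T -> R[i]) : Prop :=
  {ae mu, forall x, D x -> u x = v x}.

End ComplexLebesgue.

(* The Hilbert space L^2(D; w dmu), for a measurable set D and a measurable
   weight w that is positive on D.  Its elements are represented by functions
   on T; only their values on D matter, and they are identified when they are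
   equal mu-almost everywhere on D. *)
Section WeightedL2.
Context {d : measure_display} {T : measurableType d} {R : realType}.
Variables (mu : {measure set T -> \bar R}) (D : set T) (w : T -> R).

Definition sqnormL2 (u : T -> R[i]) : \bar R :=
  (\int[mu]_(x in D) (sqmod (u x) * w x)%:E)%E.

Definition L2 (u : T -> R[i]) : Prop :=
  cmeasurable D u /\ (sqnormL2 u < +oo)%E.

Definition innerL2 (u v : T -> R[i]) : R[i] :=
  cintegral mu D (fun x => u x * (v x)^* * (w x)%:C).

(* Domain of the closure of the quadratic form q with domain C. *)
Definition form_closure_dom (C : set (T -> R[i])) (q : (T -> R[i]) -> \bar R)
    : set (T -> R[i]) :=
  [set u | L2 u /\ exists s : nat -> T -> R[i],
    [/\ forall n, C (s n),
        sqnormL2 (s n \- u)%R @[n --> \oo] --> 0%E &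
        forall e : R, 0 < e -> exists N : nat, forall n m : nat,
          (N <= n)%N -> (N <= m)%N -> (q (s n \- s m)%R < e%:E)%E]].

(* The operator associated by the first representation theorem with the closed
   sesquilinear form a (linear in its first argument) with domain V, given by
   its graph. *)
Definition form_operator (V : set (T -> R[i]))
    (a : (T -> R[i]) -> (T -> R[i]) -> R[i]) (u f : T -> R[i]) : Prop :=
  [/\ V u, L2 f & forall v, V v -> a u v = innerL2 f v].

(* Resolvent set and spectrum of the operator with graph A.  The equation
   (A - lam) u = f is written A u = f + lam u. *)
Definition resolvent_set (A : (T -> R[i]) -> (T -> R[i]) -> Prop) : set R[i] :=
  [set lam |
    [/\ forall u, A u (fun x => lam * u x) -> aeeq mu D u (fun=> 0),
        forall f, L2 f -> exists u, A u (fun x => f x + lam * u x) &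
        exists c : R, forall u f, L2 f -> A u (fun x => f x + lam * u x) ->
          (sqnormL2 u <= c%:E * sqnormL2 f)%E]].

Definition spectrum (A : (T -> R[i]) -> (T -> R[i]) -> Prop) : set R[i] :=
  ~` resolvent_set A.

(* The spectrum of a self-adjoint operator is real, so taking real parts
   loses nothing. *)
Definition inf_spectrum (A : (T -> R[i]) -> (T -> R[i]) -> Prop) : \bar R :=
  ereal_inf [set (ReC lam)%:E | lam in spectrum A].

End WeightedL2.

Section Smooth.
Context {R : realType} {V : normedModType R}.

(* Iterated directional derivatives; f is C^oo iff all of them are
   (Frechet) differentiable everywhere. *)
Definition iter_derive (f : V -> R) (s : seq V) : V -> R :=
  foldr (fun v g => 'D_v g) f s.

Definition smooth (f : V -> R) : Prop :=
  forall (s : seq V) (x : V), differentiable (iter_derive f s) x.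

Definition csmooth (u : V -> R[i]) : Prop :=
  smooth (ReC \o u) /\ smooth (ImC \o u).

Definition cderive (v : V) (u : V -> R[i]) (x : V) : R[i] :=
  'D_v (ReC \o u) x +i* 'D_v (ImC \o u) x.

End Smooth.

Section ConicalLayer.
Context {R : realType}.
Implicit Types (theta omega : R) (m : int).

Notation leb1 := (@lebesgue_measure R).

Definition leb2 := (leb1 \x leb1)%E.
Definition leb3 := (leb2 \x leb1)%E.

(* Points of the half-plane are p = (r, z). *)
Definition Gui theta : set (R * R) :=
  [set p | [/\ 0 < p.1, - (pi / sin theta) < p.2,
               Num.max 0 (p.2 * tan theta) < p.1 &
               p.1 < p.2 * tan theta + pi / cos theta]].

(* Functions on Gui * S^1 are represented by functions of ((r, z), phi) which
   are integrated over the fundamental domain 0 <= phi < 2 pi. *)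
Definition circle : set R := `[0, 2 * pi[.

Definition Lay theta : set (R * R * R) := Gui theta `*` circle.

Definition rad2 (p : R * R) : R := p.1.
Definition rad3 (p : R * R * R) : R := p.1.1.

Definition L2Gui theta := L2 leb2 (Gui theta) rad2.

(* Smoothness on the circle is smoothness of the 2 pi-periodic lift to R.
   As the support is compact, extension by 0 outside of Gui is smooth. *)
Definition Cc_Lay theta : set (R * R * R -> R[i]) :=
  [set u | [/\ csmooth u,
    forall p phi, u (p, phi + 2 * pi) = u (p, phi) &
    exists K : set (R * R), [/\ compact K, K `<=` Gui theta &
      forall p phi, ~ K p -> u (p, phi) = 0]]].

Definition d_r : R * R * R := (1, 0, 0).
Definition d_z : R * R * R := (0, 1, 0).
Definition d_phi : R * R * R := (0, 0, 1).

Definition Qform0 omega theta (u : R * R * R -> R[i]) : \bar R :=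
  (\int[leb3]_(x in Lay theta)
    ((sqmod (cderive d_r u x) + sqmod (cderive d_z u x) +
      sqmod ((0 +i* 1)%C * cderive d_phi u x - omega%:C * u x) / rad3 x ^+ 2)
     * rad3 x)%:E)%E.

Definition dom_Q omega theta : set (R * R * R -> R[i]) :=
  form_closure_dom leb3 (Lay theta) rad3 (Cc_Lay theta) (Qform0 omega theta).

Definition v_ m (phi : R) : R[i] :=
  ((Num.sqrt (2 * pi))^-1)%:C * (cos (m%:~R * phi) +i* sin (m%:~R * phi)).

Definition fourier m (u : R * R * R -> R[i]) (p : R * R) : R[i] :=
  cintegral leb1 circle (fun phi => u (p, phi) * (v_ m phi)^*).

(* Distributional derivatives on an open subset D of the half-plane, with
   respect to the flat measure dr dz. *)
Definition Cc2 (D : set (R * R)) : set (R * R -> R[i]) :=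
  [set psi | csmooth psi /\ exists K : set (R * R),
    [/\ compact K, K `<=` D & forall p, ~ K p -> psi p = 0]].

Definition cloc_integrable (D : set (R * R)) (u : R * R -> R[i]) : Prop :=
  cmeasurable D u /\
  forall K : set (R * R), compact K -> K `<=` D -> cintegrable leb2 K u.

Definition is_weak_derive (D : set (R * R)) (e : R * R) (u g : R * R -> R[i])
    : Prop :=
  cloc_integrable D g /\
  forall psi, Cc2 D psi ->
    cintegral leb2 D (fun p => u p * cderive e psi p) =
    - cintegral leb2 D (fun p => g p * psi p).

(* The weak derivative is unique up to null sets; the value is junk when there
   is none. *)
Definition weak_derive (D : set (R * R)) (e : R * R) (u : R * R -> R[i])
    : R * R -> R[i] :=
  xget (fun=> 0) [set g | is_weak_derive D e u g].

Definition dom_f m omega theta : set (R * R -> R[i]) :=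
  [set f | L2Gui theta f /\
    exists2 u, dom_Q omega theta u & aeeq leb2 (Gui theta) f (fourier m u)].

(* The quadratic form of the fiber, and the sesquilinear form it is the
   diagonal of. *)
Definition fiber_quad m omega theta (u : R * R -> R[i]) : R :=
  let D := Gui theta in
  Rintegral leb2 D (fun p =>
    (sqmod (weak_derive D (1, 0) u p) + sqmod (weak_derive D (0, 1) u p) +
     (m%:~R - omega) ^+ 2 / rad2 p ^+ 2 * sqmod (u p)) * rad2 p).

Definition fiber_form m omega theta (u v : R * R -> R[i]) : R[i] :=
  let D := Gui theta in
  cintegral leb2 D (fun p =>
    (weak_derive D (1, 0) u p * (weak_derive D (1, 0) v p)^* +
     weak_derive D (0, 1) u p * (weak_derive D (0, 1) v p)^* +
     ((m%:~R - omega) ^+ 2 / rad2 p ^+ 2)%:C * (u p * (v p)^*)) *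
    (rad2 p)%:C).

Lemma fiber_form_diag m omega theta u :
  fiber_form m omega theta u u = (fiber_quad m omega theta u)%:C.
Proof.
rewrite /fiber_form /cintegral /fiber_quad; congr (_ +i* _).
  by apply: eq_Rintegral => p _; rewrite /comp form_density.
transitivity (Rintegral leb2 (Gui theta) (fun=> 0 : R)).
  by apply: eq_Rintegral => p _; rewrite /comp form_density.
by rewrite /Rintegral integral0_eq.
Qed.

Definition fiber m omega theta : (R * R -> R[i]) -> (R * R -> R[i]) -> Prop :=
  form_operator leb2 (Gui theta) rad2 (dom_f m omega theta)
    (fiber_form m omega theta).

Definition inf_sigma_fiber m omega theta : \bar R :=
  inf_spectrum leb2 (Gui theta) rad2 (fiber m omega theta).

End ConicalLayer.

(* Main.v *)
From HB Require Import structures.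
Require Import Defs.
From mathcomp Require Import all_boot all_order all_algebra.
From mathcomp Require Import ring lra.
From mathcomp Require Import complex.
From mathcomp Require Import all_classical all_reals all_analysis.
From mathcomp Require Import measurable_realfun.

(** Why the theorem is true.  The fiber acts on the guide as
    - d_r^2 - d_r / r - d_z^2 + (m - omega)^2 / r^2, with Dirichlet conditions.
    For an integer m other than 0 and omega in (0, 1/2] the distance from m to
    omega is at least 1/2, so the centrifugal term is at least 1 / (4 r^2), which
    is exactly what the substitution u = r^(-1/2) v loses.  What remains is the
    flat Dirichlet Laplacian on the guide.  The guide lies in a strip of width pi,
    and the first Dirichlet eigenvalue of that strip is 1.

    For smooth functions with compact support this is one weighted identity
    (test_poincare): the positive function r^(-1/2) sin(d), where d is the distance
    to a boundary line of the strip, is a ground state at energy 1 of the operator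
    with centrifugal term 1 / (4 r^2), and completing the square with it yields
    the bound 1.

    The spectrum is defined as the complement of a set of complex numbers, so the
    work is to show that every lam with real part below 1 is in the resolvent set.
    Complex functions are pairs of real ones, and the equation (F - lam) u = f is a
    coupled system of two real equations.  It is solved by the Riesz theorem for
    the real closure of the test functions (coupled_riesz, real_resolvent), whose
    elements are triples of a function and its two partial derivatives (form_dom).
    Three facts connect these triples with the operator of the statement.
    - The weak derivatives of the function of a triple are its two other entries
      (weak_derive_ae), by integration by parts for test functions, a limit, and
      the fundamental lemma of the calculus of variations (weak_null_ae).
    - A function built from two triples belongs to the form domain of the fiber
      (form_dom_dom_f): multiplied by the angular mode, its approximating test
      functions converge in the layer.
    - Conversely every element of that domain arises in this way
      (dom_f_form_dom): Fourier coefficients of smooth functions on the layer are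
      test functions on the guide (smooth_circle_integral), and the inequality of
      Bessel and the theorem of Tonelli bound their energy by the energy on the
      layer (mode_energy_le, mode_limit_le).
    The angular mode of number m is an eigenvector of i d_phi - omega for the value
    - (m + omega), so the domain comes with the coefficient (m + omega)^2 and the
    form with (m - omega)^2.  Both are at least 1/4, and by the bound above all
    such coefficients define equivalent norms on the test functions.

    Testing the equation with its own solution gives the estimate
    (1 - Re lam) |u| <= |f| (resolvent_bound), hence injectivity and continuity of
    the inverse. *)

Set Implicit Arguments.
Unset Strict Implicit.
Unset Printing Implicit Defensive.

Import Order.TTheory GRing.Theory Num.Theory.
Import numFieldNormedType.Exports.

Local Open Scope classical_set_scope.
Local Open Scope ring_scope.

(** * The Riesz representation theorem *)

Section Riesz.
Context {R : realType} {X : lmodType R}.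
Variable K : X -> Prop.
Hypothesis Klin : forall a x y, K x -> K y -> K (a *: x + y).
Hypothesis K0 : K 0.

(** The spaces in use are sets of functions that carry no quotient, so linear
    forms, inner products and completeness are relative to a subspace K, and
    inner products may be degenerate. *)
Definition linear_on (l : X -> R) : Prop :=
  forall a x y, K x -> K y -> l (a *: x + y) = a * l x + l y.

Definition semi_inner (e : X -> X -> R) : Prop :=
  [/\ forall x y, K x -> K y -> e x y = e y x,
      forall z, K z -> linear_on (e ^~ z) &
      forall x, K x -> 0 <= e x x].

(** Limits are stated through the seminorm of e; no topology is put on X. *)
Definition complete_on (e : X -> X -> R) : Prop :=
  forall s : nat -> X, (forall n, K (s n)) ->
    (forall c : R, 0 < c -> exists N, forall n m, (N <= n)%N -> (N <= m)%N ->
       e (s n - s m) (s n - s m) < c) ->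
    exists2 x, K x & forall c : R, 0 < c -> exists N, forall n, (N <= n)%N ->
       e (s n - x) (s n - x) < c.

Lemma linear_on0 l : linear_on l -> l 0 = 0.
Proof.
move=> h; have := h (-1) 0 0 K0 K0.
by rewrite scaler0 addr0 mulN1r addNr.
Qed.

Lemma linear_onZ l a x : linear_on l -> K x -> l (a *: x) = a * l x.
Proof. by move=> h Kx; have := h a x 0 Kx K0; rewrite !addr0 linear_on0// addr0. Qed.

Lemma linear_onD l x y : linear_on l -> K x -> K y -> l (x + y) = l x + l y.
Proof. by move=> h Kx Ky; have := h 1 x y Kx Ky; rewrite scale1r mul1r. Qed.

Lemma linear_onB l x y : linear_on l -> K x -> K y -> l (x - y) = l x - l y.
Proof.
move=> h Kx Ky; have := h (-1) y x Ky Kx.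
by rewrite scaleN1r mulN1r addrC [RHS]addrC.
Qed.

Lemma subspaceZ a x : K x -> K (a *: x).
Proof. by move=> Kx; rewrite -[_ *: _]addr0; exact: Klin. Qed.

Lemma subspaceD x y : K x -> K y -> K (x + y).
Proof. by move=> Kx Ky; rewrite -[x]scale1r; exact: Klin. Qed.

Lemma subspaceB x y : K x -> K y -> K (x - y).
Proof. by move=> Kx Ky; rewrite addrC -scaleN1r; exact: Klin. Qed.

(** A quadratic polynomial that is nonnegative on the line has a nonpositive
    discriminant; the case c = 0 forces b = 0. *)
Lemma discriminant_le (a b c : R) : (forall t, 0 <= a + 2 * t * b + t ^+ 2 * c) ->
  b ^+ 2 <= a * c.
Proof.
move=> h.
have a0 : 0 <= a by have := h 0; lra.
have [c0|c0|c0] := ltgtP c 0.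
- (* a large t makes the quadratic negative *)
  have := h ((a + 1 + `|b|) / - c * 2 + 1); have := h (- ((a + 1 + `|b|) / - c * 2 + 1)).
  set k := _ / _; have k0 : 0 <= k by apply: divr_ge0; [have := normr_ge0 b; lra|lra].
  have kc : k * - c = a + 1 + `|b| by rewrite /k -mulrA mulVf ?mulr1// oppr_eq0 lt_eqF.
  have := normr_ge0 b; nra.
- have cn0 : c != 0 by rewrite gt_eqF.
  have := h (- b / c).
  have -> : a + 2 * (- b / c) * b + (- b / c) ^+ 2 * c = (a * c - b ^+ 2) / c.
    by field.
  by rewrite pmulr_lge0 ?invr_gt0// subr_ge0.
- rewrite c0 mulr0; have [->|b0] := eqVneq b 0; first by rewrite expr0n.
  have := h (- (a + 1) / (2 * b)); rewrite c0 mulr0 addr0.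
  have -> : a + 2 * (- (a + 1) / (2 * b)) * b = - 1 by field.
  by rewrite lerNr oppr0 ler10.
Qed.

Section form.
Variable e : X -> X -> R.
Hypothesis he : semi_inner e.

Lemma inner_sym x y : K x -> K y -> e x y = e y x. Proof. by case: he => h _ _; exact: h. Qed.
Lemma inner_linl z : K z -> linear_on (e ^~ z). Proof. by case: he => _ h _; exact: h. Qed.
Lemma inner_linr z : K z -> linear_on (e z).
Proof.
move=> Kz a x y Kx Ky; rewrite inner_sym//; last exact: Klin.
by rewrite (inner_linl Kz)// (inner_sym Kx Kz) (inner_sym Ky Kz).
Qed.
Lemma inner_expand t x y : K x -> K y ->
  e (x + t *: y) (x + t *: y) = e x x + 2 * t * e x y + t ^+ 2 * e y y.
Proof.
move=> Kx Ky; have Kty := subspaceZ t Ky; have Ks := subspaceD Kx Kty.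
rewrite (linear_onD (inner_linl Ks))// (linear_onZ _ (inner_linl Ks))//.
rewrite (linear_onD (inner_linr Kx))// (linear_onD (inner_linr Ky))// (linear_onZ _ (inner_linr Kx))//.
by rewrite (linear_onZ _ (inner_linr Ky))// (inner_sym Ky Kx); ring.
Qed.

Lemma cauchy_schwarz x y : K x -> K y -> e x y ^+ 2 <= e x x * e y y.
Proof.
move=> Kx Ky; apply: discriminant_le => t; rewrite -inner_expand//.
by case: he => _ _; apply; apply: subspaceD => //; exact: subspaceZ.
Qed.

(** The representing vector minimizes J x = e x x - 2 l x.  A minimizing sequence
    is a Cauchy sequence by the parallelogram identity, and the first variation
    of J at the limit is the equation. *)
Lemma riesz l (C : R) : complete_on e -> 0 <= C -> linear_on l ->
  (forall x, K x -> l x ^+ 2 <= C * e x x) ->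
  exists2 x, K x & forall y, K y -> e x y = l y.
Proof.
move=> hc C0 hl hC.
have epos x : K x -> 0 <= e x x by case: he => _ _; apply.
pose J x := e x x - 2 * l x.
have JC x : K x -> - C <= J x.
  move=> Kx; have := hC x Kx; have := epos x Kx; rewrite /J => q0 h.
  have h4 : (2 * l x) ^+ 2 <= (C + e x x) ^+ 2.
    have : 0 <= (C - e x x) ^+ 2 by exact: sqr_ge0.
    nra.
  have h5 : 0 <= C + e x x by lra.
  rewrite -(ger0_norm h5) -ler_sqrt ?sqr_ge0// !sqrtr_sqr normr_id in h4 *.
  have := ler_norm (2 * l x); have := ger0_norm h5; lra.
pose S := [set J x | x in [set x | K x]].
have hS : has_inf S.
  by split; [exists (J 0), 0|exists (- C) => _ [x Kx <-]; exact: JC].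
have dJ x : K x -> inf S <= J x.
  by move=> Kx; apply: ge_inf; [case: hS|exists x].
have ex n : exists x, K x /\ J x < inf S + n.+1%:R^-1.
  have n0 : 0 < n.+1%:R^-1 :> R by rewrite invr_gt0.
  have [] := inf_adherent n0 hS.
  by move=> _ [x Kx <-] h; exists x.
have [s hs] := choice ex.
have Ks n : K (s n) := (hs n).1.
(* the value of J at the midpoint of s n and s m is at least the infimum *)
have par n m : e (s n - s m) (s n - s m) <= 2 * n.+1%:R^-1 + 2 * m.+1%:R^-1.
  pose h := 2^-1 *: (s n + s m).
  have Kh : K h by apply/subspaceZ/subspaceD.
  have E1 : e (s n - s m) (s n - s m) = e (s n) (s n) - 2 * e (s n) (s m) + e (s m) (s m).
    by rewrite -scaleN1r inner_expand//; ring.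
  have E2 : e h h = 4^-1 * (e (s n) (s n) + 2 * e (s n) (s m) + e (s m) (s m)).
    have Kd := subspaceD (Ks n) (Ks m).
    rewrite /h (linear_onZ _ (inner_linl Kh))// (linear_onZ _ (inner_linr Kd))//.
    have := inner_expand 1 (Ks n) (Ks m); rewrite scale1r => ->; by field.
  have E3 : l h = 2^-1 * (l (s n) + l (s m)) by rewrite /h linear_onZ// ?linear_onD//; exact: subspaceD.
  have := dJ h Kh; have := (hs n).2; have := (hs m).2; rewrite /J E1 E2 E3.
  move: (n.+1%:R^-1) (m.+1%:R^-1) => a b; lra.
have cauchy (c : R) : 0 < c -> exists N, forall n m, (N <= n)%N -> (N <= m)%N ->
    e (s n - s m) (s n - s m) < c.
  move=> c0; have [N hN] : exists N : nat, forall n, (N <= n)%N -> n.+1%:R^-1 < c / 4.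
    have c4 : 0 < c / 4 by lra.
    have /cvgrPdist_lt /(_ _ c4) [N _ hN] := @cvg_harmonic R.
    by exists N => n /hN; rewrite sub0r normrN ger0_norm// invr_ge0.
  exists N => n m /hN h1 /hN h2; apply: le_lt_trans (par n m) _.
  move: (n.+1%:R^-1) (m.+1%:R^-1) h1 h2 => a b; lra.
have [x Kx hx] := hc s Ks cauchy.
exists x => // y Ky.
(* J (s n + t y) is at least the infimum for all t: a discriminant again *)
have gn n : (e (s n) y - l y) ^+ 2 <= n.+1%:R^-1 * e y y.
  apply: discriminant_le => t.
  have Kt := subspaceZ t Ky; have := dJ _ (subspaceD (Ks n) Kt).
  rewrite /J inner_expand// linear_onD// linear_onZ//; have := (hs n).2; rewrite /J.
  move: (n.+1%:R^-1) => a; lra.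
have hsm (c : R) : 0 < c -> (e x y - l y) ^+ 2 <= c * (4 * e y y).
  move=> c0; have [N1 hN1] := hx c c0.
  have /cvgrPdist_lt /(_ _ c0) [N2 _ hN2] := @cvg_harmonic R.
  pose n := maxn N1 N2.
  have h1 := hN1 n (leq_maxl _ _).
  have := hN2 n (leq_maxr _ _); rewrite /= sub0r normrN ger0_norm ?invr_ge0// => h2.
  have h3 := cauchy_schwarz (subspaceB (Ks n) Kx) Ky.
  rewrite (linear_onB (inner_linl Ky))// in h3.
  have h4 := gn n; have q0 := epos y Ky.
  have h5 : (e (s n) y - e x y) ^+ 2 <= c * e y y.
    by apply: le_trans h3 _; apply: ler_wpM2r => //; exact: ltW.
  have h6 : (e (s n) y - l y) ^+ 2 <= c * e y y.
    by apply: le_trans h4 _; apply: ler_wpM2r => //; exact: ltW.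
  have : 0 <= ((e (s n) y - e x y) + (e (s n) y - l y)) ^+ 2 by exact: sqr_ge0.
  nra.
apply/eqP; rewrite -subr_eq0 -sqrf_eq0; apply/eqP/le_anti.
rewrite sqr_ge0 andbT; apply/ler_addgt0Pl => c c0; rewrite addr0.
have q1 : 0 < 4 * e y y + 1 by have := epos y Ky; lra.
have := hsm (c / (4 * e y y + 1)) (divr_gt0 c0 q1).
move=> /le_trans; apply; rewrite mulrAC ler_pdivrMr// ler_pM2l//; lra.
Qed.

End form.

(** The system is (A - (alpha + i beta)) u = f split into real and imaginary
    parts.  Eliminating the second unknown leaves the symmetric form
    e(x, y) + beta^2 e(T x, T y), T being the operator of s with respect to e, so
    that the symmetric Riesz theorem suffices for a complex spectral parameter. *)
Lemma coupled_riesz e s (b C C0 C1 : R) l0 l1 :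
  semi_inner e -> complete_on e -> 0 <= C -> 0 <= C0 -> 0 <= C1 ->
  (forall x y, K x -> K y -> s x y = s y x) ->
  (forall z, K z -> linear_on (s ^~ z)) ->
  (forall x y, K x -> K y -> s x y ^+ 2 <= C * e x x * e y y) ->
  linear_on l0 -> linear_on l1 ->
  (forall x, K x -> l0 x ^+ 2 <= C0 * e x x) ->
  (forall x, K x -> l1 x ^+ 2 <= C1 * e x x) ->
  exists x0 x1, [/\ K x0, K x1,
    forall y, K y -> e x0 y + b * s x1 y = l0 y &
    forall y, K y -> e x1 y - b * s x0 y = l1 y].
Proof.
move=> he hc C_ge0 C0_ge0 C1_ge0 ssym slin sC hl0 hl1 hC0 hC1.
have epos x : K x -> 0 <= e x x by case: he => _ _; apply.
have slinr z : K z -> linear_on (s z).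
  move=> Kz a x y Kx Ky; rewrite ssym//; last exact: Klin.
  by rewrite slin// (ssym x z) ?(ssym y z).
have [r1 Kr1 hr1] := riesz he hc C1_ge0 hl1 hC1.
have exT x : exists tx, K x -> K tx /\ forall y, K y -> e tx y = s x y.
  have [Kx|nKx] := pselect (K x); last by exists 0.
  have [||tx Ktx htx] := riesz he hc _ (slinr x Kx) (C := C * e x x).
  - by rewrite mulr_ge0// epos.
  - by move=> y Ky; apply: sC.
  by exists tx.
have [T hT] := choice exT.
have KT x : K x -> K (T x) by move=> /hT[].
have eT x y : K x -> K y -> e (T x) y = s x y by move=> /hT[_]; apply.
have eTbd x : K x -> e (T x) (T x) <= C * e x x.
  move=> Kx; have KTx := KT x Kx.
  have := sC x (T x) Kx KTx; rewrite -eT//.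
  have [->|q0] := eqVneq (e (T x) (T x)) 0; first by rewrite mulr_ge0// epos.
  have q1 : 0 < e (T x) (T x) by rewrite lt_neqAle eq_sym q0 epos.
  by rewrite expr2 ler_pM2r.
(* substituting x1 = r1 + b T x0 into the first equation gives this form *)
pose e2 x y := e x y + b ^+ 2 * e (T x) (T y).
have he2 : semi_inner e2.
  split=> [x y Kx Ky|z Kz a x y Kx Ky|x Kx].
  - by rewrite /e2 (inner_sym he Kx Ky) (inner_sym he (KT _ Kx) (KT _ Ky)).
  - have KTz := KT z Kz; have Kl := Klin a Kx Ky.
    by rewrite /e2 !eT// (inner_linl he Kz)// slin//; ring.
  - by rewrite /e2 addr_ge0// ?epos// mulr_ge0 ?sqr_ge0// epos//; exact: KT.
have hle x : K x -> e x x <= e2 x x.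
  by move=> Kx; rewrite /e2 lerDl mulr_ge0 ?sqr_ge0// epos//; exact: KT.
have hge x : K x -> e2 x x <= (1 + b ^+ 2 * C) * e x x.
  move=> Kx; rewrite /e2 mulrDl mul1r lerD2l -mulrA ler_wpM2l ?sqr_ge0//.
  exact: eTbd.
have M0 : 0 < 1 + b ^+ 2 * C by rewrite ltr_wpDr// mulr_ge0// sqr_ge0.
have hc2 : complete_on e2.
  move=> u Ku hu; have [|x Kx hx] := hc u Ku.
    move=> c /hu[N hN]; exists N => n m nN mN.
    by apply: le_lt_trans (hN n m nN mN); apply: hle; exact: subspaceB.
  exists x => // c c0; have [N hN] := hx _ (divr_gt0 c0 M0).
  exists N => n /hN h; apply: le_lt_trans (hge _ _) _; first exact: subspaceB.
  by rewrite mulrC -ltr_pdivlMr.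
pose l y := l0 y - b * s r1 y.
have hl : linear_on l.
  by move=> a x y Kx Ky; rewrite /l hl0// slinr//; ring.
have hCl_ge0 : 0 <= 2 * C0 + 2 * b ^+ 2 * (C * e r1 r1).
  have b2 := sqr_ge0 b; have := mulr_ge0 C_ge0 (epos _ Kr1) => h.
  have := mulr_ge0 b2 h; lra.
have hCl x : K x -> l x ^+ 2 <= (2 * C0 + 2 * b ^+ 2 * (C * e r1 r1)) * e2 x x.
  move=> Kx; have h0 := hC0 x Kx; have h1 := sC r1 x Kr1 Kx.
  apply: (@le_trans _ _ ((2 * C0 + 2 * b ^+ 2 * (C * e r1 r1)) * e x x)).
    have hb : b ^+ 2 * s r1 x ^+ 2 <= b ^+ 2 * (C * e r1 r1 * e x x).
      by apply: ler_wpM2l => //; exact: sqr_ge0.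
    have : 0 <= (l0 x + b * s r1 x) ^+ 2 by exact: sqr_ge0.
    rewrite /l; nra.
  apply: ler_wpM2l; last exact: hle.
  exact: hCl_ge0.
have [|x0 Kx0 hx0] := riesz he2 hc2 _ hl hCl.
  exact: hCl_ge0.
have KTx0 := KT _ Kx0.
exists x0, (r1 + b *: T x0); split => //; first by apply: subspaceD => //; exact: subspaceZ.
- move=> y Ky; have Kb := subspaceZ b KTx0; have := hx0 y Ky.
  rewrite /e2 /l (linear_onD (slin y Ky))// (linear_onZ _ (slin y Ky))//.
  rewrite (inner_sym he KTx0 (KT _ Ky)) eT// (ssym y)//; lra.
- move=> y Ky; have Kb := subspaceZ b KTx0; rewrite (linear_onD (inner_linl he Ky))//.
  by rewrite (linear_onZ _ (inner_linl he Ky))// hr1// eT//; ring.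
Qed.

End Riesz.

(** * Real weighted spaces of square integrable functions *)

Section RealL2.
Context {d : measure_display} {T : measurableType d} {R : realType}.
Variables (mu : {measure set T -> \bar R}) (D : set T) (w : T -> R).

Definition sqint (f : T -> R) : Prop :=
  measurable_fun D f /\ mu.-integrable D (EFin \o (fun x => f x ^+ 2 * w x)).

Definition ip (f g : T -> R) : R := Rintegral mu D (fun x => f x * g x * w x).

Hypothesis mD : measurable D.
Hypothesis mw : measurable_fun D w.
Hypothesis w_gt0 : forall x, D x -> 0 < w x.

Lemma sqw_ge0 (f : T -> R) x : D x -> 0 <= f x ^+ 2 * w x.
Proof. by move=> Dx; rewrite mulr_ge0 ?sqr_ge0// ltW// w_gt0. Qed.

Lemma sqint_integrableM f g : sqint f -> sqint g ->
  mu.-integrable D (EFin \o (fun x => f x * g x * w x)).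
Proof.
move=> [mf If] [mg Ig].
apply: le_integrable (integrableD mD If Ig) => //.
  by apply/measurable_EFinP; apply: measurable_funM => //; exact: measurable_funM.
move=> x Dx; have w0 := ltW (w_gt0 Dx).
rewrite /= lee_fin -mulrDl !(normrM _ (w x)) (ger0_norm w0) ler_wpM2r//.
rewrite [leRHS]ger0_norm ?addr_ge0 ?sqr_ge0// ler_norml.
have := sqr_ge0 (f x - g x); have := sqr_ge0 (f x + g x) => h1 h2.
by apply/andP; split; nra.
Qed.

Lemma sqintP (f : T -> R) : measurable_fun D f ->
  (\int[mu]_(x in D) (f x ^+ 2 * w x)%:E < +oo)%E -> sqint f.
Proof.
move=> mf h; split=> //; apply/integrableP; split.
  by apply/measurable_EFinP; apply: measurable_funM => //; exact: measurable_funX.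
under eq_integral => x xD.
  rewrite gee0_abs; last by rewrite lee_fin mulr_ge0 ?sqr_ge0// ltW// w_gt0//; exact: set_mem.
  over.
by [].
Qed.

Lemma sqint_meas f : sqint f -> measurable_fun D (fun x => (f x ^+ 2 * w x)%:E).
Proof. by case=> _ /measurable_int. Qed.

Lemma ipE f : sqint f ->
  (ip f f)%:E = (\int[mu]_(x in D) (f x ^+ 2 * w x)%:E)%E.
Proof.
move=> hf; rewrite /ip /Rintegral fineK; first by apply: eq_integral => x _; rewrite expr2.
exact: (integrable_fin_num mD (sqint_integrableM hf hf)).
Qed.

Lemma sqint_lin (a : R) f g : sqint f -> sqint g -> sqint (a *: f + g).
Proof.
move=> hf hg; have [mf If] := hf; have [mg Ig] := hg; split.
  by apply: measurable_funD => //; exact: measurable_funM.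
have I1 := sqint_integrableM hf hg.
have := integrableD mD (integrableZl mD (a ^+ 2) If)
  (integrableD mD (integrableZl mD (2 * a) I1) Ig).
apply: eq_integrable => // x _; rewrite /= -!EFinM -!EFinD; congr EFin.
by rewrite -[(a *: f + g) x]/(a * f x + g x); ring.
Qed.

Lemma sqint0 : sqint 0.
Proof.
split; first exact: measurable_cst.
apply: eq_integrable (integrable0 mu D) => // x _ /=.
by rewrite -[(0 : T -> R) x]/(0 : R) expr0n mul0r.
Qed.

Lemma sqintB f g : sqint f -> sqint g -> sqint (f - g).
Proof. by move=> hf hg; rewrite addrC -scaleN1r; exact: sqint_lin. Qed.

Lemma ipC f g : ip f g = ip g f.
Proof. by apply: eq_Rintegral => x _; rewrite (mulrC (f x)). Qed.

Lemma ip_lin a f g h : sqint f -> sqint g -> sqint h ->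
  ip (a *: f + g) h = a * ip f h + ip g h.
Proof.
move=> hf hg hh; have I1 := sqint_integrableM hf hh; have I2 := sqint_integrableM hg hh.
rewrite /ip -RintegralZl// -RintegralD//; last exact: (integrableZl mD a I1).
by apply: eq_Rintegral => x _; rewrite -[(a *: f + g) x]/(a * f x + g x); ring.
Qed.

Lemma ip_ge0 f : 0 <= ip f f.
Proof.
by apply: Rintegral_ge0 => x Dx; rewrite -expr2 mulr_ge0 ?sqr_ge0// ltW// w_gt0.
Qed.

Lemma ip_semi_inner : semi_inner sqint ip.
Proof.
split=> [x y _ _|z Kz a x y Kx Ky|x _]; [exact: ipC|exact: ip_lin|exact: ip_ge0].
Qed.

Lemma ip_split f g h : sqint f -> sqint g -> sqint h ->
  ip (f - h) (f - h) <= 2 * ip (f - g) (f - g) + 2 * ip (g - h) (g - h).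
Proof.
move=> hf hg hh; have h1 := sqintB hf hg; have h2 := sqintB hg hh.
have h3 := sqintB hf hh; rewrite /ip -!RintegralZl//; do ?exact: sqint_integrableM.
have I1 := integrableZl mD 2 (sqint_integrableM h1 h1).
have I2 := integrableZl mD 2 (sqint_integrableM h2 h2).
rewrite -RintegralD//.
apply: le_Rintegral => //; first exact: sqint_integrableM.
  exact: (integrableD mD I1 I2).
move=> x Dx; have w0 := ltW (w_gt0 Dx).
rewrite -[(f - h) x]/(f x - h x) -[(f - g) x]/(f x - g x) -[(g - h) x]/(g x - h x).
have -> : 2 * ((f x - g x) * (f x - g x) * w x) + 2 * ((g x - h x) * (g x - h x) * w x)
  = (2 * (f x - g x) ^+ 2 + 2 * (g x - h x) ^+ 2) * w x by ring.
by rewrite ler_wpM2r//; have := sqr_ge0 (f x - g x - (g x - h x)); nra.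
Qed.

Lemma geom_cauchy_cvg (u : nat -> R) (C : R) :
  (forall k, `|u k.+1 - u k| <= C * 2^-1 ^+ k) -> cvgn u.
Proof.
move=> h; have -> : u = (fun n => u 0%N + series (telescope u) n).
  by apply/funext => n; exact: eq_sum_telescope.
apply: is_cvgD; first exact: is_cvg_cst.
apply: normed_cvg; apply: (@series_le_cvg _ _ (geometric C 2^-1)).
- by move=> n; exact: normr_ge0.
- by move=> n; apply: le_trans (h n); exact: normr_ge0.
- by move=> n; exact: h.
- by apply: is_cvg_geometric_series; rewrite ger0_norm; lra.
Qed.

(** The classical argument of Riesz and Fischer.  Along a fast subsequence the
    series of the weighted squares of the increments, multiplied by 4^k, has a
    finite integral, so almost everywhere the increments decay geometrically;
    the lemma of Fatou identifies the pointwise limit as the limit in norm. *)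
Lemma L2_complete (s : nat -> T -> R) : (forall n, sqint (s n)) ->
  (forall c : R, 0 < c -> exists N, forall n m, (N <= n)%N -> (N <= m)%N ->
     ip (s n - s m) (s n - s m) < c) ->
  exists2 f, sqint f & forall c : R, 0 < c -> exists N, forall n, (N <= n)%N ->
     ip (s n - f) (s n - f) < c.
Proof.
move=> hs hc.
have /choice[N hN] : forall k : nat, exists N, forall n m, (N <= n)%N -> (N <= m)%N ->
    ip (s n - s m) (s n - s m) < 8^-1 ^+ k.
  by move=> k; apply: hc; rewrite exprn_gt0.
(* sums make the indices of the subsequence increasing *)
pose nn k := (\sum_(j < k.+1) (N j).+1)%N.
have nnS k : (nn k <= nn k.+1)%N by rewrite /nn [leqRHS]big_ord_recr leq_addr.
have nnN k : (N k <= nn k)%N by rewrite /nn big_ord_recr /= addnS ltnW// ltnS leq_addl.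
have nnm k j : (k <= j)%N -> (nn k <= nn j)%N.
  by move=> /subnK <-; elim: (j - k)%N => // i /leq_trans; apply; rewrite addSn.
pose v k := s (nn k).
have hv k : sqint (v k) by exact: hs.
pose dk k := v k.+1 - v k.
have hdk k : sqint (dk k) by exact: sqintB.
have dkb k : ip (dk k) (dk k) <= 8^-1 ^+ k.
  by apply/ltW/hN => //; exact: leq_trans (nnN _) (nnS _).
(* the integral of the k-th term is at most (4/8)^k *)
pose g x := (\sum_(k <oo) (4 ^+ k * (dk k x ^+ 2 * w x))%:E)%E.
have g_ge0 k x : D x -> (0 <= (4 ^+ k * (dk k x ^+ 2 * w x))%:E)%E.
  by move=> Dx; rewrite lee_fin mulr_ge0 ?exprn_ge0// sqw_ge0.
have mg k : measurable_fun D (fun x => (4 ^+ k * (dk k x ^+ 2 * w x))%:E).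
  apply/measurable_EFinP; apply: measurable_funM => //.
  by apply: measurable_funM => //; apply: measurable_funX; case: (hdk k).
have Ig : mu.-integrable D g.
  apply/integrableP; split.
    apply: ge0_emeasurable_sum => // k x Dx _; exact: g_ge0.
  under eq_integral => x xD.
    rewrite gee0_abs; last by apply: nneseries_ge0 => k _ _; apply: g_ge0; exact: set_mem.
    over.
  rewrite integral_nneseries//.
  apply: (@le_lt_trans _ _ (\sum_(k <oo) ((2^-1 ^+ k)%:E))%E).
    apply: lee_nneseries => k _ //.
      by move=> _; apply: integral_ge0 => x Dx; exact: g_ge0.
    under eq_integral do rewrite EFinM.
    rewrite ge0_integralZl_EFin//.
    - rewrite -(ipE (hdk k)) -EFinM lee_fin.
      apply: (@le_trans _ _ (4 ^+ k * 8^-1 ^+ k)); first by rewrite ler_wpM2l ?exprn_ge0.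
      by rewrite -exprMn; have -> : 4 * 8^-1 = 2^-1 :> R by field.
    - by move=> x Dx; rewrite lee_fin sqw_ge0.
    - exact: sqint_meas.
  have n2 : `|2^-1| < 1 :> R by rewrite ger0_norm; lra.
  have hg' := @cvg_geometric_series R 1 2^-1 n2.
  rewrite (_ : (\sum_(k <oo) _)%E = (1 / (1 - 2^-1))%:E) ?ltry//.
  apply: cvg_lim => //.
  rewrite (_ : (fun n => _) = EFin \o series (geometric 1 2^-1)).
    by apply/cvg_EFin; [exact: nearW|exact: hg'].
  apply/funext => n; rewrite /= seriesEnat /= sumEFin; congr EFin.
  by apply: eq_bigr => i _; rewrite mul1r.
have cvv : {ae mu, forall x, D x -> cvgn (fun k => v k x)}.
  apply: filterS (integrable_ae mD Ig) => x hx Dx; have {}hx := hx Dx.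
  have gx0 k : (((4 ^+ k * (dk k x ^+ 2 * w x))%:E <= g x))%E.
    have h0 i : (true -> 0 <= (4 ^+ i * (dk i x ^+ 2 * w x))%:E)%E by move=> _; exact: g_ge0.
    apply: le_trans (nneseries_lim_ge k.+1 (fun i _ => h0 i)).
    by rewrite big_nat_recr//= leeDr// sume_ge0// => i _; exact: g_ge0.
  pose C := Num.sqrt (fine (g x) / w x).
  apply: (@geom_cauchy_cvg _ C) => k.
  have := gx0 k; rewrite -(fineK hx) lee_fin => h.
  have w0 := w_gt0 Dx.
  have h2 : dk k x ^+ 2 <= fine (g x) / w x * (2^-1 ^+ k) ^+ 2.
    have -> : 2^-1 ^+ k ^+ 2 = (4 ^+ k)^-1 :> R.
      by rewrite -exprM mulnC exprM -exprVn; congr (_ ^+ _); field.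
    by rewrite mulrAC ler_pdivlMr// ler_pdivlMr ?exprn_gt0// mulrC.
  have := ler_wsqrtr h2; rewrite sqrtr_sqr sqrtrM; last first.
    rewrite divr_ge0 ?(ltW w0)//; apply: fine_ge0; apply: nneseries_ge0 => i _ _.
    exact: g_ge0.
  by rewrite sqrtr_sqr [`|_ ^+ k|]ger0_norm ?exprn_ge0.
pose f x := fine (limn_esup (fun k => (v k x)%:E)).
have mf : measurable_fun D f.
  apply: measurableT_comp => //.
  apply: measurable_fun_limn_esup => n; apply/measurable_EFinP; by case: (hv n).
have fE : {ae mu, forall x, D x -> (fun k => v k x) @ \oo --> f x}.
  apply: filterS cvv => x h Dx; have {}h := h Dx.
  have [l hl] := (cvg_ex _).1 h.
  have hl' : (fun k => (v k x)%:E) @ \oo --> l%:E.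
    by apply/cvg_EFin; [exact: nearW|exact: hl].
  rewrite /f is_cvg_limn_esupE; last by apply/cvg_ex; eexists; exact: hl'.
  by rewrite (cvg_lim _ hl').
have bnd n K c : (forall k, (K <= k)%N -> ip (s n - v k) (s n - v k) <= c) ->
    (\int[mu]_(x in D) ((s n - f) x ^+ 2 * w x)%:E <= c%:E)%E.
  move=> hk; pose h k x := (((s n - v (k + K)%N) x) ^+ 2 * w x)%:E.
  have h_ge0 k x : D x -> (0 <= h k x)%E.
    by move=> Dx; rewrite lee_fin sqw_ge0.
  have mh k : measurable_fun D (h k).
    by apply: sqint_meas; apply: sqintB.
  have einf_ge0 x : D x -> (0 <= limn_einf (h ^~ x))%E.
    move=> Dx; rewrite limn_einf_lim; apply: lime_ge; first exact: is_cvg_einfs.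
    by apply: nearW => k; apply: le_ereal_inf_tmp => _ [j _ <-]; exact: h_ge0.
  have : (\int[mu]_(x in D) ((s n - f) x ^+ 2 * w x)%:E <=
          \int[mu]_(x in D) limn_einf (h ^~ x))%E.
    apply: ae_ge0_le_integral => //.
    - by move=> x Dx; rewrite lee_fin sqw_ge0.
    - apply/measurable_EFinP; apply: measurable_funM => //; apply: measurable_funX.
      by apply: measurable_funB => //; case: (hs n).
    - have hE : (fun x => limn_einf (h ^~ x)) =
          (fun x => - limn_esup (fun k => - h k x))%E.
        apply/funext => x; rewrite -limn_einfN; congr limn_einf.
        by apply/funext => k; exact: (esym (oppeK (h k x))).
      rewrite hE; apply: measurableT_comp => //.
      by apply: measurable_fun_limn_esup => k; apply: measurableT_comp => //; exact: mh.
    apply: filterS fE => x hx Dx; have {}hx := hx Dx.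
    suff hl : (h ^~ x) @ \oo --> ((s n - f) x ^+ 2 * w x)%:E.
      rewrite is_cvg_limn_einfE; last by apply/cvg_ex; eexists; exact: hl.
      by rewrite (cvg_lim _ hl).
    apply/cvg_EFin; first exact: nearW.
    apply: cvgM; last exact: cvg_cst.
    have hsub : (s n x - v (k + K)%N x) @[k --> \oo] --> s n x - f x.
      apply: cvgB; first exact: cvg_cst.
      by rewrite (@cvg_shiftn K _ (fun k => v k x)).
    by under eq_cvg do rewrite expr2; rewrite expr2; exact: cvgM.
  move=> /le_trans; apply.
  apply: le_trans (fatou mu mD mh h_ge0) _.
  rewrite limn_einf_lim; apply: lime_le; first exact: is_cvg_einfs.
  apply: nearW => k; apply: ge_ereal_inf; exists (\int[mu]_(x in D) h k x)%E.
    by exists k => /=.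
  rewrite -(ipE (sqintB (hs n) (hv _))) lee_fin; apply: hk; exact: leq_addl.
have hbnd (c : R) : 0 < c -> exists M, forall n, (M <= n)%N ->
    (\int[mu]_(x in D) ((s n - f) x ^+ 2 * w x)%:E <= c%:E)%E.
  move=> c0; have [M hM] := hc c c0; exists M => n Mn.
  apply: (bnd n M) => k Mk; apply/ltW/hM => //.
  apply: leq_trans Mk _; elim: k => [//|k ih]; apply: leq_ltn_trans ih _.
  by rewrite /nn [ltnRHS]big_ord_recr /= addnS ltnS leq_addr.
have hsnf n : (\int[mu]_(x in D) ((s n - f) x ^+ 2 * w x)%:E < +oo)%E -> sqint (s n - f).
  by apply: sqintP; apply: measurable_funB => //; case: (hs n).
have sf : sqint f.
  have [M hM] := hbnd 1 ltr01.
  have h := hsnf M (le_lt_trans (hM M (leqnn _)) (ltry _)).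
  by rewrite -[f](subKr (s M)); exact: sqintB.
exists f => // c c0; have c2 : 0 < c / 2 by lra.
have [M hM] := hbnd _ c2; exists M => n /hM.
rewrite -(ipE (sqintB (hs n) sf)) lee_fin; lra.
Qed.

End RealL2.

(** * Borel measurability of open sets of the plane and of space *)

(** A countable base drawn from a class M of sets. *)
Definition open_base {T : topologicalType} (M : set (set T)) : Prop :=
  exists b : nat -> set T, (forall n, M (b n)) /\
    forall U x, open U -> U x -> exists n, b n x /\ b n `<=` U.

Lemma open_base_prod (T1 T2 : topologicalType) (M1 : set (set T1))
    (M2 : set (set T2)) (M : set (set (T1 * T2))) :
  open_base M1 -> open_base M2 ->
  (forall A B, M1 A -> M2 B -> M (A `*` B)) -> open_base M.
Proof.
move=> [b1 [m1 h1]] [b2 [m2 h2]] mX.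
pose b n := if unpickle n is Some (i, j) then b1 i `*` b2 j else b1 0%N `*` b2 0%N.
exists b; split=> [n|U x oU Ux].
  by rewrite /b; case: unpickle => [[i j]|]; exact: mX.
have : nbhs x U by exact: open_nbhs_nbhs.
case=> -[/= A B] [nA nB] AB.
have [i [b1x b1A]] := h1 _ x.1 (open_interior A) nA.
have [j [b2x b2B]] := h2 _ x.2 (open_interior B) nB.
exists (pickle (i, j)); rewrite /b pickleK; split=> // y [y1 y2].
by apply: AB; split; apply: interior_subset; [exact: b1A|exact: b2B].
Qed.

(** An open set is the union of the sets of the base that it contains. *)
Lemma open_base_open (T : topologicalType) (M : set (set T)) U :
  open_base M -> M set0 ->
  (forall F : nat -> set T, (forall n, M (F n)) -> M (\bigcup_n F n)) ->
  open U -> M U.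
Proof.
move=> [b [mb hb]] M0 MU oU.
pose F n := if `[< b n `<=` U >] then b n else set0.
suff -> : U = \bigcup_n F n.
  by apply: MU => n; rewrite /F; case: ifP.
apply/seteqP; split=> [x Ux|x [n _]].
  have [n [bx bU]] := hb U x oU Ux; exists n => //.
  by rewrite /F asboolT.
by rewrite /F; case: asboolP => // h; exact: h.
Qed.

Section Borel.
Context {R : realType}.

Definition oitv (A : set R) : Prop := exists a b, A = `]a, b[%classic.

Lemma open_base_oitv : open_base oitv.
Proof.
pose b n : set R := if unpickle n is Some (a, c)
  then `](ratr a : R), (ratr c : R)[%classic else `]0, 0[%classic.
exists b; split=> [n|U x oU Ux].
  by rewrite /b; case: unpickle => [[a c]|]; do 2 eexists.
have : nbhs x U by exact: open_nbhs_nbhs.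
move=> /nbhs_ballP[e /= e0 eU].
have [a ax] := @rat_in_itvoo R (x - e) x ltac:(lra).
have [c cx] := @rat_in_itvoo R x (x + e) ltac:(lra).
move: ax cx; rewrite !in_itv /= => /andP[a1 a2] /andP[c1 c2].
exists (pickle (a, c)); rewrite /b pickleK; split=> [|y].
  by rewrite /= in_itv /= a2.
rewrite /= in_itv /= => /andP[y1 y2]; apply: eU.
by rewrite /ball /= ltr_distlC; apply/andP; split; lra.
Qed.

Lemma oitv_measurable (A : set R) : oitv A -> measurable A.
Proof. by move=> [a [b ->]]; exact: measurable_itv. Qed.

Lemma open_base_R : @open_base R measurable.
Proof.
have [b [mb hb]] := open_base_oitv; exists b; split; last exact: hb.
by move=> n; apply: oitv_measurable; exact: mb.
Qed.

Lemma open_base_R2 : @open_base (R * R)%type measurable.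
Proof.
apply: (open_base_prod open_base_R open_base_R) => A B.
exact: measurableX.
Qed.

Lemma open_base_R3 : @open_base (R * R * R)%type measurable.
Proof.
apply: (open_base_prod open_base_R2 open_base_R) => A B.
exact: measurableX.
Qed.

(** The measurable sets of the plane are those of the product of two Borel
    structures, not the Borel sets of the product topology; the rational boxes
    bridge the gap. *)
Lemma open_measurable2 (U : set (R * R)) : open U -> measurable U.
Proof.
apply: (open_base_open open_base_R2); first exact: measurable0.
by move=> F mF; exact: bigcupT_measurable.
Qed.

Lemma open_measurable3 (U : set (R * R * R)) : open U -> measurable U.
Proof.
apply: (open_base_open open_base_R3); first exact: measurable0.
by move=> F mF; exact: bigcupT_measurable.
Qed.

Lemma open_preimage_measurable d (T : measurableType d) (D : set T) (f : T -> R) :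
  (forall U, open U -> measurable (D `&` f @^-1` U)) -> measurable_fun D f.
Proof.
move=> h mD; apply: (measurability _ (RGenOInfty.measurableE R)) => //.
by move=> _ [_ [a ->] <-]; apply: h; exact: interval_open.
Qed.

Lemma continuous_measurable3 (f : R * R * R -> R) :
  continuous f -> measurable_fun setT f.
Proof.
move=> cf; apply: open_preimage_measurable => U oU; rewrite setTI.
by apply: open_measurable3; move/continuousP : cf; exact.
Qed.

Lemma continuous_on_measurable2 (D : set (R * R)) (f : R * R -> R) :
  open D -> (forall x, D x -> {for x, continuous f}) -> measurable_fun D f.
Proof.
move=> oD cf; apply: open_preimage_measurable => U oU; apply: open_measurable2.
rewrite openE => x [Dx Ux]; apply: filterI; first exact: open_nbhs_nbhs.
by apply: cf => //; exact: open_nbhs_nbhs.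
Qed.

Lemma continuous_measurable2 (f : R * R -> R) :
  continuous f -> measurable_fun setT f.
Proof. by move=> cf; apply: continuous_on_measurable2; [exact: openT|move=> x _; exact: cf]. Qed.

End Borel.

(** * Calculus of smooth functions *)

Section SmoothCalculus.
Context {R : realType} {V : normedModType R}.
Implicit Types f g : V -> R.

(** Smoothness is defined through all iterated directional derivatives; a class
    of differentiable functions that is stable under directional derivatives
    consists of smooth functions.  All smoothness proofs below exhibit a class. *)
Lemma smooth_class (C : (V -> R) -> Prop) :
  (forall f x, C f -> differentiable f x) ->
  (forall f v, C f -> C ('D_v f)) -> forall f, C f -> smooth f.
Proof.
move=> hd hC f Cf s x; apply: hd.
by elim: s => [//|v s ih] /=; exact: hC.
Qed.

Lemma smooth_differentiable f x : smooth f -> differentiable f x.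
Proof. by move=> /(_ [::] x). Qed.

Lemma smooth_continuous f : smooth f -> continuous f.
Proof. by move=> sf x; apply/differentiable_continuous/smooth_differentiable. Qed.

Lemma smooth_derive f v : smooth f -> smooth ('D_v f).
Proof. by move=> sf s x; have := sf (rcons s v) x; rewrite /iter_derive foldr_rcons. Qed.

Lemma smooth_derivable f v x : smooth f -> derivable f x v.
Proof. by move=> sf; apply/diff_derivable/smooth_differentiable. Qed.

Lemma smooth_cst (c : R) : smooth (fun _ : V => c).
Proof.
apply: (@smooth_class (fun f => exists c, f = fun=> c)); last by exists c.
  by move=> f x [{}c ->]; exact: differentiable_cst.
by move=> f v [{}c ->]; exists 0; apply/funext => x; rewrite derive_cst.
Qed.

Lemma smoothD f g : smooth f -> smooth g -> smooth (fun x => f x + g x).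
Proof.
move=> sf sg; apply: (@smooth_class (fun h => exists f g, [/\ smooth f, smooth g &
  h = fun x => f x + g x])); last by exists f, g.
  move=> h x [f1 [g1 [s1 s2 ->]]].
  by apply: differentiableD; exact: smooth_differentiable.
move=> h v [f1 [g1 [s1 s2 ->]]]; exists ('D_v f1), ('D_v g1).
split; [exact: smooth_derive|exact: smooth_derive|].
by apply/funext => x; rewrite (@deriveD _ _ _ f1 g1)//; exact: smooth_derivable.
Qed.

Inductive sum_of_products : (V -> R) -> Prop :=
| sp_mul f g : smooth f -> smooth g -> sum_of_products (fun x => f x * g x)
| sp_add f g : sum_of_products f -> sum_of_products g ->
    sum_of_products (fun x => f x + g x).

Lemma smoothM f g : smooth f -> smooth g -> smooth (fun x => f x * g x).
Proof.
move=> sf sg; apply: (@smooth_class sum_of_products); last exact: sp_mul.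
  move=> h x; elim=> [f1 g1 s1 s2|f1 g1 _ h1 _ h2].
    by apply: differentiableM; exact: smooth_differentiable.
  exact: differentiableD.
move=> h v hh; suff [] : sum_of_products ('D_v h) /\ forall x, derivable h x v by [].
elim: hh => [f1 g1 s1 s2|f1 g1 _ [h1 d1] _ [h2 d2]]; split.
- rewrite (_ : 'D_v _ = fun x => f1 x * 'D_v g1 x + g1 x * 'D_v f1 x).
    by apply: sp_add; apply: sp_mul => //; exact: smooth_derive.
  by apply/funext => x; rewrite (@deriveM _ _ f1 g1)//; exact: smooth_derivable.
- by move=> x; apply: (@derivableM _ _ f1 g1); exact: smooth_derivable.
- rewrite (_ : 'D_v _ = fun x => 'D_v f1 x + 'D_v g1 x); first exact: sp_add.
  by apply/funext => x; rewrite (@deriveD _ _ _ f1 g1).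
- by move=> x; exact: (@derivableD _ _ _ f1 g1).
Qed.

Lemma smoothZ (c : R) f : smooth f -> smooth (fun x => c * f x).
Proof. by move=> sf; apply: smoothM => //; exact: smooth_cst. Qed.

Lemma smoothN f : smooth f -> smooth (fun x => - f x).
Proof.
move=> /(smoothZ (-1)); congr smooth; apply/funext => x; exact: mulN1r.
Qed.

Lemma smoothB f g : smooth f -> smooth g -> smooth (fun x => f x - g x).
Proof. by move=> sf sg; apply: smoothD => //; exact: smoothN. Qed.

End SmoothCalculus.

Lemma derive_comp_affine {R : realType} {V W : normedModType R} (f : W -> R)
    (L : V -> W) (l : V -> W) v x :
  differentiable f (L x) -> is_diff x L l ->
  'D_v (f \o L) x = 'D_(l v) f (L x).
Proof.
move=> df [dL eL]; rewrite deriveE; last exact: differentiable_comp.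
by rewrite diff_comp//= eL deriveE.
Qed.

Lemma smooth_comp_affine {R : realType} {V W : normedModType R} (f : W -> R)
    (L : V -> W) (l : V -> W) :
  (forall x, is_diff x L l) -> smooth f -> smooth (f \o L).
Proof.
move=> hL sf; apply: (@smooth_class _ _ (fun h => exists2 f, smooth f & h = f \o L)).
- move=> h x [g sg ->]; apply: differentiable_comp; last exact: smooth_differentiable.
  by case: (hL x).
- move=> h v [g sg ->]; exists ('D_(l v) g); first exact: smooth_derive.
  by apply/funext => x; apply: derive_comp_affine => //; exact: smooth_differentiable.
- by exists f.
Qed.

Section Projections.
Context {R : realType} {V W : normedModType R}.

Lemma is_diff_fst (x : V * W) : is_diff x fst fst.
Proof. 
have h : linear (fst : V * W -> V) by [].
pose m := GRing.isLinear.Build _ _ _ _ _ h.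
pose L : {linear (V * W)%type -> V} := HB.pack (fst : V * W -> V) m.
have c : continuous (L : V * W -> V) by move=> y; exact: cvg_fst.
by apply: DiffDef; [exact: (@linear_differentiable _ _ _ L)|exact: (@diff_lin _ _ _ L)].
Qed.

Lemma is_diff_snd (x : V * W) : is_diff x snd snd.
Proof.
have h : linear (snd : V * W -> W) by [].
pose m := GRing.isLinear.Build _ _ _ _ _ h.
pose L : {linear (V * W)%type -> W} := HB.pack (snd : V * W -> W) m.
have c : continuous (L : V * W -> W) by move=> y; exact: cvg_snd.
by apply: DiffDef; [exact: (@linear_differentiable _ _ _ L)|exact: (@diff_lin _ _ _ L)].
Qed.

End Projections.

Section OneVariable.
Context {R : realType}.
Implicit Types f g : R -> R.

Lemma derive_scale1 f v x : derivable f x 1 -> 'D_v f x = v * 'D_1 f x.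
Proof.
move=> /derivable1_diffP df; rewrite !deriveE// -{1}(mulr1 v).
by rewrite -[v * 1]/(v *: 1) linearZ.
Qed.

Lemma smooth_class1 (C : (R -> R) -> Prop) :
  (forall f, C f -> exists2 g, C g & forall x, is_derive x (1 : R) f (g x)) ->
  (forall (c : R) f, C f -> C (fun x => c * f x)) -> forall f, C f -> smooth f.
Proof.
move=> hd hZ f Cf; apply: (@smooth_class _ _ C) => //.
  move=> h x /hd[g _ /(_ x)] [d _]; exact/derivable1_diffP.
move=> h v /hd[g Cg hg]; rewrite (_ : 'D_v h = fun x => v * g x); first exact: hZ.
by apply/funext => x; rewrite derive_scale1; have [d e] := hg x; rewrite ?e.
Qed.

Lemma smooth_trig (a b k : R) : smooth (fun x : R => a * cos (k * x) + b * sin (k * x)).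
Proof.
apply: (@smooth_class1 (fun f => exists a b, f = fun x => a * cos (k * x) + b * sin (k * x))).
- move=> f [a1 [b1 ->]]; exists (fun x => (k * b1) * cos (k * x) + (- k * a1) * sin (k * x)).
    by exists (k * b1), (- k * a1).
  move=> x; have d0 : is_derive x (1 : R) (fun x => k * x) k.
    by apply: is_derive_eq; rewrite scaler1.
  have d1 : is_derive x (1 : R) (fun x => cos (k * x)) (- sin (k * x) * k).
    exact: (@is_derive1_comp _ cos (fun x => k * x)).
  have d2 : is_derive x (1 : R) (fun x => sin (k * x)) (cos (k * x) * k).
    exact: (@is_derive1_comp _ sin (fun x => k * x)).
  by apply: is_derive_eq; rewrite /GRing.scale /=; ring.
- move=> c f [a1 [b1 ->]]; exists (c * a1), (c * b1).
  by apply/funext => x; ring.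
- by exists a, b.
Qed.

(** The functions p(1/x) exp(-1/x), extended by 0, form a class that is stable
    under differentiation and contains the flat function below. *)
Definition bump_term (p : {poly R}) (x : R) : R :=
  if 0 < x then p.[x^-1] * expR (- x^-1) else 0.

(** The exponential series beats every power of 1/x, with one factor x to spare:
    that factor gives differentiability at 0. *)
Lemma monomial_expR_le n (x : R) : 0 < x ->
  (x^-1) ^+ n * expR (- x^-1) <= n.+1`!%:R * x.
Proof.
move=> x0; have y0 : 0 < x^-1 by rewrite invr_gt0.
have f0 : 0 < n.+1`!%:R :> R by rewrite ltr0n fact_gt0.
have h := @expR_ge1Dxn R x^-1 n (ltW y0).
have h2 : x^-1 ^+ n.+1 / n.+1`!%:R <= expR x^-1 by lra.
rewrite expRN ler_pdivrMr ?expR_gt0//.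
rewrite ler_pdivrMr// exprSr in h2.
have := ler_wpM2r (ltW x0) h2; rewrite -mulrA mulVf ?gt_eqF// mulr1.
by rewrite -mulrA mulrC.
Qed.

Lemma bump_term_le p : exists2 C : R, 0 <= C & forall x, `|bump_term p x| <= C * `|x|.
Proof.
exists (\sum_(i < size p) `|p`_i| * i.+1`!%:R).
  by apply: sumr_ge0 => i _; rewrite mulr_ge0.
move=> x; rewrite /bump_term; case: ifPn => [x0|_]; last first.
  by rewrite normr0 mulr_ge0// sumr_ge0// => i _; rewrite mulr_ge0.
rewrite horner_coef mulr_suml (gtr0_norm x0) mulr_suml.
apply: le_trans (ler_norm_sum _ _ _) _; apply: ler_sum => i _.
rewrite -mulrA normrM -mulrA ler_wpM2l//.
rewrite ger0_norm; last by rewrite mulr_ge0 ?expR_ge0// exprn_ge0// invr_ge0 ltW.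
exact: monomial_expR_le.
Qed.

Lemma is_derive_bump p x :
  is_derive x (1 : R) (bump_term p) (bump_term ('X^2 * (p - p^`())) x).
Proof.
have [x0|x0|->] := ltgtP x 0.
- apply: (@near_eq_is_derive _ _ _ (fun=> 0)).
    near=> y; rewrite /bump_term ltNge (_ : y <= 0)//.
    by apply/ltW; near: y; exact: lt_nbhsl.
  rewrite /bump_term ltNge (ltW x0)/=; exact: is_derive_cst.
- have xn0 : x != 0 by rewrite gt_eqF.
  have d1 : is_derive x (1 : R) (fun y : R => y^-1) (- x^-2).
    by have h := @is_deriveV _ id x 1 1 xn0 _; apply: is_derive_eq; rewrite /GRing.scale /= mulr1.
  have d2 : is_derive x (1 : R) (fun y => p.[y^-1]) (p^`().[x^-1] * - x^-2).
    exact: (@is_derive1_comp _ (horner p) (fun y : R => y^-1)).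
  have d3 : is_derive x (1 : R) (fun y => expR (- y^-1)) (expR (- x^-1) * (x^-2)).
    apply: (@is_derive1_comp _ expR (fun y : R => - y^-1)).
    by apply: is_derive_eq; rewrite opprK.
  have d4 := is_deriveM d2 d3.
  apply: near_eq_is_derive; last first.
    apply: (is_derive_eq d4); rewrite /bump_term x0 !hornerE /= -!exprVn /GRing.scale /=.
    by ring.
  near=> y; rewrite /bump_term (_ : 0 < y)//.
  by near: y; exact: lt_nbhsr.
- have b0 q : bump_term q 0 = 0 by rewrite /bump_term ltxx.
  have key : h^-1 *: (bump_term p (h *: (1 : R) + 0) - bump_term p 0) @[h --> 0^'] -->
      (0 : R).
    have [C C0 hC] := bump_term_le ('X * p).
    apply/cvgr0Pnorm_lt => e e0.
    have C1 : 0 < C + 1 by lra.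
    near=> h.
    have -> : h^-1 *: (bump_term p (h *: (1 : R) + 0) - bump_term p 0) = bump_term ('X * p) h.
      rewrite b0 subr0 addr0 /GRing.scale /= mulr1 /bump_term.
      by case: ifP => _; [rewrite hornerM hornerX mulrA|rewrite mulr0].
    apply: le_lt_trans (hC h) _.
    have : `|h| < e / (C + 1).
      near: h; apply: dnbhs0_lt; exact: divr_gt0.
    by rewrite ltr_pdivlMr//; have := normr_ge0 h; nra.
  rewrite b0; apply: DeriveDef; first by apply/cvg_ex; exists 0.
  exact: cvg_lim key.
Unshelve. all: by end_near. Qed.

Lemma smooth_bump_term p : smooth (bump_term p).
Proof.
apply: (@smooth_class1 (fun f => exists p, f = bump_term p)); last by exists p.
- move=> f [q ->]; exists (bump_term ('X^2 * (q - q^`()))); first by eexists.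
  by move=> x; exact: is_derive_bump.
- move=> c f [q ->]; exists (c *: q); apply/funext => x; rewrite /bump_term.
  by case: ifP => _; rewrite ?mulr0// hornerZ mulrA.
Qed.

(** The dilations flat (k x) increase to the indicator of the positive half-line;
    products of them approximate indicators of boxes. *)
Definition flat (x : R) : R := if 0 < x then expR (- x^-1) else 0.

Lemma smooth_flat : smooth flat.
Proof.
rewrite (_ : flat = bump_term 1); first exact: smooth_bump_term.
by apply/funext => x; rewrite /flat /bump_term hornerE mul1r.
Qed.

Lemma flat_ge0 x : 0 <= flat x.
Proof. by rewrite /flat; case: ifP => // _; exact: expR_ge0. Qed.

Lemma flat_le1 x : flat x <= 1.
Proof.
rewrite /flat; case: ifP => // x0.
by rewrite expR_le1 oppr_le0 invr_ge0 ltW.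
Qed.

Lemma flat_le0 x : x <= 0 -> flat x = 0.
Proof. by rewrite /flat ltNge => ->. Qed.

Lemma cvg_flat x : 0 < x -> flat (n.+1%:R * x) @[n --> \oo] --> (1 : R).
Proof.
move=> x0; have h : - (n.+1%:R^-1 * x^-1) @[n --> \oo] --> (0 : R).
  rewrite -[0]oppr0 -(mul0r x^-1); apply: cvgN; apply: cvgM; last exact: cvg_cst.
  exact: cvg_harmonic.
have h2 : expR (- (n.+1%:R^-1 * x^-1)) @[n --> \oo] --> (1 : R).
  by rewrite -[X in _ --> X]expR0; apply: (cvg_comp _ _ h); exact: continuous_expR.
apply: cvg_trans h2; apply: near_eq_cvg; apply: nearW => n.
by rewrite /flat mulr_gt0// invfM.
Qed.

End OneVariable.

(** * Integration of compactly supported functions on the plane *)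

Section Plane.
Context {R : realType}.
Implicit Types (f g phi psi : R * R -> R) (K D : set (R * R)).
Notation leb1 := (@lebesgue_measure R).
Notation leb2 := (@leb2 R).
Notation plane := (measurableTypeR R * measurableTypeR R)%type.
Notation mset := (@measurable _ plane).
Notation mfun2 := (@measurable_fun _ _ plane R).

Lemma compact_box K : compact K -> exists2 M : R, 0 < M &
  forall p, K p -> - M < p.1 < M /\ - M < p.2 < M.
Proof.
move=> /compact_bounded /ex_strict_bound_gt0 [M M0 hM]; exists M => // p Kp.
have : `|p| < M := hM p Kp; rewrite prod_normE /= gt_max => /andP[].
by rewrite !ltr_norml.
Qed.

Lemma compact_closed2 K : compact K -> closed K.
Proof. by apply: compact_closed; exact: norm_hausdorff. Qed.

(** The complement of a compact set is open, so functions and their derivatives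
    vanish near each point outside of a compact support. *)
Lemma near_off_compact K f p : compact K -> (forall q, ~ K q -> f q = 0) ->
  ~ K p -> \forall q \near p, f q = 0.
Proof.
move=> cK f0 nKp; have oK : open (~` K) by apply: closed_openC; exact: compact_closed2.
have : nbhs p (~` K) by exact: open_nbhs_nbhs.
by apply: filterS => q /f0.
Qed.

Lemma derive_off_compact K f v p : compact K -> (forall q, ~ K q -> f q = 0) ->
  ~ K p -> 'D_v f p = 0.
Proof.
move=> cK f0 nKp; rewrite (@near_eq_derive _ _ _ f (fun=> 0)) ?derive_cst//.
exact: near_off_compact nKp.
Qed.

Lemma leb2_box (M : R) :
  (leb2 (`[(- M)%R, M]%classic `*` `[(- M)%R, M]%classic) < +oo)%E.
Proof.
rewrite /Defs.leb2 product_measure1E//= lebesgue_measure_itv /=.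
by case: ifP => _; rewrite -?EFinB -?EFinM ?mule0 ltry.
Qed.

Lemma compact_measurable2 K : compact K -> mset K.
Proof.
move=> /compact_closed2 cK; rewrite -[K]setCK; apply: measurableC.
by apply: open_measurable2; exact: closed_openC.
Qed.

Lemma leb2_compact K : compact K -> (leb2 K < +oo)%E.
Proof.
move=> cK; have [M M0 hM] := compact_box cK.
apply: le_lt_trans (leb2_box M); apply: le_measure; rewrite ?inE.
- exact: compact_measurable2.
- by apply: measurableX.
- by move=> p /hM [/andP[a b] /andP[c e]]; split; rewrite /= in_itv /= !ltW.
Qed.

Lemma continuous_bounded_on K f : compact K -> (forall p, K p -> {for p, continuous f}) ->
  exists2 C : R, 0 < C & forall p, K p -> `|f p| <= C.
Proof.
move=> cK cf.
have cfK : {within K, continuous f}.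
  apply: continuous_in_subspaceT => p /set_mem; exact: cf.
have := compact_bounded (continuous_compact cfK cK).
move=> /ex_strict_bound_gt0 [C C0 hC]; exists C => // p Kp.
by apply/ltW/hC; exists p.
Qed.

Lemma compact_integrable K f : compact K -> mfun2 K f ->
  (exists C : R, forall p, K p -> `|f p| <= C) -> leb2.-integrable K (EFin \o f).
Proof.
move=> cK mf [C hC]; apply: measurable_bounded_integrable => //.
- exact: compact_measurable2.
- exact: leb2_compact.
- exists C; split; first exact: num_real.
  by move=> M CM p Kp; apply: le_trans (hC p Kp) (ltW CM).
Qed.

Lemma integrable_off K D f : mset K -> mset D -> K `<=` D ->
  (forall p, ~ K p -> f p = 0) -> leb2.-integrable K (EFin \o f) ->
  leb2.-integrable D (EFin \o f).
Proof.
move=> mK mD KD f0 If; apply: (@integrableS _ _ _ _ setT) => //.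
have := (@integrable_mkcond _ plane R leb2 K (EFin \o f) mK).1 If; apply: eq_integrable => // p _.
by rewrite patchE; case: ifPn => // /negP h; rewrite /= f0// => Kp; apply: h; exact/mem_set.
Qed.

Lemma Rintegral_off D f : (forall p, ~ D p -> f p = 0) ->
  Rintegral leb2 D f = Rintegral leb2 setT f.
Proof.
move=> f0; rewrite Rintegral_mkcond; apply: eq_Rintegral => p _.
by rewrite patchE; case: ifPn => // /negP h; rewrite f0// => Kp; apply: h; exact/mem_set.
Qed.

Lemma continuous_compact_integrable2 K f : compact K -> continuous f ->
  (forall p, ~ K p -> f p = 0) -> leb2.-integrable setT (EFin \o f).
Proof.
move=> cK cf f0; apply: (@integrable_off K) => //; first exact: compact_measurable2.
apply: compact_integrable => //.
  by apply: measurable_funTS; exact: continuous_measurable2.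
by have [C _ hC] := continuous_bounded_on cK (fun p _ => cf p); exists C.
Qed.

(** A directional derivative along a coordinate axis is the derivative of the
    restriction to that axis. *)
Lemma slice1 phi (r z a : R) : is_derive (r, z) ((1, 0) : R * R) phi a ->
  is_derive r (1 : R) (fun x => phi (x, z)) a.
Proof.
have E : (fun h : R => h^-1 *: ((phi \o shift (r, z)) (h *: ((1, 0) : R * R)) - phi (r, z)))
       = (fun h : R => h^-1 *: (((fun x => phi (x, z)) \o shift r) (h *: (1 : R)) - phi (r, z))).
  apply/funext => h /=; congr (_ *: (phi _ - _)).
  by rewrite -[LHS]/(h * 1 + r, h * 0 + z) mulr0 add0r.
by move=> [d e]; split; [move: d|move: e]; rewrite /derivable /derive E.
Qed.

Lemma slice2 phi (r z a : R) : is_derive (r, z) ((0, 1) : R * R) phi a ->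
  is_derive z (1 : R) (fun x => phi (r, x)) a.
Proof.
have E : (fun h : R => h^-1 *: ((phi \o shift (r, z)) (h *: ((0, 1) : R * R)) - phi (r, z)))
       = (fun h : R => h^-1 *: (((fun x => phi (r, x)) \o shift z) (h *: (1 : R)) - phi (r, z))).
  apply/funext => h /=; congr (_ *: (phi _ - _)).
  by rewrite -[LHS]/(h * 0 + r, h * 1 + z) mulr0 add0r.
by move=> [d e]; split; [move: d|move: e]; rewrite /derivable /derive E.
Qed.

Lemma integral_derive_line (u v : R -> R) (M : R) : 0 < M ->
  (forall x, is_derive x (1 : R) u (v x)) -> continuous v ->
  (forall x, ~ (- M < x < M) -> u x = 0 /\ v x = 0) ->
  (\int[leb1]_x (v x)%:E = 0)%E.
Proof.
move=> M0 du cv h0.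
have -> : (\int[leb1]_x (v x)%:E = \int[leb1]_(x in `[(- M)%R, M]) (v x)%:E)%E.
  rewrite [RHS]integral_mkcond; apply: eq_integral => x _; rewrite patchE.
  case: ifPn => // /negP h.
  have hx : ~ (- M < x < M).
    by move=> /andP[h1 h2]; apply: h; rewrite inE /= in_itv /= !ltW.
  by rewrite (h0 x hx).2.
have cu : continuous u.
  move=> x; apply/differentiable_continuous/derivable1_diffP; by have [] := du x.
rewrite (@continuous_FTC2 _ v u).
- have -> : u M = 0 by apply: (h0 M _).1; rewrite ltxx andbF.
  have -> : u (- M) = 0 by apply: (h0 (- M) _).1; rewrite ltxx.
  by rewrite subee.
- lra.
- exact: continuous_subspaceT.
- split=> [x _||]; first by have [] := du x.
    exact/cvg_at_right_filter/cu.
  exact/cvg_at_left_filter/cu.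
- by move=> x _; rewrite derive1E; have [_ ->] := du x.
Qed.

(** The theorem of Fubini reduces the claim to lines parallel to the direction of
    the derivative. *)
Lemma integral_derive_plane K phi psi (b : bool) : compact K ->
  continuous psi -> (forall p, ~ K p -> phi p = 0) ->
  (forall p, is_derive p (if b then (1, 0) else (0, 1) : R * R) phi (psi p)) ->
  Rintegral leb2 setT psi = 0.
Proof.
move=> cK cpsi phi0 dphi.
have psi0 p : ~ K p -> psi p = 0.
  move=> nK; have [_ <-] := dphi p; exact: derive_off_compact nK.
have Ipsi := continuous_compact_integrable2 cK cpsi psi0.
have [M M0 hM] := compact_box cK.
rewrite /Rintegral.
suff -> : (\int[leb2]_x (psi x)%:E = 0)%E by [].
have cp1 z : continuous (fun x => psi (x, z)).
  move=> x; have h : (fun y : R => (y, z)) @ x --> (x, z).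
    by apply: (@cvg_pair _ _ _ (nbhs x) (nbhs x) (nbhs z) _ _ _ id (fun=> z)); [exact: cvg_id|exact: cvg_cst].
  exact: (cvg_comp _ _ h (cpsi (x, z))).
have cp2 r : continuous (fun x => psi (r, x)).
  move=> x; have h : (fun y : R => (r, y)) @ x --> (r, x).
    by apply: (@cvg_pair _ _ _ (nbhs x) (nbhs r) (nbhs x) _ _ _ (fun=> r) id); [exact: cvg_cst|exact: cvg_id].
  exact: (cvg_comp _ _ h (cpsi (r, x))).
case: b dphi => dphi.
- rewrite -(integral21_prod_meas1 Ipsi) integral0_eq// => z _.
  rewrite /fubini_G; apply: (@integral_derive_line (fun x => phi (x, z)) _ M) => //.
    by move=> x; exact: slice1.
  by move=> x hx; split; [apply: phi0|apply: psi0] => /hM [].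
- rewrite -(integral12_prod_meas1 Ipsi) integral0_eq// => z _.
  rewrite /fubini_F; apply: (@integral_derive_line (fun x => phi (z, x)) _ M) => //.
    by move=> x; exact: slice2.
  by move=> x hx; split; [apply: phi0|apply: psi0] => /hM [].
Qed.

End Plane.

(** * The fundamental lemma of the calculus of variations *)

(** The sets over which f has integral zero form a lambda system. *)
Lemma integral_null_dynkin d (T : measurableType d) (R : realType)
    (mu : {measure set T -> \bar R}) (f : T -> R) (G : set (set T)) :
  mu.-integrable setT (EFin \o f) -> G `<=` measurable -> setI_closed G ->
  (forall A, G A -> (\int[mu]_(x in A) (f x)%:E = 0)%E) ->
  (\int[mu]_x (f x)%:E = 0)%E ->
  forall A, <<s G >> A -> (\int[mu]_(x in A) (f x)%:E = 0)%E.
Proof.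
move=> If Gm GI G0 T0.
pose H := [set A : set T | measurable A /\ (\int[mu]_(x in A) (f x)%:E = 0)%E].
have GH : G `<=` H by move=> A GA; split; [exact: Gm|exact: G0].
have hH : dynkin H.
  split=> [|A [mA A0]|F tF hF]; first by split.
  - split; first exact: measurableC.
    have := @integral_setU_EFin _ T R mu A (~` A) f mA (measurableC mA).
    rewrite setUv => /(_ _ _); rewrite A0 add0e T0 => <- //.
      exact/measurable_EFinP/(measurable_int mu If).
    by apply/disj_setPS; rewrite setICr.
  - split; first by apply: bigcupT_measurable => k; have [] := hF k.
    rewrite integral_bigcup//; last 2 first.
    + by move=> k; have [] := hF k.
    + apply: integrableS If => //; apply: bigcupT_measurable => k; by have [] := hF k.
    by rewrite eseries0// => k _ _; have [] := hF k.
have := @lambda_system_subset T G GI setT H ((dynkin_lambda_system _).1 hH) GH.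
by move=> h A sA; have [|//] := h _ A sA; move=> X _.
Qed.

Section PlaneNullSets.
Context {R : realType}.
Implicit Types (f g h psi : R * R -> R) (K D : set (R * R)).
Notation leb2 := (@leb2 R).
Notation plane := (measurableTypeR R * measurableTypeR R)%type.
Notation mset := (@measurable _ plane).
Notation mfun2 := (@measurable_fun _ _ plane R).

#[global] Instance ae_filter_leb2 : Filter (almost_everywhere leb2).
Proof. exact: (@ae_filter_ringOfSetsType _ plane R leb2). Qed.

Definition obox (a b c d : R) : set (R * R) := `]a, b[%classic `*` `]c, d[%classic.
Definition cbox (a b c d : R) : set (R * R) := `[a, b]%classic `*` `[c, d]%classic.

Definition is_obox (A : set (R * R)) : Prop := exists a b c d, A = obox a b c d.

Lemma oboxI a b c d a' b' c' d' : obox a b c d `&` obox a' b' c' d' =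
  obox (Num.max a a') (Num.min b b') (Num.max c c') (Num.min d d').
Proof.
rewrite /obox; apply/seteqP; split=> [p|p].
  move=> [[/= + +] [/= + +]]; rewrite !in_itv /= => /andP[? ?] /andP[? ?] /andP[? ?] /andP[? ?].
  by split; rewrite /= ?in_itv /= ?gt_max ?lt_min; apply/andP; split; apply/andP.
move=> [/= + +]; rewrite !in_itv /= !gt_max !lt_min.
move=> /andP[/andP[? ?] /andP[? ?]] /andP[/andP[? ?] /andP[? ?]].
by split; split; rewrite /= ?in_itv /=; apply/andP.
Qed.

Lemma open_setX (A B : set R) : open A -> open B -> open (A `*` B).
Proof.
move=> oA oB; rewrite openE => p [Ap Bp]; exists (A, B) => //.
by split; exact: open_nbhs_nbhs.
Qed.

Lemma obox_open a b c d : open (obox a b c d).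
Proof. by apply: open_setX; exact: interval_open. Qed.

Lemma open_base_obox : open_base is_obox.
Proof.
apply: (open_base_prod (@open_base_oitv R) (@open_base_oitv R)).
by move=> _ _ [a [b ->]] [c [d ->]]; exists a, b, c, d.
Qed.

(** Open boxes are stable under intersection and generate the measurable sets,
    as the uniqueness argument with lambda systems requires. *)
Lemma plane_measurable_obox : mset `<=` <<s is_obox >>.
Proof.
have opens U : open U -> <<s is_obox >> U.
  have sa := @smallest_sigma_algebra _ setT is_obox.
  have [b [mb hb]] := open_base_obox.
  apply: open_base_open.
  - by exists b; split=> // n; apply: sub_sigma_algebra.
  - by case: sa.
  - by case: sa.
pose T := g_sigma_algebraType is_obox.
have m1 : measurable_fun setT (fst : T -> R).
  apply: open_preimage_measurable => U oU; rewrite setTI; apply: opens.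
  rewrite (_ : fst @^-1` U = U `*` setT); first by apply: open_setX => //; exact: openT.
  by apply/seteqP; split=> [p|p []].
have m2 : measurable_fun setT (snd : T -> R).
  apply: open_preimage_measurable => U oU; rewrite setTI; apply: opens.
  rewrite (_ : snd @^-1` U = setT `*` U); first by apply: open_setX => //; exact: openT.
  by apply/seteqP; split=> [p|p []].
rewrite measurable_prod_measurableType; apply: smallest_sub.
  exact: smallest_sigma_algebra.
move=> _ [A mA [B mB <-]].
have h1 : @measurable _ T (fst @^-1` A) by rewrite -[_ @^-1` _]setTI; exact: m1.
have h2 : @measurable _ T (snd @^-1` B) by rewrite -[_ @^-1` _]setTI; exact: m2.
exact: (measurableI _ _ h1 h2).
Qed.

Lemma compact_cbox a b c d : compact (cbox a b c d).
Proof. by apply: compact_setX; exact: segment_compact. Qed.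

Lemma obox_sub_cbox a b c d : obox a b c d `<=` cbox a b c d.
Proof.
move=> p [/= + +]; rewrite !in_itv /= => /andP[? ?] /andP[? ?].
by split; rewrite /= ?in_itv /= !ltW.
Qed.

Definition box_bump (a b c d : R) (n : nat) (p : R * R) : R :=
  (flat (n.+1%:R * (p.1 - a)) * flat (n.+1%:R * (b - p.1))) *
  (flat (n.+1%:R * (p.2 - c)) * flat (n.+1%:R * (d - p.2))).

Definition affine (k l x : R) : R := k * x + l.

Lemma is_diff_affine (k l x : R) : is_diff x (affine k l) ( *%R k).
Proof.
have h : is_diff x (fun y : R => k *: y + l) ( *:%R k + 0) by apply: is_diffD.
by move: h; rewrite addr0.
Qed.

Lemma smooth_box_bump a b c d n : smooth (box_bump a b c d n).
Proof.
have s1 k l : smooth (fun x : R => flat (k * x + l)).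
  by apply: (smooth_comp_affine (is_diff_affine k l)); exact: smooth_flat.
have s2 k l : smooth (fun p : R * R => flat (k * p.1 + l)).
  exact: (smooth_comp_affine (fun x => is_diff_fst x) (s1 k l)).
have s3 k l : smooth (fun p : R * R => flat (k * p.2 + l)).
  exact: (smooth_comp_affine (fun x => is_diff_snd x) (s1 k l)).
have := smoothM
 (smoothM (s2 n.+1%:R (- (n.+1%:R * a))) (s2 (- n.+1%:R) (n.+1%:R * b)))
 (smoothM (s3 n.+1%:R (- (n.+1%:R * c))) (s3 (- n.+1%:R) (n.+1%:R * d))).
congr smooth; apply/funext => p; rewrite /box_bump.
by congr (flat _ * flat _ * (flat _ * flat _)); ring.
Qed.

Lemma box_bump_off a b c d n p : ~ obox a b c d p -> box_bump a b c d n p = 0.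
Proof.
have n0 : 0 < n.+1%:R :> R by rewrite ltr0n.
have b0 (x : R) : x <= 0 -> flat (n.+1%:R * x) = 0.
  by move=> x0; apply: flat_le0; rewrite pmulr_rle0.
move=> hp; rewrite /box_bump.
have [h1|h1] := lerP p.1 a; first by rewrite b0 ?subr_le0// !mul0r.
have [h2|h2] := lerP b p.1; first by rewrite (b0 (b - _)) ?subr_le0// mulr0 !mul0r.
have [h3|h3] := lerP p.2 c; first by rewrite (b0 (p.2 - _)) ?subr_le0// mul0r mulr0.
have [h4|h4] := lerP d p.2; first by rewrite (b0 (d - _)) ?subr_le0// !mulr0.
by exfalso; apply: hp; split; rewrite /= ?in_itv /=; apply/andP.
Qed.

Lemma box_bump_norm a b c d n p : `|box_bump a b c d n p| <= 1.
Proof.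
rewrite /box_bump !normrM !(ger0_norm (flat_ge0 _)).
have h (x y : R) : 0 <= x -> x <= 1 -> 0 <= y -> y <= 1 -> x * y <= (1 : R).
  by move=> *; rewrite -[leRHS]mulr1; apply: ler_pM.
by apply: (h _ _); rewrite ?mulr_ge0 ?flat_ge0//; apply: (h _ _); rewrite ?flat_ge0 ?flat_le1.
Qed.

Lemma cvg_box_bump a b c d p :
  box_bump a b c d n p @[n --> \oo] --> (\1_(obox a b c d) p : R).
Proof.
rewrite indicE; have [/set_mem[/= + +]|/negP hp] := boolP (p \in _); last first.
  rewrite (_ : (fun n => _) = fun=> 0); first exact: cvg_cst.
  by apply/funext => n; apply: box_bump_off => h; apply: hp; exact/mem_set.
rewrite !in_itv /= => /andP[? ?] /andP[? ?].
rewrite (_ : true%:R = 1 * 1 * (1 * 1) :> R); last by rewrite !mulr1.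
by apply: cvgM; apply: cvgM; apply: cvg_flat; rewrite subr_gt0.
Qed.

Section weak_null.
Variables (D : set (R * R)) (h : R * R -> R).
Hypothesis oD : open D.
Hypothesis mh : mfun2 D h.
Hypothesis Ih : forall K, compact K -> K `<=` D -> leb2.-integrable K (EFin \o h).
Hypothesis h0 : forall psi, smooth psi ->
  (exists K, [/\ compact K, K `<=` D & forall p, ~ K p -> psi p = 0]) ->
  Rintegral leb2 D (fun p => h p * psi p) = 0.

Let mD : mset D. Proof. exact: open_measurable2. Qed.
Let mobox a b c d : mset (obox a b c d).
Proof. by apply: open_measurable2; exact: obox_open. Qed.

(** Dominated convergence for the smooth functions that increase to the
    indicator of the box. *)
Lemma integral_obox0 a b c d : cbox a b c d `<=` D ->
  (\int[leb2]_(p in obox a b c d) (h p)%:E = 0)%E.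
Proof.
move=> QD; pose Q := cbox a b c d; pose P := obox a b c d.
have cQ : compact Q by exact: compact_cbox.
have mQ : mset Q by exact: compact_measurable2.
have IQ : leb2.-integrable D (EFin \o (fun p => `|(h \_ Q) p|)).
  have := integrable_norm (Ih cQ QD) => I1.
  have I2 : leb2.-integrable setT (EFin \o (fun p => `|(h \_ Q) p|)).
    apply: (@integrable_off _ Q) => //.
      by move=> p nQ; rewrite patchE memNset// normr0.
    apply: eq_integrable I1 => // p pQ; rewrite /= patchE pQ //.
  exact: (@integrableS _ plane R leb2 setT D _ measurableT mD).
have mb n : mfun2 D (box_bump a b c d n).
  by apply: measurable_funTS; apply: continuous_measurable2; exact: smooth_continuous (smooth_box_bump _ _ _ _ _).
pose f_ n p := (h p * box_bump a b c d n p)%:E.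
pose f p := (h p * \1_P p)%:E.
have [|||||_ _] := @dominated_convergence _ plane R leb2 D mD f_ f (EFin \o (fun p => `|(h \_ Q) p|)).
- by move=> n; apply/measurable_EFinP; apply: measurable_funM.
- apply/measurable_EFinP; apply: measurable_funM => //.
  by apply: measurable_indic; exact: mobox.
- apply: aeW => p Dp; apply/cvg_EFin; first exact: nearW.
  by apply: cvgM; [exact: cvg_cst|exact: cvg_box_bump].
- exact: IQ.
- apply: aeW => p n Dp; rewrite /f_ abse_EFin lee_fin patchE.
  case: ifPn => [_|/negP nQ].
    by rewrite normrM -[leRHS]mulr1 ler_wpM2l// box_bump_norm.
  rewrite box_bump_off ?mulr0// => hp; apply: nQ; apply/mem_set; exact: obox_sub_cbox.
have -> : [sequence (\int[leb2]_(x in D) f_ n x)%E]_n = fun=> 0%E.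
  apply/funext => n /=.
  have hn : leb2.-integrable D (EFin \o (fun p => h p * box_bump a b c d n p)).
    apply: le_integrable IQ => //.
      by apply/measurable_EFinP; apply: measurable_funM.
    move=> p Dp; rewrite /= lee_fin normr_id patchE.
    case: ifPn => [_|/negP nQ].
      by rewrite normrM -[leRHS]mulr1 ler_wpM2l// box_bump_norm.
    rewrite box_bump_off ?mulr0// ?normr0// => hp; apply: nQ; apply/mem_set; exact: obox_sub_cbox.
  (* the box bump is itself a test function for D *)
  have := h0 (smooth_box_bump a b c d n); rewrite /Rintegral => hr.
  rewrite -[LHS]fineK; last exact: (integrable_fin_num mD hn).
  rewrite hr//; exists Q; split=> // p nQ; apply: box_bump_off => hp; apply: nQ.
  exact: obox_sub_cbox.
move=> /cvg_lim hl.
have : limn (fun=> 0%E : \bar R) = (\int[leb2]_(x in D) f x)%E by exact: hl.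
rewrite lim_cst// => ->.
rewrite [LHS]integral_mkcond [RHS]integral_mkcond; apply: eq_integral => p _.
rewrite !patchE /f indicE; case: ifPn => [pP|]; last by rewrite mulr0; case: ifP.
by rewrite mulr1 mem_set//; apply: QD; apply: obox_sub_cbox; exact/set_mem.
Qed.

Lemma ae_obox0 a b c d : cbox a b c d `<=` D ->
  {ae leb2, forall p, obox a b c d p -> h p = 0}.
Proof.
move=> QD; pose Q := cbox a b c d; pose P := obox a b c d.
have cQ : compact Q by exact: compact_cbox.
have mQ : mset Q by exact: compact_measurable2.
have IP : leb2.-integrable P (EFin \o h).
  by apply: integrableS (Ih cQ QD) => //; [exact: mobox|exact: obox_sub_cbox].
pose f := h \_ P.
have fE A : (\int[leb2]_(x in A) (f x)%:E = \int[leb2]_(x in A `&` P) (h x)%:E)%E.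
  rewrite integral_mkcondr; apply: eq_integral => x _; rewrite /f !patchE.
  by case: ifP.
have If : leb2.-integrable setT (EFin \o f).
  apply: (@integrable_off _ P) => //; first exact: mobox.
    by move=> p nP; rewrite /f patchE memNset.
  apply: eq_integrable IP; first exact: mobox.
  by move=> p pP; rewrite /= /f patchE pP.
have all0 A : mset A -> (\int[leb2]_(x in A) (f x)%:E = 0)%E.
  move=> mA; apply: (@integral_null_dynkin _ plane R leb2 f is_obox If _ _ _ _ A).
  - by move=> _ [a1 [b1 [c1 [d1 ->]]]]; exact: mobox.
  - move=> _ _ [a1 [b1 [c1 [d1 ->]]]] [a2 [b2 [c2 [d2 ->]]]].
    by rewrite oboxI; do 4 eexists.
  - move=> _ [a1 [b1 [c1 [d1 ->]]]]; rewrite fE oboxI; apply: integral_obox0.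
    apply: subset_trans QD => p [/= + +]; rewrite !in_itv /= !ge_max !le_min.
    move=> /andP[/andP[? ?] /andP[? ?]] /andP[/andP[? ?] /andP[? ?]].
    by split; rewrite /= ?in_itv /=; apply/andP.
  - by rewrite fE setTI; apply: integral_obox0.
  - exact: plane_measurable_obox.
have : ae_eq leb2 P (EFin \o h) (cst 0%E).
  apply: integral_ae_eq => //; first exact: mobox.
  move=> E EP mE; rewrite integral0 -(all0 E mE) fE; congr integral.
  by apply/esym/setIidPl.
by apply: filterS => p hp /hp [].
Qed.

(** A function orthogonal to all test functions vanishes almost everywhere: its
    integral over each box is zero, hence it is zero almost everywhere on each
    box, and countably many rational boxes cover D. *)
Lemma weak_null_ae : {ae leb2, forall p, D p -> h p = 0}.
Proof.
(* good q p: the box with the rational corners coded by q, if inside D, shows that h p = 0 *)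
pose good (q : nat) p := if unpickle q is Some (a, b, c, d) then
  cbox (ratr a) (ratr b) (ratr c) (ratr d) `<=` D ->
  obox (ratr a) (ratr b) (ratr c) (ratr d) p -> h p = 0 else True.
have hg : {ae leb2, forall p, forall q, good q p}.
  apply/ae_foralln => q; rewrite /good; case: unpickle => [[[[a b] c] d]|]; last exact: aeW.
  have [QD|nQD] := pselect (cbox (ratr a) (ratr b) (ratr c) (ratr d) `<=` D).
    by have := ae_obox0 QD; apply: filterS => p hp _.
  exact: aeW.
apply: filterS hg => p hp Dp.
have : nbhs p D by exact: open_nbhs_nbhs.
move=> /nbhs_ballP[e /= e0 eD].
have [a] := @rat_in_itvoo R (p.1 - e) p.1 ltac:(lra).
have [b] := @rat_in_itvoo R p.1 (p.1 + e) ltac:(lra).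
have [c] := @rat_in_itvoo R (p.2 - e) p.2 ltac:(lra).
have [d] := @rat_in_itvoo R p.2 (p.2 + e) ltac:(lra).
rewrite !in_itv /= => /andP[d1 d2] /andP[c1 c2] /andP[b1 b2] /andP[a1 a2].
have := hp (pickle (a, b, c, d)); rewrite /good pickleK; apply.
  move=> q [/=]; rewrite !in_itv /= => /andP[q1 q2] /andP[q3 q4]; apply: eD.
  by split; rewrite /ball /= ltr_distlC; apply/andP; split; lra.
by split; rewrite /= ?in_itv /=; apply/andP.
Qed.

End weak_null.

End PlaneNullSets.

(** * Test functions and the weighted Poincare inequality *)

Section TestFunctions.
Context {R : realType}.
Implicit Types (f g t : R * R -> R) (K D : set (R * R)).
Notation leb2 := (@leb2 R).
Notation plane := (measurableTypeR R * measurableTypeR R)%type.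
Notation mset := (@measurable _ plane).
Notation mfun2 := (@measurable_fun _ _ plane R).

Definition test D t : Prop := smooth t /\
  exists K, [/\ compact K, K `<=` D & forall p, ~ K p -> t p = 0].

Definition dr t := 'D_((1, 0) : R * R) t.
Definition dz t := 'D_((0, 1) : R * R) t.

Lemma test_derive D t v : test D t -> test D ('D_v t).
Proof.
move=> [st [K [cK KD t0]]]; split; first exact: smooth_derive.
by exists K; split=> // p nK; exact: derive_off_compact nK.
Qed.

Lemma test0 D : test D (fun=> 0).
Proof.
split; first exact: smooth_cst.
by exists set0; split=> //; exact: compact0.
Qed.

Lemma test_lin D (a : R) t1 t2 : test D t1 -> test D t2 ->
  test D (fun p => a * t1 p + t2 p).
Proof.
move=> [s1 [K1 [c1 K1D z1]]] [s2 [K2 [c2 K2D z2]]]; split.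
  by apply: smoothD => //; exact: smoothZ.
exists (K1 `|` K2); split; [exact: compactU|by rewrite subUset|].
by move=> p /not_orP[n1 n2]; rewrite z1// z2// mulr0 addr0.
Qed.

(** A product with a function supported inside D is continuous on the whole
    plane although the other factor is only continuous on D.  This is how the
    weights r and 1/r, singular on the axis, enter integrals over the plane. *)
Lemma continuous_off K D f g : compact K -> K `<=` D -> continuous f ->
  (forall p, ~ K p -> f p = 0) -> (forall p, D p -> {for p, continuous g}) ->
  continuous (fun p => f p * g p).
Proof.
move=> cK KD cf f0 cg p; have [Kp|nKp] := pselect (K p).
  apply: cvgM; [exact: cf|exact/cg/KD].
rewrite /prop_for /continuous_at f0// mul0r; apply: cvg_near_cst.
have := near_off_compact cK f0 nKp; apply: filterS => q ->.
by rewrite mul0r.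
Qed.

Lemma test_integrable D t g : open D -> test D t ->
  (forall p, D p -> {for p, continuous g}) ->
  leb2.-integrable D (EFin \o (fun p => t p * g p)).
Proof.
move=> oD [st [K [cK KD t0]]] cg.
have mD : mset D by exact: open_measurable2.
apply: (@integrableS _ plane R leb2 setT D) => //.
apply: (continuous_compact_integrable2 cK).
  exact: (continuous_off cK KD (smooth_continuous st) t0).
by move=> p nK; rewrite t0// mul0r.
Qed.

Lemma test_measurable D t : mset D -> smooth t -> mfun2 D t.
Proof.
move=> mD st; apply: measurable_funTS; apply: continuous_measurable2.
exact: smooth_continuous.
Qed.

Lemma test_sqint D t w : open D -> test D t ->
  (forall p, D p -> {for p, continuous w}) -> sqint leb2 D w t.
Proof.
move=> oD tD cw; have mD : mset D by exact: open_measurable2.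
split; first by apply: test_measurable => //; case: tD.
have := @test_integrable D t (fun p => t p * w p) oD tD.
move=> h; apply: eq_integrable (h _) => //.
  by move=> p _ /=; rewrite expr2 mulrA.
move=> p Dp; apply: cvgM; last exact: cw.
by apply: smooth_continuous; case: tD.
Qed.

Lemma is_diff_is_derive (V W : normedModType R) (f df : V -> W) x v :
  is_diff x f df -> is_derive x v f (df v).
Proof.
move=> [d e]; apply: DeriveDef; first exact: diff_derivable.
by rewrite deriveE// e.
Qed.

(** The divergence theorem for the vector field t^2 A e, with e a coordinate
    direction: the integrand is the derivative of a compactly supported function. *)
Lemma integral_flux D t A dA (b : bool) : open D -> test D t ->
  let e : R * R := if b then (1, 0) else (0, 1) in
  (forall p, D p -> is_derive p e A (dA p)) ->
  (forall p, D p -> {for p, continuous A}) ->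
  (forall p, D p -> {for p, continuous dA}) ->
  let psi p := t p * (2 * 'D_e t p * A p + t p * dA p) in
  leb2.-integrable D (EFin \o psi) /\ Rintegral leb2 D psi = 0.
Proof.
move=> oD tD e dAE cA cdA psi; have [st [K [cK KD t0]]] := tD.
have ct := smooth_continuous st; have cdt := smooth_continuous (smooth_derive e st).
have cg p : D p -> {for p, continuous (fun p => 2 * 'D_e t p * A p + t p * dA p)}.
  move=> Dp; apply: cvgD; apply: cvgM; [|exact: cA|exact: ct|exact: cdA].
  by apply: cvgM; [exact: cvg_cst|exact: cdt].
split; first exact: test_integrable.
rewrite Rintegral_off; last first.
  by move=> p nD; rewrite /psi t0 ?mul0r// => /KD.
apply: (@integral_derive_plane _ K (fun p => t p ^+ 2 * A p) psi b) => //.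
- exact: (continuous_off cK KD ct t0).
- by move=> p nK; rewrite t0// expr0n mul0r.
move=> p; have [Dp|nDp] := pselect (D p); last first.
  have nK : ~ K p by move=> /KD.
  have dc : is_derive p e (cst (0 : R) : R * R -> R) 0 by exact: is_derive_cst.
  rewrite /psi t0// mul0r; apply: near_eq_is_derive dc.
  have := near_off_compact cK t0 nK; apply: filterS => q ->.
  by rewrite expr0n mul0r.
have dt : is_derive p e t ('D_e t p) by apply: derivableP; exact: smooth_derivable.
have h := dAE p Dp.
have d2 := is_deriveM dt dt.
have d3 := is_deriveM d2 h.
rewrite -/e (_ : (fun p => t p ^+ 2 * A p) = (t * t) * A); last first.
  by apply/funext => q; rewrite expr2.
apply: is_derive_eq d3 _; rewrite /psi /GRing.scale /= -[(t * t) p]/(t p * t p); ring.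
Qed.

End TestFunctions.

Section Guide.
Context {R : realType}.
Variable theta : R.
Hypothesis htheta : 0 < theta < pi / 2.
Implicit Types (t : R * R -> R).
Notation leb2 := (@leb2 R).
Notation plane := (measurableTypeR R * measurableTypeR R)%type.
Notation mset := (@measurable _ plane).
Notation D := (Gui theta).

Let c := cos theta.
Let s := sin theta.
Let c_gt0 : 0 < c.
Proof. by apply: cos_gt0_pihalf; move: htheta; have := pi_gt0 R; lra. Qed.

Lemma Gui_rad_gt0 p : D p -> 0 < p.1. Proof. by case. Qed.

Lemma Gui_open : open D.
Proof.
have c1 : continuous (fst : R * R -> R) by move=> ?; exact: cvg_fst.
have c2 : continuous (snd : R * R -> R) by move=> ?; exact: cvg_snd.
have c3 : continuous (fun p : R * R => p.2 * tan theta).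
  by move=> p; apply: cvgM; [exact: c2|exact: cvg_cst].
rewrite (_ : D = [set p | 0 < p.1] `&` [set p | - (pi / sin theta) < p.2] `&`
   [set p | 0 < p.1 - p.2 * tan theta] `&`
   [set p | 0 < p.2 * tan theta + pi / cos theta - p.1]); last first.
  apply/seteqP; split=> p /=.
    by move=> []; rewrite gt_max => ? ? /andP[? ?] ?; rewrite !subr_gt0.
  by rewrite !subr_gt0 => -[[[? ?] ?] ?]; split=> //; rewrite gt_max; apply/andP.
have op (f : R * R -> R) (a : R) : continuous f -> open [set p | a < f p].
  by move=> cf; apply: (open_comp (D := [set x | a < x])) => [p _|]; [exact: cf|exact: open_gt].
apply: openI; [apply: openI; [apply: openI|]|]; apply: op => // p.
- by apply: cvgB; [exact: c1|exact: c3].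
- apply: cvgB; last exact: c1.
  by apply: cvgD; [exact: c3|exact: cvg_cst].
Qed.

(** The distance to the boundary line r cos(theta) = z sin(theta) of the strip; on
    the guide it ranges over (0, pi). *)
Definition strip (p : R * R) : R := c * p.1 - s * p.2.

Lemma strip_bounds p : D p -> 0 < strip p < pi.
Proof.
move=> [_ _]; rewrite gt_max => /andP[_ h1] h2; rewrite /strip.
have tE : tan theta * c = s by rewrite /tan mulfVK// gt_eqF.
have h3 : p.2 * tan theta * c < p.1 * c by rewrite ltr_pM2r.
have h4 : p.1 * c < (p.2 * tan theta + pi / c) * c by rewrite ltr_pM2r.
have e1 : pi / c * c = pi by rewrite mulfVK// gt_eqF.
have e2 : p.2 * tan theta * c = s * p.2 by rewrite -mulrA tE mulrC.
rewrite mulrDl e1 e2 in h4; rewrite e2 in h3.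
apply/andP; lra.
Qed.

Lemma sin_strip_gt0 p : D p -> 0 < sin (strip p).
Proof. by move=> /strip_bounds /andP[? ?]; apply: sin_gt0_pi; apply/andP. Qed.

Lemma is_diff_strip p : is_diff p strip strip.
Proof.
have d1 := @is_diff_fst R R R p; have d2 := @is_diff_snd R R R p.
exact: (is_diffB (is_diffZ c d1) (is_diffZ s d2)).
Qed.

Lemma is_derive_comp_strip (f : R -> R) df p v : is_derive (strip p) (1 : R) f df ->
  is_derive p v (f \o strip) (strip v * df).
Proof.
move=> [d e]; have [ds es] := is_diff_strip p.
have dd := (derivable1_diffP f (strip p)).1 d.
apply: DeriveDef.
  by apply: diff_derivable; exact: differentiable_comp.
by rewrite (derive_comp_affine v dd (is_diff_strip p)) derive_scale1// e.
Qed.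

Definition cot1 (x : R) : R := cos x / sin x.

Lemma is_derive_cot1 x : sin x != 0 -> is_derive x (1 : R) cot1 (- (sin x)^-2).
Proof.
move=> s0; have d := is_deriveM (is_derive_cos x) (is_deriveV s0 (is_derive_sin x)).
apply: is_derive_eq d _; rewrite /GRing.scale /= -!exprVn.
have := cos2Dsin2 x => h; apply: (mulIf s0); apply: (mulIf s0).
have e : (sin x)^-1 * sin x = 1 by rewrite mulVf.
transitivity (- (cos x ^+ 2) * ((sin x)^-1 * sin x) ^+ 2 - sin x ^+ 2 * ((sin x)^-1 * sin x)).
  by ring.
transitivity (- ((sin x)^-1 * sin x) ^+ 2); last by ring.
by rewrite e; lra.
Qed.

Definition cot p := cot1 (strip p).
Definition csc2 p := (sin (strip p)) ^- 2.

Lemma is_derive_cot p v : D p -> is_derive p v cot (- (strip v * csc2 p)).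
Proof.
move=> Dp; have s0 : sin (strip p) != 0 by rewrite gt_eqF// sin_strip_gt0.
by rewrite -mulrN; apply: is_derive_comp_strip; exact: is_derive_cot1.
Qed.

Lemma csc2E p : D p -> csc2 p = 1 + cot p ^+ 2.
Proof.
move=> Dp; have s0 : sin (strip p) != 0 by rewrite gt_eqF// sin_strip_gt0.
rewrite /csc2 /cot /cot1; have := cos2Dsin2 (strip p) => h.
by apply: (mulIf (expf_neq0 2 s0)); rewrite mulVf ?expf_neq0// -[LHS]h; field.
Qed.

Lemma continuous_strip : continuous strip.
Proof.
move=> p; apply/differentiable_continuous; by have [] := is_diff_strip p.
Qed.

Lemma continuous_cot p : D p -> {for p, continuous cot}.
Proof.
move=> Dp; have s0 : sin (strip p) != 0 by rewrite gt_eqF// sin_strip_gt0.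
have h2 : {for strip p, continuous cot1}.
  by apply: differentiable_continuous; apply/derivable1_diffP; have [] := is_derive_cot1 s0.
have h3 := @continuous_comp _ _ _ strip cot1 p (@continuous_strip p) h2.
exact: h3.
Qed.

Lemma continuous_csc2 p : D p -> {for p, continuous csc2}.
Proof.
move=> Dp; have s0 : sin (strip p) != 0 by rewrite gt_eqF// sin_strip_gt0.
rewrite /csc2; apply: cvgV; first by rewrite expf_neq0.
have h2 : {for strip p, continuous (fun x : R => sin x ^+ 2)}.
  by apply: cvgM; exact: continuous_sin.
exact: (@continuous_comp _ _ _ strip (fun x : R => sin x ^+ 2) p (@continuous_strip p) h2).
Qed.

Definition winv (p : R * R) : R := p.1^-1.

Lemma continuous_rad (p : R * R) : {for p, continuous (@rad2 R)}.
Proof. exact: cvg_fst. Qed.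

Lemma continuous_winv p : D p -> {for p, continuous winv}.
Proof.
move=> Dp; apply: cvgV; first by rewrite gt_eqF// Gui_rad_gt0.
exact: continuous_rad.
Qed.

(** The function phi = r^(-1/2) sin(strip) satisfies
    - Delta phi = (1 - 1/(4 r^2)) phi in cylindrical coordinates.  With
    F = - grad phi / phi the identity
    |grad t|^2 r + div(t^2 r F) = |grad t + F t|^2 r + (1 - 1/(4 r^2)) t^2 r
    gives the bound, since the divergence has integral zero. *)
Lemma test_poincare t : test D t ->
  ip leb2 D (@rad2 R) t t <=
  ip leb2 D (@rad2 R) (dr t) (dr t) + ip leb2 D (@rad2 R) (dz t) (dz t) +
  4^-1 * ip leb2 D winv t t.
Proof.
move=> tD; have oD := Gui_open; have mD : mset D by exact: open_measurable2.
have crad p : D p -> {for p, continuous (@rad2 R)} by move=> _; exact: continuous_rad.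
(* the components of r F, and their partial derivatives *)
pose A1 p := 2^-1 - c * (p.1 * cot p); pose dA1 p := - c * (cot p - c * (p.1 * csc2 p)).
pose A2 p := s * (p.1 * cot p); pose dA2 p := s ^+ 2 * (p.1 * csc2 p).
have crc p : D p -> {for p, continuous (fun q : R * R => q.1 * cot q)}.
  by move=> Dp; apply: cvgM; [exact: continuous_rad|exact: continuous_cot].
have crs p : D p -> {for p, continuous (fun q : R * R => q.1 * csc2 q)}.
  by move=> Dp; apply: cvgM; [exact: continuous_rad|exact: continuous_csc2].
have [|||I1 F1] := @integral_flux R D t A1 dA1 true oD tD.
- move=> p Dp; have d1 := is_diff_is_derive ((1, 0) : R * R) (@is_diff_fst R R R p).
  have d2 := is_deriveM d1 (is_derive_cot ((1, 0) : R * R) Dp).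
  have d3 := is_deriveB (is_derive_cst (2^-1 : R) p ((1, 0) : R * R)) (is_deriveZ c d2).
  apply: is_derive_eq d3 _; rewrite /dA1 /strip /GRing.scale /=; ring.
- move=> p Dp; apply: cvgB; first exact: cvg_cst.
  by apply: cvgM; [exact: cvg_cst|exact: crc].
- move=> p Dp; apply: cvgM; first exact: cvg_cst.
  apply: cvgB; first exact: continuous_cot.
  by apply: cvgM; [exact: cvg_cst|exact: crs].
have [|||I2 F2] := @integral_flux R D t A2 dA2 false oD tD.
- move=> p Dp; have d1 := is_diff_is_derive ((0, 1) : R * R) (@is_diff_fst R R R p).
  have d2 := is_deriveM d1 (is_derive_cot ((0, 1) : R * R) Dp).
  have d3 := is_deriveZ s d2.
  apply: is_derive_eq d3 _; rewrite /dA2 /strip /GRing.scale /=; ring.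
- by move=> p Dp; apply: cvgM; [exact: cvg_cst|exact: crc].
- by move=> p Dp; apply: cvgM; [exact: cvg_cst|exact: crs].
have St := test_sqint oD tD crad.
have S1 := test_sqint oD (test_derive ((1, 0) : R * R) tD) crad.
have S2 := test_sqint oD (test_derive ((0, 1) : R * R) tD) crad.
have Sw := test_sqint oD tD continuous_winv.
have J1 := St.2; have J2 := S1.2; have J3 := S2.2; have J4 := integrableZl mD (4^-1) Sw.2.
have E : ip leb2 D (@rad2 R) (dr t) (dr t) + ip leb2 D (@rad2 R) (dz t) (dz t) +
  4^-1 * ip leb2 D winv t t - ip leb2 D (@rad2 R) t t =
  Rintegral leb2 D (fun p => ((dr t p + t p * ((2 * p.1)^-1 - c * cot p)) ^+ 2 +
      (dz t p + t p * (s * cot p)) ^+ 2) * p.1).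
  pose f1 p := dr t p ^+ 2 * @rad2 R p; pose f2 p := dz t p ^+ 2 * @rad2 R p.
  pose f4 p := t p ^+ 2 * winv p; pose f0 p := t p ^+ 2 * @rad2 R p.
  pose g1 p := f1 p + f2 p; pose g2 p := g1 p + 4^-1 * f4 p; pose g3 p := g2 p - f0 p.
  pose psi1 p := t p * (2 * dr t p * A1 p + t p * dA1 p).
  pose psi2 p := t p * (2 * dz t p * A2 p + t p * dA2 p).
  have K1 : leb2.-integrable D (EFin \o g1) by exact: (integrableD mD J2 J3).
  have K2 : leb2.-integrable D (EFin \o g2) by exact: (integrableD mD K1 J4).
  have K3 : leb2.-integrable D (EFin \o g3) by exact: (integrableB mD K2 J1).
  have K4 : leb2.-integrable D (EFin \o (fun p => g3 p + psi1 p)) by exact: (integrableD mD K3 I1).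
  have sq u w : ip leb2 D w u u = Rintegral leb2 D (fun p => u p ^+ 2 * w p).
    by apply: eq_Rintegral => p _; rewrite expr2.
  transitivity (Rintegral leb2 D (fun p => (g3 p + psi1 p) + psi2 p)).
    rewrite (@RintegralD _ plane R leb2 D _ _ mD K4 I2) F2 addr0.
    rewrite (@RintegralD _ plane R leb2 D _ _ mD K3 I1) F1 addr0.
    rewrite (@RintegralB _ plane R leb2 D g2 f0 mD K2 J1).
    rewrite (@RintegralD _ plane R leb2 D g1 (fun p => 4^-1 * f4 p) mD K1 J4).
    rewrite (@RintegralD _ plane R leb2 D f1 f2 mD J2 J3).
    by rewrite (@RintegralZl _ plane R leb2 D f4 _ mD Sw.2) !sq.
  apply: eq_Rintegral => p /set_mem Dp.
  have r0 : p.1 != 0 by rewrite gt_eqF// Gui_rad_gt0.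
  rewrite /g3 /g2 /g1 /f1 /f2 /f4 /f0 /psi1 /psi2 /A1 /A2 /dA1 /dA2 /winv /rad2 csc2E//.
  have : c ^+ 2 + s ^+ 2 = 1 by exact: cos2Dsin2.
  set k := cot p; set a := dr t p; set b := dz t p; set x := t p; move=> cs.
  have s2 : s ^+ 2 = 1 - c ^+ 2 by lra.
  rewrite [RHS](_ : _ = a ^+ 2 * p.1 + b ^+ 2 * p.1 + 2 * a * x * (2^-1 - c * p.1 * k) +
    2 * b * x * s * k * p.1 + x ^+ 2 * (4^-1 * p.1^-1 - c * k) + x ^+ 2 * k ^+ 2 * p.1 * (c ^+ 2 + s ^+ 2)); last first.
    by field.
  by rewrite cs s2; field.
rewrite -subr_ge0 E; apply: Rintegral_ge0 => p Dp.
by rewrite mulr_ge0 ?addr_ge0 ?sqr_ge0// ltW// Gui_rad_gt0.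
Qed.

End Guide.

(** * The closed form on the guide and its resolvent *)

Section SemiNorm.
Context {R : realType} {X : lmodType R} (K : X -> Prop).
Hypothesis Klin : forall a x y, K x -> K y -> K (a *: x + y).
Hypothesis K0 : K 0.

Lemma semi_norm_triangle e x y : semi_inner K e -> K x -> K y ->
  Num.sqrt (e (x + y) (x + y)) <= Num.sqrt (e x x) + Num.sqrt (e y y).
Proof.
move=> he Kx Ky; have epos z : K z -> 0 <= e z z by case: he => _ _; apply.
have h : e (x + y) (x + y) <= (Num.sqrt (e x x) + Num.sqrt (e y y)) ^+ 2.
  have := inner_expand Klin K0 he 1 Kx Ky; rewrite scale1r => ->.
  rewrite sqrrD !sqr_sqrtr ?epos// mulr1 expr1n mul1r.
  have := cauchy_schwarz Klin K0 he Kx Ky => cs.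
  have := ler_wsqrtr cs; rewrite sqrtr_sqr sqrtrM ?epos// => cs2.
  have := ler_norm (e x y); lra.
have := ler_wsqrtr h; rewrite sqrtr_sqr ger0_norm// addr_ge0// sqrtr_ge0.
Qed.

Lemma closure_le (eP eM eN : X -> X -> R) x : K x ->
  semi_inner K eP -> semi_inner K eM -> semi_inner K eN ->
  (forall y, K y -> eP y y <= eN y y) -> (forall y, K y -> eM y y <= eN y y) ->
  (forall c : R, 0 < c -> exists j, [/\ K j, eM j j <= eP j j & eN (x - j) (x - j) < c]) ->
  eM x x <= eP x x.
Proof.
move=> Kx hP hM hN PN MN hx.
have Ppos z : K z -> 0 <= eP z z by case: hP => _ _; apply.
suff h : Num.sqrt (eM x x) <= Num.sqrt (eP x x).
  by move: h; rewrite ler_sqrt// Ppos.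
apply/ler_addgt0Pl => c c0.
have c2 : 0 < (c / 2) ^+ 2 by rewrite exprn_gt0// divr_gt0.
have [j [Kj MP Nj]] := hx _ c2.
have Kd : K (x - j) by rewrite addrC -scaleN1r; exact: Klin.
have bd e : (forall y, K y -> e y y <= eN y y) -> Num.sqrt (e (x - j) (x - j)) <= c / 2.
  move=> he; apply: le_trans (ler_wsqrtr (le_trans (he _ Kd) (ltW Nj))) _.
  by rewrite sqrtr_sqr ger0_norm// divr_ge0// ltW.
have t1 := semi_norm_triangle hM Kj Kd.
have KNd : K (-1 *: (x - j)) by rewrite -[_ *: _]addr0; exact: Klin.
have t2 := semi_norm_triangle hP Kx KNd.
have eN1 : eP (-1 *: (x - j)) (-1 *: (x - j)) = eP (x - j) (x - j).
  by rewrite (linear_onZ K0 _ (inner_linl hP KNd))// (linear_onZ K0 _ (inner_linr Klin hP Kd))//; ring.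
rewrite eN1 (_ : x + -1 *: (x - j) = j) in t2; last by rewrite scaleN1r subKr.
rewrite (_ : j + (x - j) = x) in t1; last by rewrite addrC subrK.
have := ler_wsqrtr MP; have := bd _ PN; have := bd _ MN; lra.
Qed.

End SemiNorm.

Section Weights.
Context d (T : measurableType d) (R : realType).
Variables (mu : {measure set T -> \bar R}) (D : set T).
Hypothesis mD : measurable D.

Lemma sqint_weight (w1 w2 f : T -> R) : measurable_fun D w1 ->
  (forall x, D x -> 0 <= w1 x <= w2 x) -> sqint mu D w2 f -> sqint mu D w1 f.
Proof.
move=> mw h [mf If]; split=> //; apply: le_integrable If => //.
  by apply/measurable_EFinP; apply: measurable_funM => //; exact: measurable_funX.
move=> x Dx; have /andP[h1 h2] := h x Dx; rewrite /= lee_fin.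
have h3 : 0 <= w2 x := le_trans h1 h2.
rewrite (ger0_norm (mulr_ge0 (sqr_ge0 _) h1)) (ger0_norm (mulr_ge0 (sqr_ge0 _) h3)).
by rewrite ler_wpM2l ?sqr_ge0.
Qed.

Lemma ipD_weight (w1 w2 f g : T -> R) :
  mu.-integrable D (EFin \o (fun x => f x * g x * w1 x)) ->
  mu.-integrable D (EFin \o (fun x => f x * g x * w2 x)) ->
  ip mu D (fun x => w1 x + w2 x) f g = ip mu D w1 f g + ip mu D w2 f g.
Proof.
move=> I1 I2; rewrite /ip -RintegralD//; apply: eq_Rintegral => x _; ring.
Qed.

End Weights.

Section FormDomain.
Context {R : realType}.
Variable theta : R.
Hypothesis htheta : 0 < theta < pi / 2.
Notation leb2 := (@leb2 R).
Notation plane := (measurableTypeR R * measurableTypeR R)%type.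
Notation mset := (@measurable _ plane).
Notation mfun2 := (@measurable_fun _ _ plane R).
Notation D := (Gui theta).
Notation rad2 := (@rad2 R).
Notation fR := (R * R -> R).
Notation X := ((fR * fR) * fR)%type.

Let oD : open D. Proof. exact: Gui_open. Qed.
Let mD : mset D. Proof. exact: open_measurable2. Qed.

Definition wtot (p : R * R) : R := rad2 p + winv p.

Let crad p : D p -> {for p, continuous rad2}. Proof. by move=> _; exact: continuous_rad. Qed.
Let cwinv p : D p -> {for p, continuous (@winv R)}. Proof. exact: continuous_winv. Qed.
Let cwtot p : D p -> {for p, continuous wtot}.
Proof. by move=> Dp; apply: cvgD; [exact: continuous_rad|exact: cwinv]. Qed.

Let mw (w : fR) : (forall p, D p -> {for p, continuous w}) -> mfun2 D w.
Proof. by move=> cw; exact: continuous_on_measurable2. Qed.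
Let mrad : mfun2 D rad2. Proof. exact: mw. Qed.
Let mwinv : mfun2 D (@winv R). Proof. exact: mw. Qed.
Let mwtot : mfun2 D wtot. Proof. exact: mw. Qed.
Let rad_gt0 p : D p -> 0 < rad2 p. Proof. exact: Gui_rad_gt0. Qed.
Let winv_gt0 p : D p -> 0 < winv p. Proof. by move=> Dp; rewrite invr_gt0 rad_gt0. Qed.
Let wtot_gt0 p : D p -> 0 < wtot p.
Proof. by move=> Dp; rewrite addr_gt0 ?rad_gt0 ?winv_gt0. Qed.

Notation sq w := (@sqint _ plane R leb2 D w).
Notation ipr := (@ip _ plane R leb2 D rad2).
Notation ipv := (@ip _ plane R leb2 D (@winv R)).
Notation ipt := (@ip _ plane R leb2 D wtot).

Lemma sq_rad f : sq wtot f -> sq rad2 f.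
Proof.
apply: sqint_weight => // p Dp; rewrite ltW ?rad_gt0//=.
by rewrite lerDl ltW// winv_gt0.
Qed.

Lemma sq_winv f : sq wtot f -> sq (@winv R) f.
Proof.
apply: sqint_weight => // p Dp; rewrite ltW ?winv_gt0//=.
by rewrite lerDr ltW// rad_gt0.
Qed.

Lemma iptE f g : sq wtot f -> sq wtot g -> ipt f g = ipr f g + ipv f g.
Proof.
move=> hf hg; apply: ipD_weight => //.
  by apply: (@sqint_integrableM _ plane R leb2 D rad2) => //; exact: sq_rad.
by apply: (@sqint_integrableM _ plane R leb2 D (@winv R)) => //; exact: sq_winv.
Qed.

Definition finite_energy (F : X) : Prop := [/\ sq wtot F.1.1, sq rad2 F.1.2 & sq rad2 F.2].

Let sqr_lin (a : R) (f g : fR) : sq rad2 f -> sq rad2 g -> sq rad2 (a *: f + g).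
Proof. exact: (@sqint_lin _ plane R leb2 D rad2 mD mrad rad_gt0 a f g). Qed.
Let sqt_lin (a : R) (f g : fR) : sq wtot f -> sq wtot g -> sq wtot (a *: f + g).
Proof. exact: (@sqint_lin _ plane R leb2 D wtot mD mwtot wtot_gt0 a f g). Qed.

Let pr_u (a : R) (F G : X) : (a *: F + G).1.1 = a *: F.1.1 + G.1.1. Proof. by []. Qed.
Let pr_a (a : R) (F G : X) : (a *: F + G).1.2 = a *: F.1.2 + G.1.2. Proof. by []. Qed.
Let pr_b (a : R) (F G : X) : (a *: F + G).2 = a *: F.2 + G.2. Proof. by []. Qed.

Lemma finite_energy_lin (a : R) (F G : X) : finite_energy F -> finite_energy G -> finite_energy (a *: F + G).
Proof.
move=> [f1 f2 f3] [g1 g2 g3]; split; rewrite ?pr_u ?pr_a ?pr_b;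
  [exact: sqt_lin|exact: sqr_lin|exact: sqr_lin].
Qed.

Lemma finite_energy0 : finite_energy 0.
Proof. by split; exact: sqint0. Qed.

(** The weights k1 and k2 multiply the integrals of u^2 r and of u^2 / r; the
    first one also serves, with a negative value, to shift the spectrum. *)
Definition energy (k1 k2 : R) (F G : X) : R :=
  k1 * ipr F.1.1 G.1.1 + k2 * ipv F.1.1 G.1.1 + ipr F.1.2 G.1.2 + ipr F.2 G.2.
Definition mass (F G : X) : R := ipr F.1.1 G.1.1.

Let ipr_lin (a : R) (f g h : fR) : sq rad2 f -> sq rad2 g -> sq rad2 h ->
  ipr (a *: f + g) h = a * ipr f h + ipr g h.
Proof. exact: (@ip_lin _ plane R leb2 D rad2 mD mrad rad_gt0 a f g h). Qed.
Let ipv_lin (a : R) (f g h : fR) : sq (@winv R) f -> sq (@winv R) g -> sq (@winv R) h ->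
  ipv (a *: f + g) h = a * ipv f h + ipv g h.
Proof. exact: (@ip_lin _ plane R leb2 D (@winv R) mD mwinv winv_gt0 a f g h). Qed.
Let iprC (f g : fR) : ipr f g = ipr g f. Proof. exact: ipC. Qed.
Let ipvC (f g : fR) : ipv f g = ipv g f. Proof. exact: ipC. Qed.
Let ipr_ge0 (f : fR) : 0 <= ipr f f. Proof. exact: ip_ge0. Qed.
Let ipv_ge0 (f : fR) : 0 <= ipv f f. Proof. exact: ip_ge0. Qed.

Lemma mass_lin (z : X) : finite_energy z -> linear_on finite_energy (mass ^~ z).
Proof.
move=> [z1 _ _] a x y [x1 _ _] [y1 _ _]; rewrite /mass pr_u.
exact: ipr_lin (sq_rad x1) (sq_rad y1) (sq_rad z1).
Qed.

Lemma energy_lin k1 k2 (z : X) : finite_energy z -> linear_on finite_energy ((energy k1 k2) ^~ z).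
Proof.
move=> [z1 z2 z3] a x y [x1 x2 x3] [y1 y2 y3]; rewrite /energy pr_u pr_a pr_b.
rewrite (ipr_lin a (sq_rad x1) (sq_rad y1) (sq_rad z1)).
rewrite (ipv_lin a (sq_winv x1) (sq_winv y1) (sq_winv z1)).
by rewrite (ipr_lin a x2 y2 z2) (ipr_lin a x3 y3 z3); ring.
Qed.

Lemma energyC k1 k2 (F G : X) : energy k1 k2 F G = energy k1 k2 G F.
Proof.
rewrite /energy (iprC F.1.1 G.1.1) (iprC F.1.2 G.1.2) (iprC F.2 G.2).
by rewrite (ipvC F.1.1 G.1.1).
Qed.

Lemma energy_semi_inner k1 k2 : 0 <= k1 -> 0 <= k2 -> semi_inner finite_energy (energy k1 k2).
Proof.
move=> k10 k20; split=> [x y _ _|z Kz|x _]; [exact: energyC|exact: energy_lin|].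
by rewrite /energy !addr_ge0 ?mulr_ge0 ?ipr_ge0 ?ipv_ge0.
Qed.

Lemma mass_semi_inner : semi_inner finite_energy mass.
Proof.
split=> [x y _ _|z Kz|x _]; [exact: iprC|exact: mass_lin|exact: ipr_ge0].
Qed.

Notation N := (energy 1 1).

Definition jet (t : fR) : X := ((t, dr t), dz t).

Lemma finite_energy_jet t : test D t -> finite_energy (jet t).
Proof.
by move=> tD; split; apply: test_sqint => //; exact: test_derive.
Qed.

Lemma jet_lin (a : R) t1 t2 : smooth t1 -> smooth t2 ->
  jet (fun p => a * t1 p + t2 p) = a *: jet t1 + jet t2.
Proof.
move=> s1 s2; have dl v : 'D_v (fun p => a * t1 p + t2 p) = a *: 'D_v t1 + 'D_v t2.
  apply/funext => p; rewrite (@deriveD _ _ _ (a *: t1) t2); last 2 first.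
  - by apply: derivableZ; exact: smooth_derivable.
  - exact: smooth_derivable.
  by rewrite deriveZ//; exact: smooth_derivable.
rewrite /jet /dr /dz dl dl; reflexivity.
Qed.

(** The closure of the test functions in the energy norm.  Each function is kept
    together with its partial derivatives: in a space of triples completeness is
    that of three spaces of square integrable functions, and no differentiation
    of limits is involved. *)
Definition form_dom (F : X) : Prop := finite_energy F /\
  forall c : R, 0 < c -> exists2 t, test D t & N (F - jet t) (F - jet t) < c.

Let N_inner : semi_inner finite_energy N. Proof. exact: energy_semi_inner. Qed.
Let finite_energyB (F G : X) : finite_energy F -> finite_energy G -> finite_energy (F - G).
Proof. by move=> hF hG; apply: (subspaceB finite_energy_lin). Qed.

Lemma form_dom_jet t : test D t -> form_dom (jet t).
Proof.
move=> tD; split; first exact: finite_energy_jet.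
move=> c c0; exists t => //; rewrite subrr.
by rewrite (linear_on0 finite_energy0 (energy_lin 1 1 finite_energy0)).
Qed.

Lemma energy_split (x y : X) : finite_energy x -> finite_energy y ->
  N (x + y) (x + y) <= 2 * N x x + 2 * N y y.
Proof.
move=> Kx Ky; have h1 := inner_expand finite_energy_lin finite_energy0 N_inner 1 Kx Ky.
have h2 := inner_expand finite_energy_lin finite_energy0 N_inner (-1) Kx Ky.
have [_ _ pos] := N_inner.
have := pos (x + -1 *: y) (subspaceD finite_energy_lin Kx (subspaceZ finite_energy_lin finite_energy0 (-1) Ky)).
rewrite h2; rewrite scale1r in h1; rewrite h1; lra.
Qed.

Lemma energy_scale (a : R) (x : X) : finite_energy x -> N (a *: x) (a *: x) = a ^+ 2 * N x x.
Proof.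
move=> Kx; have Ka := subspaceZ finite_energy_lin finite_energy0 a Kx.
by rewrite (linear_onZ finite_energy0 _ (inner_linl N_inner Ka))// (linear_onZ finite_energy0 _ (inner_linr finite_energy_lin N_inner Kx))//; ring.
Qed.

Lemma form_dom_lin (a : R) (F G : X) : form_dom F -> form_dom G -> form_dom (a *: F + G).
Proof.
move=> [mF hF] [mG hG]; split; first exact: finite_energy_lin.
move=> c c0.
have a1 : 0 < 4 * (a ^+ 2 + 1) by have := sqr_ge0 a; lra.
have [t1 T1 n1] := hF _ (divr_gt0 c0 a1).
have c4 : 0 < c / 4 by lra.
have [t2 T2 n2] := hG _ c4.
exists (fun p => a * t1 p + t2 p); first exact: test_lin.
have [s1 _] := T1; have [s2 _] := T2; rewrite (jet_lin _ s1 s2).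
have -> : a *: F + G - (a *: jet t1 + jet t2) = a *: (F - jet t1) + (G - jet t2).
  by rewrite scalerBr opprD addrACA.
have M1 := finite_energyB mF (finite_energy_jet T1); have M2 := finite_energyB mG (finite_energy_jet T2).
apply: le_lt_trans (energy_split (subspaceZ finite_energy_lin finite_energy0 a M1) M2) _; rewrite energy_scale//.
have : N (F - jet t1) (F - jet t1) * (4 * (a ^+ 2 + 1)) < c by rewrite -ltr_pdivlMr.
have [_ _ pos] := N_inner; have := pos _ M1; move: n2.
set x := N _ _; set y := N _ _ => n2 y0.
by rewrite mulrCA mulrDr mulr1 (mulrC y) => h; lra.
Qed.

Lemma form_dom0 : form_dom 0.
Proof.
have := form_dom_jet (test0 D); congr form_dom; rewrite /jet /dr /dz.
by congr ((_, _), _); apply/funext => p; rewrite ?derive_cst.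
Qed.

Lemma energy_complete : complete_on finite_energy N.
Proof.
move=> s hs hc.
have le1 F : finite_energy F -> ipt F.1.1 F.1.1 <= N F F.
  move=> [f1 _ _]; rewrite iptE// /energy !mul1r.
  have := ipr_ge0 F.1.2; have := ipr_ge0 F.2; lra.
have le2 F : finite_energy F -> ipr F.1.2 F.1.2 <= N F F.
  move=> _; rewrite /energy !mul1r.
  have := ipr_ge0 F.1.1; have := ipv_ge0 F.1.1; have := ipr_ge0 F.2; lra.
have le3 F : finite_energy F -> ipr F.2 F.2 <= N F F.
  move=> _; rewrite /energy !mul1r.
  have := ipr_ge0 F.1.1; have := ipv_ge0 F.1.1; have := ipr_ge0 F.1.2; lra.
have [||u su hu] := @L2_complete _ plane R leb2 D wtot mD mwtot wtot_gt0 (fun n => (s n).1.1).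
- by move=> n; have [] := hs n.
- move=> c /hc[M hM]; exists M => n m nM mM.
  by apply: le_lt_trans (hM n m nM mM); apply: (le1 (s n - s m)); exact: finite_energyB.
have [||a sa ha] := @L2_complete _ plane R leb2 D rad2 mD mrad rad_gt0 (fun n => (s n).1.2).
- by move=> n; have [] := hs n.
- move=> c /hc[M hM]; exists M => n m nM mM.
  by apply: le_lt_trans (hM n m nM mM); apply: (le2 (s n - s m)); exact: finite_energyB.
have [||b sb hb] := @L2_complete _ plane R leb2 D rad2 mD mrad rad_gt0 (fun n => (s n).2).
- by move=> n; have [] := hs n.
- move=> c /hc[M hM]; exists M => n m nM mM.
  by apply: le_lt_trans (hM n m nM mM); apply: (le3 (s n - s m)); exact: finite_energyB.
have mF : finite_energy ((u, a), b) by split.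
exists ((u, a), b) => // c c0.
have c3 : 0 < c / 3 by lra.
have [M1 h1] := hu _ c3; have [M2 h2] := ha _ c3; have [M3 h3] := hb _ c3.
exists (maxn M1 (maxn M2 M3)) => n; rewrite !geq_max => /and3P[/h1 + /h2 + /h3].
have md := finite_energyB (hs n) mF; have [d1 _ _] := md.
have -> : N (s n - ((u, a), b)) (s n - ((u, a), b)) =
  ipt ((s n).1.1 - u) ((s n).1.1 - u) + ipr ((s n).1.2 - a) ((s n).1.2 - a)
   + ipr ((s n).2 - b) ((s n).2 - b).
  by rewrite iptE// /energy !mul1r.
lra.
Qed.

Lemma form_dom_complete : complete_on form_dom N.
Proof.
move=> s hs hc; have [|x mx hx] := energy_complete _ hc; first by move=> n; have [] := hs n.
exists x => //; split=> // c c0.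
have c4 : 0 < c / 4 by lra.
have [M hM] := hx _ c4; have [ms hsM] := hs M.
have [t tD ht] := hsM _ c4; exists t => //.
have mt := finite_energy_jet tD.
have -> : x - jet t = -1 *: (s M - x) + (s M - jet t).
  by rewrite scaleN1r opprB addrA subrK.
have m1 := finite_energyB ms mx; have m2 := finite_energyB ms mt.
apply: le_lt_trans (energy_split (subspaceZ finite_energy_lin finite_energy0 (-1) m1) m2) _; rewrite energy_scale//.
have := hM M (leqnn _); lra.
Qed.

(** The inequality for test functions passes to the closure because both sides
    are dominated by the energy norm. *)
Lemma form_dom_poincare (F : X) : form_dom F -> mass F F <= energy 0 4^-1 F F.
Proof.
move=> [mF hF].
have q0 : 0 <= 4^-1 :> R by [].
apply: (@closure_le _ _ finite_energy finite_energy_lin finite_energy0 (energy 0 4^-1) mass N F mF).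
- exact: energy_semi_inner.
- exact: mass_semi_inner.
- exact: N_inner.
- move=> y _; rewrite /energy; have := ipr_ge0 y.1.1; have := ipv_ge0 y.1.1; lra.
- move=> y _; rewrite /energy /mass !mul1r.
  have := ipr_ge0 y.1.2; have := ipr_ge0 y.2; have := ipv_ge0 y.1.1; lra.
- move=> c /hF[t tD ht]; exists (jet t); split=> //; first exact: finite_energy_jet.
  by rewrite /mass /energy mul0r add0r -addrA addrC; exact: (test_poincare htheta tD).
Qed.

(** The Poincare inequality leaves room for every shift al below 1. *)
Lemma energy_coercive (k al : R) (F : X) : form_dom F -> 4^-1 <= k -> al < 1 ->
  (Num.min 1 (1 - al) / 8) * N F F <= energy (- al) k F F.
Proof.
move=> KF k4 al1; have P := form_dom_poincare KF; move: P; rewrite /energy /mass.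
have := ipr_ge0 F.1.1; have := ipv_ge0 F.1.1; have := ipr_ge0 F.1.2; have := ipr_ge0 F.2.
set u := ipr F.1.1 _; set v := ipv F.1.1 _; set a := ipr F.1.2 _; set b := ipr F.2 _.
move=> b0 a0 v0 u0 P.
have kv : 4^-1 * v <= k * v by rewrite ler_wpM2r.
have [al0|al0] := lerP al 0.
  have -> : Num.min 1 (1 - al) = 1 by apply/min_idPl; lra.
  have : 0 <= - al * u by rewrite mulr_ge0// oppr_ge0.
  lra.
have -> : Num.min 1 (1 - al) = 1 - al by apply/min_idPr; lra.
have h1 : al * u <= al * (0 * u + 4^-1 * v + a + b) by rewrite ler_wpM2l// ltW.
have h2 : 0 <= (1 - al) * (0 * u + 4^-1 * v + a + b - u) by rewrite mulr_ge0; lra.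
have h3 : 0 <= (1 - al) * v by rewrite mulr_ge0; lra.
have h4 : 0 <= (1 - al) * a by rewrite mulr_ge0; lra.
have h5 : 0 <= (1 - al) * b by rewrite mulr_ge0; lra.
have h6 : 0 <= (1 - al) * u by rewrite mulr_ge0; lra.
nra.
Qed.

Lemma form_dom_finite_energy F : form_dom F -> finite_energy F. Proof. by case. Qed.

(** The solution operator for the spectral parameter al + i be, in real form: by
    coercivity the shifted form is a complete inner product, and the term with be
    is the symmetric perturbation that coupled_riesz handles. *)
Lemma real_resolvent (k al be : R) (f0 f1 : fR) : 4^-1 <= k -> al < 1 ->
  sq rad2 f0 -> sq rad2 f1 ->
  exists F0 F1, [/\ form_dom F0, form_dom F1,
    forall G, form_dom G -> energy 0 k F0 G = ipr f0 G.1.1 + al * mass F0 G - be * mass F1 G &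
    forall G, form_dom G -> energy 0 k F1 G = ipr f1 G.1.1 + al * mass F1 G + be * mass F0 G].
Proof.
move=> k4 al1 sf0 sf1; pose e := energy (- al) k; pose c := Num.min 1 (1 - al) / 8.
have c0 : 0 < c by rewrite divr_gt0// lt_min ltr01 subr_gt0.
have [_ _ Npos] := N_inner.
have sub (l : X -> R) : linear_on finite_energy l -> linear_on form_dom l.
  by move=> h a x y /form_dom_finite_energy ? /form_dom_finite_energy ?; exact: h.
have coer F : form_dom F -> c * N F F <= e F F by move=> KF; exact: energy_coercive.
have he : semi_inner form_dom e.
  split=> [x y _ _|z Kz|x Kx]; first exact: energyC.
    by apply: sub; apply: energy_lin; exact: form_dom_finite_energy.
  apply: le_trans (coer x Kx); apply: mulr_ge0; first exact: ltW.
  exact/Npos/form_dom_finite_energy.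
have KRB (x y : X) : form_dom x -> form_dom y -> form_dom (x - y) by move=> ? ?; apply: (subspaceB form_dom_lin).
have up F : e F F <= (1 + `|al| + `|k|) * N F F.
  rewrite /e /energy; have := ipr_ge0 F.1.1; have := ipv_ge0 F.1.1.
  have := ipr_ge0 F.1.2; have := ipr_ge0 F.2.
  set u := ipr F.1.1 _; set v := ipv F.1.1 _; set a := ipr F.1.2 _; set b := ipr F.2 _.
  move=> b0 a0 v0 u0; have n1 := normr_ge0 al; have n2 := normr_ge0 k.
  have h1 : - al * u <= `|al| * u by rewrite ler_wpM2r// -normrN ler_norm.
  have h2 : k * v <= `|k| * v by rewrite ler_wpM2r// ler_norm.
  have := mulr_ge0 n1 v0; have := mulr_ge0 n1 a0; have := mulr_ge0 n1 b0.
  have := mulr_ge0 n2 u0; have := mulr_ge0 n2 a0; have := mulr_ge0 n2 b0; lra.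
have M0 : 0 < 1 + `|al| + `|k| by have := normr_ge0 al; have := normr_ge0 k; lra.
have hc : complete_on form_dom e.
  move=> s hs hC; have [|x Kx hx] := form_dom_complete hs.
    move=> g g0; have [M hM] := hC _ (mulr_gt0 c0 g0); exists M => n m nM mM.
    rewrite -(ltr_pM2l c0); apply: le_lt_trans (hM n m nM mM); exact/coer/KRB.
  exists x => // g g0; have [M hM] := hx _ (divr_gt0 g0 M0); exists M => n nM.
  apply: le_lt_trans (up _) _; rewrite mulrC -ltr_pdivlMr//; exact: hM.
have mN F : mass F F <= N F F.
  rewrite /mass /energy; have := ipr_ge0 F.1.1; have := ipv_ge0 F.1.1.
  have := ipr_ge0 F.1.2; have := ipr_ge0 F.2; lra.
have me F : form_dom F -> mass F F <= c^-1 * e F F.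
  move=> KF; apply: le_trans (mN F) _; rewrite mulrC ler_pdivlMr// mulrC; exact: coer.
have c1 : 0 <= c^-1 by rewrite invr_ge0 ltW.
have epos F : form_dom F -> 0 <= e F F by case: he => _ _; apply.
have mpos F : 0 <= mass F F by exact: ipr_ge0.
have csm F G : form_dom F -> form_dom G -> mass F G ^+ 2 <= (c^-1 ^+ 2) * e F F * e G G.
  move=> KF KG; have mF := form_dom_finite_energy KF; have mG := form_dom_finite_energy KG.
  apply: le_trans (cauchy_schwarz finite_energy_lin finite_energy0 mass_semi_inner mF mG) _.
  have -> : c^-1 ^+ 2 * e F F * e G G = (c^-1 * e F F) * (c^-1 * e G G) by ring.
  by apply: ler_pM => //; exact: me.
have rhs f : sq rad2 f -> [/\ linear_on form_dom (fun G => ipr f G.1.1) &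
   forall G, form_dom G -> ipr f G.1.1 ^+ 2 <= (ipr f f * c^-1) * e G G].
  move=> sf; split=> [a x y /form_dom_finite_energy[x1 _ _] /form_dom_finite_energy[y1 _ _]|G KG].
    rewrite pr_u (iprC f) (iprC f x.1.1) (iprC f y.1.1).
    exact: ipr_lin (sq_rad x1) (sq_rad y1) sf.
  have [g1 _ _] := form_dom_finite_energy KG.
  have si := @ip_semi_inner _ plane R leb2 D rad2 mD mrad rad_gt0.
  have := cauchy_schwarz (fun a x y => @sqint_lin _ plane R leb2 D rad2 mD mrad rad_gt0 a x y)
     (@sqint0 _ plane R leb2 D rad2 mD) si sf (sq_rad g1).
  move=> /le_trans; apply; rewrite -mulrA ler_wpM2l//; exact: me.
have [l0 b0] := rhs f0 sf0; have [l1 b1] := rhs f1 sf1.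
have [|||||F0 [F1 [K0 K1 E0 E1]]] := @coupled_riesz R X form_dom form_dom_lin form_dom0 e mass be
  (c^-1 ^+ 2) (ipr f0 f0 * c^-1) (ipr f1 f1 * c^-1) _ _ he hc _ _ _ _ _ csm l0 l1 b0 b1.
- exact: sqr_ge0.
- by rewrite mulr_ge0.
- by rewrite mulr_ge0.
- by move=> x y _ _; exact: iprC.
- by move=> z Kz; apply: sub; apply: mass_lin; exact: form_dom_finite_energy.
have ee F G : energy 0 k F G = e F G + al * mass F G.
  by rewrite /e /energy /mass; ring.
exists F0, F1; split=> // G KG; rewrite ee.
  by have := E0 G KG; lra.
by have := E1 G KG; lra.
Qed.

End FormDomain.

(** * Weak derivatives in the form domain *)

Section LocalIntegrability.
Context {R : realType}.
Implicit Types (f g h t : R * R -> R) (K D : set (R * R)).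
Notation leb2 := (@leb2 R).
Notation plane := (measurableTypeR R * measurableTypeR R)%type.
Notation mset := (@measurable _ plane).
Notation mfun2 := (@measurable_fun _ _ plane R).

Lemma loc_integrable_test D h t : open D -> mfun2 D h ->
  (forall K, compact K -> K `<=` D -> leb2.-integrable K (EFin \o h)) ->
  test D t -> leb2.-integrable D (EFin \o (fun p => h p * t p)).
Proof.
move=> oD mh Ih [st [K [cK KD t0]]].
have mD : mset D by exact: open_measurable2.
have mK := compact_measurable2 cK.
have ct : forall p, K p -> {for p, continuous t} by move=> p _; exact: smooth_continuous.
have [C C0 hC] := continuous_bounded_on cK ct.
apply: (integrable_off mK mD KD); first by move=> p nK; rewrite t0// mulr0.
have mhK : mfun2 K h by exact: (measurable_funS mD KD mh).
have mtK : mfun2 K t by apply: (test_measurable mK).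
apply: (@le_integrable _ plane R leb2 K mK _ (fun p => (C * h p)%:E)) => /=.
- by apply/measurable_EFinP; exact: measurable_funM.
- move=> p Kp; rewrite lee_fin !normrM mulrC ler_wpM2r//.
  by apply: le_trans (hC _ Kp) _; rewrite ler_norm.
exact: (integrableZl mK C (Ih K cK KD)).
Qed.

End LocalIntegrability.

Section WeakDerivative.
Context {R : realType}.
Variable theta : R.
Notation leb2 := (@leb2 R).
Notation plane := (measurableTypeR R * measurableTypeR R)%type.
Notation mset := (@measurable _ plane).
Notation mfun2 := (@measurable_fun _ _ plane R).
Notation D := (Gui theta).
Notation rad2 := (@rad2 R).
Notation fR := (R * R -> R).
Notation X := ((fR * fR) * fR)%type.
Notation sq w := (@sqint _ plane R leb2 D w).
Notation ipr := (@ip _ plane R leb2 D rad2).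
Notation ipv := (@ip _ plane R leb2 D (@winv R)).

Let oD : open D. Proof. exact: Gui_open. Qed.
Let mD : mset D. Proof. exact: open_measurable2. Qed.
Let crad p : D p -> {for p, continuous rad2}. Proof. by move=> _; exact: continuous_rad. Qed.
Let cwinv p : D p -> {for p, continuous (@winv R)}. Proof. exact: continuous_winv. Qed.
Let mrad : mfun2 D rad2. Proof. exact: continuous_on_measurable2. Qed.
Let rad_gt0 p : D p -> 0 < rad2 p. Proof. exact: Gui_rad_gt0. Qed.

(** From 2 |f| <= f^2 r + 1 / r, where 1 / r is bounded on compact sets. *)
Lemma sq_loc_integrable (f : fR) K : sq rad2 f -> compact K -> K `<=` D ->
  leb2.-integrable K (EFin \o f).
Proof.
move=> [mf If] cK KD; have mK := compact_measurable2 cK.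
have I1 : leb2.-integrable K (EFin \o (fun p => f p ^+ 2 * rad2 p)).
  exact: (@integrableS _ plane R leb2 D K).
have cwK p : K p -> {for p, continuous (@winv R)} by move=> /KD; exact: cwinv.
have I2 : leb2.-integrable K (EFin \o (@winv R)).
  apply: compact_integrable => //.
    apply: (measurable_funS mD KD); exact: continuous_on_measurable2.
  by have [C _ hC] := continuous_bounded_on cK cwK; exists C.
apply: (@le_integrable _ plane R leb2 K mK _ _ _ _ (integrableD mK I1 I2)).
  by apply/measurable_EFinP; exact: (measurable_funS mD KD mf).
move=> p Kp; rewrite /= lee_fin /winv /rad2.
have r0 : 0 < p.1 by exact/rad_gt0/KD.
have ri0 : 0 < p.1^-1 by rewrite invr_gt0.
have h0 : 0 <= f p ^+ 2 * p.1 + p.1^-1.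
  by apply: addr_ge0; [apply: mulr_ge0; [exact: sqr_ge0|exact: ltW]|exact: ltW].
rewrite (ger0_norm h0).
have e : p.1 * p.1^-1 = 1 by rewrite divff// gt_eqF.
have h1 : 0 <= p.1 * (`|f p| - p.1^-1) ^+ 2 by rewrite mulr_ge0 ?sqr_ge0 ?ltW.
have h2 := normr_ge0 (f p); rewrite -(real_normK (num_real (f p))).
(* the square whose positivity is the inequality 2 |f| <= f^2 r + 1 / r *)
have e1 : p.1 * (`|f p| - p.1^-1) ^+ 2 =
  `|f p| ^+ 2 * p.1 - 2 * `|f p| * (p.1 * p.1^-1) + p.1^-1 * (p.1 * p.1^-1) by ring.
rewrite e1 e !mulr1 in h1; lra.
Qed.

(** Both partial derivatives are treated at once: the value true stands for the
    radial direction. *)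
Definition dir (b : bool) : R * R := if b then (1, 0) else (0, 1).
Definition partial (b : bool) (F : X) : fR := if b then F.1.2 else F.2.

Lemma partial_sq b (F : X) : form_dom theta F -> sq rad2 (partial b F).
Proof. by case: b => -[[]]. Qed.

Lemma energy_ge b (F : X) : ipr F.1.1 F.1.1 <= energy theta 1 1 F F /\
  ipr (partial b F) (partial b F) <= energy theta 1 1 F F.
Proof.
have q1 : 0 <= ipr F.1.1 F.1.1 by exact: (@ip_ge0 _ plane R leb2 D rad2 rad_gt0).
have q2 : 0 <= ipr F.1.2 F.1.2 by exact: (@ip_ge0 _ plane R leb2 D rad2 rad_gt0).
have q3 : 0 <= ipr F.2 F.2 by exact: (@ip_ge0 _ plane R leb2 D rad2 rad_gt0).
have q4 : 0 <= ipv F.1.1 F.1.1.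
  by apply: (@ip_ge0 _ plane R leb2 D (@winv R)) => p Dp; rewrite invr_gt0; exact: rad_gt0.
have gen (u v x y : R) : 0 <= u -> 0 <= v -> 0 <= x -> 0 <= y ->
    [/\ u <= u + v + x + y, x <= u + v + x + y & y <= u + v + x + y].
  by move=> *; split; lra.
have [e1 e2 e3] := gen _ _ _ _ q1 q4 q2 q3.
by rewrite /energy !mul1r; case: b; split.
Qed.

(** Dividing a test function by r turns a flat integral into a weighted inner
    product, to which the inequality of Cauchy and Schwarz applies. *)
Lemma test_winv_sq t : test D t -> sq rad2 (fun p => t p * winv p).
Proof.
move=> tD; split.
  apply: measurable_funM; first by apply: test_measurable => //; case: tD.
  exact: continuous_on_measurable2.
have := @test_integrable R D t (fun p => t p * winv p) oD tD.
move=> h; apply: eq_integrable (h _) => //.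
  move=> p /set_mem Dp /=; rewrite /winv /rad2; congr EFin.
  have : p.1 != 0 by rewrite gt_eqF// rad_gt0.
  by move=> ?; field.
move=> p Dp; apply: cvgM; last exact: cwinv.
by apply: smooth_continuous; case: tD.
Qed.

Lemma ipr_test_winv (f t : fR) : ipr f (fun p => t p * winv p) = Rintegral leb2 D (fun p => f p * t p).
Proof.
apply: eq_Rintegral => p /set_mem Dp; rewrite /winv /rad2.
have : p.1 != 0 by rewrite gt_eqF// rad_gt0.
by move=> ?; field.
Qed.

Lemma jet_weak b s t : test D s -> test D t ->
  Rintegral leb2 D (fun p => s p * 'D_(dir b) t p) =
  - Rintegral leb2 D (fun p => 'D_(dir b) s p * t p).
Proof.
move=> sD tD; have [ss _] := sD; have [st [K [cK KD t0]]] := tD.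
have cs := smooth_continuous ss; have ct := smooth_continuous st.
have cds := smooth_continuous (smooth_derive (dir b) ss).
have cdt := smooth_continuous (smooth_derive (dir b) st).
have I1 : leb2.-integrable D (EFin \o (fun p => s p * 'D_(dir b) t p)).
  by apply: (test_integrable oD sD) => p _; exact: cdt.
have I2 : leb2.-integrable D (EFin \o (fun p => 'D_(dir b) s p * t p)).
  by apply: (test_integrable oD (test_derive (dir b) sD)) => p _; exact: ct.
apply/eqP; rewrite -subr_eq0 opprK -(@RintegralD _ plane R leb2 D _ _ mD I1 I2).
rewrite Rintegral_off; last first.
  move=> p nD; have nK : ~ K p by move=> /KD.
  by rewrite t0// (derive_off_compact _ cK t0 nK) !mulr0 addr0.
apply/eqP; apply: (@integral_derive_plane R K (fun p => s p * t p) _ b) => //.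
- move=> p; apply: cvgD; apply: cvgM; [exact: cs|exact: cdt|exact: cds|exact: ct].
- by move=> p nK; rewrite t0// mulr0.
move=> p; have d1 : is_derive p (dir b) s ('D_(dir b) s p).
  by apply: derivableP; exact: smooth_derivable.
have d2 : is_derive p (dir b) t ('D_(dir b) t p).
  by apply: derivableP; exact: smooth_derivable.
apply: is_derive_eq (is_deriveM d1 d2) _.
by rewrite /GRing.scale /=; congr (_ + _); rewrite mulrC.
Qed.

(** Integration by parts passes to the closure since both sides are continuous
    for the energy norm. *)
Lemma form_dom_by_parts b (F : X) t : form_dom theta F -> test D t ->
  Rintegral leb2 D (fun p => F.1.1 p * 'D_(dir b) t p) =
  - Rintegral leb2 D (fun p => partial b F p * t p).
Proof.
move=> KF tD; have [mF hF] := KF; have dtD := test_derive (dir b) tD.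
set g0 : fR := fun p => 'D_(dir b) t p * winv p; set g1 : fR := fun p => t p * winv p.
have sg0 : sq rad2 g0 by exact: test_winv_sq.
have sg1 : sq rad2 g1 by exact: test_winv_sq.
rewrite -2!ipr_test_winv -/g0 -/g1.
have lin (a : R) (f g h : fR) : sq rad2 f -> sq rad2 g -> sq rad2 h ->
    ipr (a *: f + g) h = a * ipr f h + ipr g h.
  exact: (@ip_lin _ plane R leb2 D rad2 mD mrad rad_gt0 a f g h).
have cs (f g : fR) : sq rad2 f -> sq rad2 g -> ipr f g ^+ 2 <= ipr f f * ipr g g.
  have si := @ip_semi_inner _ plane R leb2 D rad2 mD mrad rad_gt0.
  move=> sf sg; exact: (cauchy_schwarz (fun a x y => @sqint_lin _ plane R leb2 D rad2 mD mrad rad_gt0 a x y)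
     (@sqint0 _ plane R leb2 D rad2 mD) si sf sg).
apply/eqP; rewrite -subr_eq0 opprK; set L := _ + _.
(* the defect L is linear in F, vanishes on jets, and satisfies L^2 <= M * energy 1 1 F F *)
set M := 2 * (ipr g0 g0 + ipr g1 g1).
have p0 : 0 <= ipr g0 g0 by exact: (@ip_ge0 _ plane R leb2 D rad2 rad_gt0).
have p1 : 0 <= ipr g1 g1 by exact: (@ip_ge0 _ plane R leb2 D rad2 rad_gt0).
have M0 : 0 <= M by rewrite mulr_ge0 ?addr_ge0.
suff hL c : 0 < c -> L ^+ 2 <= c.
  by rewrite -sqrf_eq0 eq_le sqr_ge0 andbT; apply/ler_addgt0Pl => c c0; rewrite addr0 hL.
move=> c0; have M1 : 0 < M + 1 by lra.
have [s sD hs] := hF _ (divr_gt0 c0 M1).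
have mj := finite_energy_jet sD; set G := F - jet s in hs.
have KG : form_dom theta G by exact: (subspaceB (@form_dom_lin R theta) KF (form_dom_jet sD)).
have sFu : sq rad2 F.1.1 by apply: sq_rad => //; case: mF.
have sGu : sq rad2 G.1.1 by apply: sq_rad => //; case: KG => -[].
have sju : sq rad2 s by apply: test_sqint.
have sFa := partial_sq b KF; have sGa := partial_sq b KG.
have sja : sq rad2 ('D_(dir b) s) by apply: test_sqint => //; exact: test_derive.
have eG1 : G.1.1 = -1 *: s + F.1.1 by rewrite scaleN1r addrC.
have eG2 : partial b G = -1 *: 'D_(dir b) s + partial b F.
  by rewrite scaleN1r addrC; case: (b).
have EL : L = ipr G.1.1 g0 + ipr (partial b G) g1.
  rewrite eG1 eG2 (lin _ _ _ _ sju sFu sg0) (lin _ _ _ _ sja sFa sg1).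
  have := jet_weak b sD tD; rewrite -(ipr_test_winv s) -(ipr_test_winv ('D_(dir b) s)) -/g0 -/g1 /L.
  lra.
have c1 := cs _ _ sGu sg0; have c2 := cs _ _ sGa sg1.
have n1 : ipr G.1.1 G.1.1 <= energy theta 1 1 G G /\ ipr (partial b G) (partial b G) <= energy theta 1 1 G G.
  have [h1 h2] := energy_ge b G; split; [exact: h1|exact: h2].
move: c1 c2 n1 hs; rewrite EL ltr_pdivlMr// /M.
set x := ipr G.1.1 g0; set y := ipr (partial b G) g1.
set A := ipr G.1.1 G.1.1; set B := ipr (partial b G) _; set n := energy _ _ _ _ _.
move: p0 p1; set k0 := ipr g0 g0; set k1 := ipr g1 g1 => p0 p1 c1 c2 [n1 n2] hs.
have s0 := sqr_ge0 (x - y).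
have h1 : A * k0 <= n * k0 by rewrite ler_wpM2r.
have h2 : B * k1 <= n * k1 by rewrite ler_wpM2r.
have n0 : 0 <= n by apply: le_trans n1; exact: (@ip_ge0 _ plane R leb2 D rad2 rad_gt0).
have e1 : n * (2 * (k0 + k1) + 1) = 2 * (n * k0 + n * k1) + n by ring.
have e2 : (x + y) ^+ 2 = 2 * (x ^+ 2 + y ^+ 2) - (x - y) ^+ 2 by ring.
rewrite e1 in hs; rewrite e2; lra.
Qed.

Notation ReC := (@complex.Re R).
Notation ImC := (@complex.Im R).

Lemma Cc2_real t : test D t -> Cc2 D (fun p => (t p)%:C%C).
Proof.
move=> [st [K [cK KD t0]]]; split; first by split; [exact: st|exact: smooth_cst].
by exists K; split=> // p /t0 ->.
Qed.

Lemma Cc2_test psi : Cc2 D psi -> test D (ReC \o psi) /\ test D (ImC \o psi).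
Proof.
move=> [[s0 s1] [K [cK KD h]]].
by split; split=> //; exists K; split=> // p nK; rewrite /= h.
Qed.

Lemma form_dom_loc_integrable b (F0 F1 : X) : form_dom theta F0 -> form_dom theta F1 ->
  cloc_integrable D (fun p => partial b F0 p +i* partial b F1 p)%C.
Proof.
move=> K0 K1; have s0 := partial_sq b K0; have s1 := partial_sq b K1.
split; first by split; [case: s0|case: s1].
by move=> K cK KD; split; exact: sq_loc_integrable.
Qed.

Lemma form_dom_weak_derive b (F0 F1 : X) : form_dom theta F0 -> form_dom theta F1 ->
  is_weak_derive D (dir b) (fun p => F0.1.1 p +i* F1.1.1 p)%C
    (fun p => partial b F0 p +i* partial b F1 p)%C.
Proof.
move=> K0 K1; split; first exact: form_dom_loc_integrable.
move=> psi cpsi; have [t0 t1] := Cc2_test cpsi.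
have dt0 := test_derive (dir b) t0; have dt1 := test_derive (dir b) t1.
have I (f t : fR) : sq rad2 f -> test D t -> leb2.-integrable D (EFin \o (fun p => f p * t p)).
  move=> sf td; apply: loc_integrable_test => //; first by case: sf.
  by move=> K cK KD; exact: sq_loc_integrable.
have su (F : X) : form_dom theta F -> sq rad2 F.1.1 by move=> -[[? _ _] _]; exact: sq_rad.
have u0 := su _ K0; have u1 := su _ K1.
have a0 := partial_sq b K0; have a1 := partial_sq b K1.
have J00 := I _ _ u0 dt0; have J01 := I _ _ u0 dt1.
have J10 := I _ _ u1 dt0; have J11 := I _ _ u1 dt1.
have L00 := I _ _ a0 t0; have L01 := I _ _ a0 t1.
have L10 := I _ _ a1 t0; have L11 := I _ _ a1 t1.
rewrite /cintegral /cderive.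
have -> : Rintegral leb2 D (ReC \o (fun p => (F0.1.1 p +i* F1.1.1 p)%C *
   ('D_(dir b) (ReC \o psi) p +i* 'D_(dir b) (ImC \o psi) p)%C)) =
  Rintegral leb2 D (fun p => F0.1.1 p * 'D_(dir b) (ReC \o psi) p) -
  Rintegral leb2 D (fun p => F1.1.1 p * 'D_(dir b) (ImC \o psi) p).
  by rewrite -(@RintegralB _ plane R leb2 D _ _ mD J00 J11).
have -> : Rintegral leb2 D (ImC \o (fun p => (F0.1.1 p +i* F1.1.1 p)%C *
   ('D_(dir b) (ReC \o psi) p +i* 'D_(dir b) (ImC \o psi) p)%C)) =
  Rintegral leb2 D (fun p => F0.1.1 p * 'D_(dir b) (ImC \o psi) p) +
  Rintegral leb2 D (fun p => F1.1.1 p * 'D_(dir b) (ReC \o psi) p).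
  by rewrite -(@RintegralD _ plane R leb2 D _ _ mD J01 J10).
have -> : Rintegral leb2 D (ReC \o (fun p => (partial b F0 p +i* partial b F1 p)%C * psi p)) =
  Rintegral leb2 D (fun p => partial b F0 p * (ReC \o psi) p) -
  Rintegral leb2 D (fun p => partial b F1 p * (ImC \o psi) p).
  rewrite -(@RintegralB _ plane R leb2 D _ _ mD L00 L11).
  by apply: eq_Rintegral => p _ /=; case: (psi p).
have -> : Rintegral leb2 D (ImC \o (fun p => (partial b F0 p +i* partial b F1 p)%C * psi p)) =
  Rintegral leb2 D (fun p => partial b F0 p * (ImC \o psi) p) +
  Rintegral leb2 D (fun p => partial b F1 p * (ReC \o psi) p).
  rewrite -(@RintegralD _ plane R leb2 D _ _ mD L01 L10).
  by apply: eq_Rintegral => p _ /=; case: (psi p).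
rewrite !form_dom_by_parts//; apply/eqP; rewrite eq_complex /=; apply/andP; split; apply/eqP; ring.
Qed.

Lemma is_weak_derive_uniq e (u g h : R * R -> R[i]) :
  is_weak_derive D e u g -> is_weak_derive D e u h -> aeeq leb2 D g h.
Proof.
move=> [[[mg0 mg1] Ig] Wg] [[[mh0 mh1] Ih] Wh].
have I0 K : compact K -> K `<=` D -> leb2.-integrable K (EFin \o (fun p => ReC (g p) - ReC (h p))).
  move=> cK KD; exact: (integrableB (compact_measurable2 cK) (Ig K cK KD).1 (Ih K cK KD).1).
have I1 K : compact K -> K `<=` D -> leb2.-integrable K (EFin \o (fun p => ImC (g p) - ImC (h p))).
  move=> cK KD; exact: (integrableB (compact_measurable2 cK) (Ig K cK KD).2 (Ih K cK KD).2).
have E psi : test D psi -> cintegral leb2 D (fun p => g p * (psi p)%:C%C) =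
    cintegral leb2 D (fun p => h p * (psi p)%:C%C).
  move=> tp; apply: oppr_inj; rewrite -(Wg _ (Cc2_real tp)).
  exact: (Wh _ (Cc2_real tp)).
have Rg (k : R * R -> R[i]) (psi : fR) : Rintegral leb2 D (ReC \o (fun p => k p * (psi p)%:C%C)) =
    Rintegral leb2 D (fun p => ReC (k p) * psi p).
  by apply: eq_Rintegral => p _ /=; case: (k p) => a c /=; rewrite mulr0 subr0.
have Jg (k : R * R -> R[i]) (psi : fR) : Rintegral leb2 D (ImC \o (fun p => k p * (psi p)%:C%C)) =
    Rintegral leb2 D (fun p => ImC (k p) * psi p).
  by apply: eq_Rintegral => p _ /=; case: (k p) => a c /=; rewrite mulr0 add0r.
have A0 : {ae leb2, forall p, D p -> ReC (g p) - ReC (h p) = 0}.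
  apply: weak_null_ae => //; first exact: measurable_funB.
  move=> psi sp hp; have tp : test D psi by split.
  have := congr1 ReC (E _ tp); rewrite /cintegral /= !Rg => e0.
  have T0 := @loc_integrable_test R D _ psi oD mg0 (fun K cK KD => (Ig K cK KD).1) tp.
  have T1 := @loc_integrable_test R D _ psi oD mh0 (fun K cK KD => (Ih K cK KD).1) tp.
  transitivity (Rintegral leb2 D (fun p => ReC (g p) * psi p - ReC (h p) * psi p)).
    by apply: eq_Rintegral => p _; rewrite mulrBl.
  by rewrite (@RintegralB _ plane R leb2 D _ _ mD T0 T1) e0 subrr.
have A1 : {ae leb2, forall p, D p -> ImC (g p) - ImC (h p) = 0}.
  apply: weak_null_ae => //; first exact: measurable_funB.
  move=> psi sp hp; have tp : test D psi by split.
  have := congr1 ImC (E _ tp); rewrite /cintegral /= !Jg => e0.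
  have T0 := @loc_integrable_test R D _ psi oD mg1 (fun K cK KD => (Ig K cK KD).2) tp.
  have T1 := @loc_integrable_test R D _ psi oD mh1 (fun K cK KD => (Ih K cK KD).2) tp.
  transitivity (Rintegral leb2 D (fun p => ImC (g p) * psi p - ImC (h p) * psi p)).
    by apply: eq_Rintegral => p _; rewrite mulrBl.
  by rewrite (@RintegralB _ plane R leb2 D _ _ mD T0 T1) e0 subrr.
apply: filterS2 A0 A1 => p h0 h1 Dp; apply/eqP.
have := h0 Dp; have := h1 Dp; case: (g p) (h p) => [a c] [x y] /= /eqP + /eqP.
by rewrite !subr_eq0 eq_complex /= => -> ->.
Qed.

(** The weak derivative is selected by a choice operator; uniqueness identifies
    the selected function with the entry of the triple up to null sets. *)
Lemma weak_derive_ae b (F0 F1 : X) : form_dom theta F0 -> form_dom theta F1 ->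
  let u := (fun p => F0.1.1 p +i* F1.1.1 p)%C in
  @cmeasurable _ plane R D (weak_derive D (dir b) u) /\
  aeeq leb2 D (weak_derive D (dir b) u) (fun p => partial b F0 p +i* partial b F1 p)%C.
Proof.
move=> K0 K1 u; have W := form_dom_weak_derive b K0 K1.
have W' : is_weak_derive D (dir b) u (weak_derive D (dir b) u).
  exact: (xgetPex _ (ex_intro _ _ W)).
by split; [case: W' => -[]|exact: (is_weak_derive_uniq W' W)].
Qed.

End WeakDerivative.

(** * Complex functions and the sesquilinear form *)

Section ComplexMeasurability.
Context d (T : measurableType d) (R : realType).
Variables (mu : {measure set T -> \bar R}) (D : set T).
Hypothesis mD : measurable D.
Implicit Types u v : T -> R[i].
Notation ReC := (@complex.Re R).
Notation ImC := (@complex.Im R).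

Lemma cmeasM u v : cmeasurable D u -> cmeasurable D v -> cmeasurable D (fun x => u x * v x).
Proof.
move=> [u0 u1] [v0 v1]; split.
  have h : measurable_fun D (fun x => ReC (u x) * ReC (v x) - ImC (u x) * ImC (v x)).
    by apply: measurable_funB; exact: measurable_funM.
  by apply: eq_measurable_fun h => x _ /=; case: (u x) (v x) => [a b] [c e].
have h : measurable_fun D (fun x => ReC (u x) * ImC (v x) + ImC (u x) * ReC (v x)).
  by apply: measurable_funD; exact: measurable_funM.
by apply: eq_measurable_fun h => x _ /=; case: (u x) (v x) => [a b] [c e].
Qed.

Lemma cmeasD u v : cmeasurable D u -> cmeasurable D v -> cmeasurable D (fun x => u x + v x).
Proof.
move=> [u0 u1] [v0 v1]; split.
  have h : measurable_fun D (fun x => ReC (u x) + ReC (v x)) by exact: measurable_funD.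
  by apply: eq_measurable_fun h => x _ /=; case: (u x) (v x) => [a b] [c e].
have h : measurable_fun D (fun x => ImC (u x) + ImC (v x)) by exact: measurable_funD.
by apply: eq_measurable_fun h => x _ /=; case: (u x) (v x) => [a b] [c e].
Qed.

Lemma cmeasJ u : cmeasurable D u -> cmeasurable D (fun x => (u x)^*%C).
Proof.
move=> [u0 u1]; split; first by apply: eq_measurable_fun u0 => x _ /=; case: (u x).
have h : measurable_fun D (fun x => - ImC (u x)).
  by apply: measurableT_comp => //.
by apply: eq_measurable_fun h => x _ /=; case: (u x).
Qed.

Lemma cmeas_real (f : T -> R) : measurable_fun D f -> cmeasurable D (fun x => (f x)%:C%C).
Proof. by move=> mf; split=> //; exact: measurable_cst. Qed.

Lemma cintegral_ae u v : cmeasurable D u -> cmeasurable D v ->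
  aeeq mu D u v -> cintegral mu D u = cintegral mu D v.
Proof.
move=> [u0 u1] [v0 v1] uv; rewrite /cintegral /Rintegral.
have e0 : ae_eq mu D (EFin \o (ReC \o u)) (EFin \o (ReC \o v)).
  by apply: filterS uv => x h Dx /=; rewrite h.
have e1 : ae_eq mu D (EFin \o (ImC \o u)) (EFin \o (ImC \o v)).
  by apply: filterS uv => x h Dx /=; rewrite h.
by congr (fine _ +i* fine _)%C; apply: ae_eq_integral => //; apply/measurable_EFinP.
Qed.

Lemma cintegralE u (f g : T -> R) : (forall x, D x -> u x = (f x +i* g x)%C) ->
  cintegral mu D u = (Rintegral mu D f +i* Rintegral mu D g)%C.
Proof.
move=> h; rewrite /cintegral; congr (_ +i* _)%C;
  by apply: eq_Rintegral => x /set_mem Dx; rewrite /= h.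
Qed.

Section Weighted.
Variable w : T -> R.
Hypothesis mw : measurable_fun D w.
Hypothesis w_gt0 : forall x, D x -> 0 < w x.

Lemma sqmod_ge0 (z : R[i]) : 0 <= sqmod z.
Proof. by rewrite addr_ge0 ?sqr_ge0. Qed.

Lemma L2_sqint u : L2 mu D w u <-> sqint mu D w (ReC \o u) /\ sqint mu D w (ImC \o u).
Proof.
split=> [[[m0 m1] fin]|[[m0 I0] [m1 I1]]].
  have m2 : measurable_fun D (fun x => (sqmod (u x) * w x)%:E).
    by apply/measurable_EFinP; apply: measurable_funM => //; apply: measurable_funD; exact: measurable_funX.
  split; apply: sqintP => //; apply: le_lt_trans fin; apply: ge0_le_integral => //.
  - by move=> x Dx; rewrite lee_fin mulr_ge0 ?sqr_ge0// ltW// w_gt0.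
  - by apply/measurable_EFinP; apply: measurable_funM => //; exact: measurable_funX.
  - by move=> x Dx; rewrite lee_fin ler_wpM2r ?(ltW (w_gt0 Dx))// lerDl sqr_ge0.
  - by move=> x Dx; rewrite lee_fin mulr_ge0 ?sqr_ge0// ltW// w_gt0.
  - by apply/measurable_EFinP; apply: measurable_funM => //; exact: measurable_funX.
  - by move=> x Dx; rewrite lee_fin ler_wpM2r ?(ltW (w_gt0 Dx))// lerDr sqr_ge0.
split; first by split.
have /integrableP[_] := integrableD mD I0 I1; apply: le_lt_trans.
rewrite /sqnormL2 le_eqVlt; apply/orP; left; apply/eqP; apply: eq_integral => x /set_mem Dx.
rewrite /= ger0_norm; first by rewrite /sqmod mulrDl.
by rewrite addr_ge0// mulr_ge0 ?sqr_ge0// ltW// w_gt0.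
Qed.

Lemma sqnormL2E u : L2 mu D w u ->
  sqnormL2 mu D w u = (ip mu D w (ReC \o u) (ReC \o u) + ip mu D w (ImC \o u) (ImC \o u))%:E.
Proof.
move=> /L2_sqint[s0 s1]; rewrite EFinD !ipE// -ge0_integralD//.
- by apply: eq_integral => x _; rewrite -EFinD -mulrDl.
- by move=> x Dx; rewrite lee_fin mulr_ge0 ?sqr_ge0// ltW// w_gt0.
- exact: sqint_meas s0.
- by move=> x Dx; rewrite lee_fin mulr_ge0 ?sqr_ge0// ltW// w_gt0.
- exact: sqint_meas s1.
Qed.

Lemma innerL2E u v : L2 mu D w u -> L2 mu D w v -> innerL2 mu D w u v =
  ((ip mu D w (ReC \o u) (ReC \o v) + ip mu D w (ImC \o u) (ImC \o v)) +i*
   (ip mu D w (ImC \o u) (ReC \o v) - ip mu D w (ReC \o u) (ImC \o v)))%C.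
Proof.
move=> /L2_sqint[u0 u1] /L2_sqint[v0 v1].
have I f g := @sqint_integrableM _ _ _ mu D w mD mw w_gt0 f g.
rewrite /ip -RintegralD//; do ?exact: I.
rewrite -RintegralB//; do ?exact: I.
apply: cintegralE => x _ /=; case: (u x) (v x) => [a b] [c e] /=.
by apply/eqP; rewrite eq_complex /=; apply/andP; split; apply/eqP; ring.
Qed.

End Weighted.
End ComplexMeasurability.

Section FiberForm.
Context {R : realType}.
Variable theta : R.
Notation leb2 := (@leb2 R).
Notation plane := (measurableTypeR R * measurableTypeR R)%type.
Notation mset := (@measurable _ plane).
Notation mfun2 := (@measurable_fun _ _ plane R).
Notation D := (Gui theta).
Notation rad2 := (@rad2 R).
Notation fR := (R * R -> R).
Notation X := ((fR * fR) * fR)%type.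
Notation sq w := (@sqint _ plane R leb2 D w).

Let oD : open D. Proof. exact: Gui_open. Qed.
Let mD : mset D. Proof. exact: open_measurable2. Qed.
Let mrad : mfun2 D rad2.
Proof. by apply: (continuous_on_measurable2 oD) => p _; exact: continuous_rad. Qed.
Let mwinv : mfun2 D (@winv R).
Proof. by apply: (continuous_on_measurable2 oD) => p; exact: continuous_winv. Qed.
Let rad_gt0 p : D p -> 0 < rad2 p. Proof. exact: Gui_rad_gt0. Qed.
Let winv_gt0 p : D p -> 0 < winv p. Proof. by move=> Dp; rewrite invr_gt0 rad_gt0. Qed.

Definition of_parts (F0 F1 : X) (p : R * R) : R[i] := (F0.1.1 p +i* F1.1.1 p)%C.

Lemma form_dom_sq_rad (F : X) : form_dom theta F -> sq rad2 F.1.1.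
Proof. by move=> -[[? _ _] _]; exact: sq_rad. Qed.

Lemma form_dom_sq_winv (F : X) : form_dom theta F -> sq (@winv R) F.1.1.
Proof. by move=> -[[? _ _] _]; exact: sq_winv. Qed.

Definition energy_density (k : R) (F G : X) (p : R * R) : R :=
  k * (F.1.1 p * G.1.1 p * winv p) + F.1.2 p * G.1.2 p * rad2 p + F.2 p * G.2 p * rad2 p.

Lemma energy_integral k (F G : X) : form_dom theta F -> form_dom theta G ->
  leb2.-integrable D (EFin \o energy_density k F G) /\
  energy theta 0 k F G = Rintegral leb2 D (energy_density k F G).
Proof.
move=> KF KG.
have I1 : leb2.-integrable D (EFin \o (fun p => k * (F.1.1 p * G.1.1 p * winv p))).
  exact: (integrableZl mD k (@sqint_integrableM _ plane R leb2 D (@winv R) mD mwinv winv_gt0 _ _ (form_dom_sq_winv KF) (form_dom_sq_winv KG))).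
have I2 : leb2.-integrable D (EFin \o (fun p => F.1.2 p * G.1.2 p * rad2 p)).
  exact: (@sqint_integrableM _ plane R leb2 D rad2 mD mrad rad_gt0 _ _ (partial_sq true KF) (partial_sq true KG)).
have I3 : leb2.-integrable D (EFin \o (fun p => F.2 p * G.2 p * rad2 p)).
  exact: (@sqint_integrableM _ plane R leb2 D rad2 mD mrad rad_gt0 _ _ (partial_sq false KF) (partial_sq false KG)).
have I12 := integrableD mD I1 I2.
split; first exact: (integrableD mD I12 I3).
rewrite /energy mul0r add0r /ip.
rewrite -(@RintegralZl _ plane R leb2 D _ _ mD (@sqint_integrableM _ plane R leb2 D (@winv R) mD mwinv winv_gt0 _ _ (form_dom_sq_winv KF) (form_dom_sq_winv KG))).
rewrite -(@RintegralD _ plane R leb2 D _ _ mD I1 I2).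
by rewrite -(@RintegralD _ plane R leb2 D _ _ mD I12 I3).
Qed.

(** Real and imaginary part of a conj(b) are a0 b0 + a1 b1 and a1 b0 - a0 b1. *)
Lemma fiber_formE m (omega : R) (F0 F1 G0 G1 : X) :
  form_dom theta F0 -> form_dom theta F1 -> form_dom theta G0 -> form_dom theta G1 ->
  let e := energy theta 0 ((m%:~R - omega) ^+ 2) in
  fiber_form m omega theta (of_parts F0 F1) (of_parts G0 G1) =
    ((e F0 G0 + e F1 G1) +i* (e F1 G0 - e F0 G1))%C.
Proof.
move=> KF0 KF1 KG0 KG1 e; rewrite /e; set k := (m%:~R - omega) ^+ 2.
have [I00 ->] := energy_integral k KF0 KG0; have [I11 ->] := energy_integral k KF1 KG1.
have [I10 ->] := energy_integral k KF1 KG0; have [I01 ->] := energy_integral k KF0 KG1.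
rewrite -(@RintegralD _ plane R leb2 D _ _ mD I00 I11).
rewrite -(@RintegralB _ plane R leb2 D _ _ mD I10 I01).
have [ma1 ea1] := weak_derive_ae true KF0 KF1.
have [mb1 eb1] := weak_derive_ae false KF0 KF1.
have [ma2 ea2] := weak_derive_ae true KG0 KG1.
have [mb2 eb2] := weak_derive_ae false KG0 KG1.
have mu (F0' F1' : X) : form_dom theta F0' -> form_dom theta F1' -> @cmeasurable _ plane R D (of_parts F0' F1').
  by move=> /form_dom_sq_rad[? _] /form_dom_sq_rad[? _].
have mc b (F0' F1' : X) : form_dom theta F0' -> form_dom theta F1' ->
    @cmeasurable _ plane R D (fun p => (partial b F0' p +i* partial b F1' p)%C).
  by move=> /(partial_sq b)[? _] /(partial_sq b)[? _].
have mk : mfun2 D (fun p => k / rad2 p ^+ 2).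
  rewrite [X in mfun2 D X](_ : _ = (fun p => k * (winv p * winv p))); last first.
    by apply/funext => p; rewrite /winv /rad2 expr2 invfM.
  by apply: measurable_funM => //; exact: measurable_funM.
pose dens (da db u da' db' u' : R * R -> R[i]) p :=
  (da p * (da' p)^*%C + db p * (db' p)^*%C + (k / rad2 p ^+ 2)%:C%C * (u p * (u' p)^*%C)) * (rad2 p)%:C%C.
have md da db u da' db' u' : @cmeasurable _ plane R D da -> @cmeasurable _ plane R D db ->
    @cmeasurable _ plane R D u -> @cmeasurable _ plane R D da' -> @cmeasurable _ plane R D db' ->
    @cmeasurable _ plane R D u' -> @cmeasurable _ plane R D (dens da db u da' db' u').
  move=> h1 h2 h3 h4 h5 h6.
  apply: cmeasM => //; last exact: cmeas_real.
  apply: cmeasD => //.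
    by apply: cmeasD => //; apply: cmeasM => //; exact: cmeasJ.
  apply: cmeasM => //; first exact: cmeas_real.
  by apply: cmeasM => //; exact: cmeasJ.
set wa := weak_derive _ _ _ in ma1 ea1; set wb := weak_derive _ _ _ in mb1 eb1.
set wa' := weak_derive _ _ _ in ma2 ea2; set wb' := weak_derive _ _ _ in mb2 eb2.
have M1 := md _ _ _ _ _ _ ma1 mb1 (mu _ _ KF0 KF1) ma2 mb2 (mu _ _ KG0 KG1).
have M2 := md _ _ _ _ _ _ (mc true _ _ KF0 KF1) (mc false _ _ KF0 KF1) (mu _ _ KF0 KF1)
   (mc true _ _ KG0 KG1) (mc false _ _ KG0 KG1) (mu _ _ KG0 KG1).
have E := @cintegral_ae _ plane R leb2 D mD _ _ M1 M2.
transitivity (cintegral leb2 D (dens wa wb (of_parts F0 F1) wa' wb' (of_parts G0 G1))).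
  by rewrite /fiber_form -/k.
rewrite E.
  apply: cintegralE => p Dp; have r0 : p.1 != 0 by rewrite gt_eqF// rad_gt0.
rewrite /dens /of_parts /energy_density /winv /rad2 /partial.
apply/eqP; rewrite eq_complex /=; apply/andP; split; apply/eqP; field => //.
apply: filterS2 (filterI ea1 eb1) (filterI ea2 eb2) => p [h1 h2] [h3 h4] Dp.
by rewrite /dens (h1 Dp) (h2 Dp) (h3 Dp) (h4 Dp).
Qed.

End FiberForm.

(** * Differentiation under the integral over the circle *)

Lemma is_diff_eps (R : realType) (V W : normedModType R) (f : V -> W)
    (df : {linear V -> W}) (x : V) : continuous df ->
  (forall eps : R, 0 < eps -> \forall h \near (0 : V), `|f (h + x) - f x - df h| <= eps * `|h|) ->
  is_diff x f df.
Proof.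
move=> cdf h; have E : f \o shift x = cst (f x) + df +o_ 0 id.
  apply/eqaddoP => eps e0; apply: filterS (h _ e0) => y hy.
  by move: hy; rewrite -addrA -opprD.
have eD := diff_unique cdf E.
by split; [apply/diff_locallyP; rewrite eD|exact: eD].
Qed.

Section CircleIntegral.
Context {R : realType}.
Notation leb1 := (@lebesgue_measure R).
Notation circle := (@circle R).
Notation space := (R * R * R)%type.
Implicit Types (g : space -> R) (p h : R * R).

Lemma circle_measurable : measurable circle. Proof. exact: measurable_itv. Qed.

Lemma leb1_circle : leb1 circle = (2 * pi)%:E.
Proof.
rewrite /circle lebesgue_measure_itv /= lte_fin.
by rewrite mulr_gt0 ?pi_gt0// sube0.
Qed.

Lemma circle_integrable (f : R -> R) : continuous f -> leb1.-integrable circle (EFin \o f).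
Proof.
move=> cf; apply: (@integrableS _ _ R leb1 `[0, 2 * pi]%classic circle) => //.
- exact: circle_measurable.
- by move=> x; rewrite /circle /= !in_itv /= => /andP[-> /ltW].
- apply: continuous_compact_integrable; first exact: segment_compact.
  exact: continuous_subspaceT.
Qed.

Definition circle_integral g p : R := Rintegral leb1 circle (fun phi => g (p, phi)).

Lemma continuous_fiber g p : continuous g -> continuous (fun phi : R => g (p, phi)).
Proof.
move=> cg phi; apply: (@continuous_comp _ _ _ (fun x : R => (p, x)) g); last exact: cg.
apply: differentiable_continuous.
by have [d _] := is_diff_pair (is_diff_cst p phi) (is_diff_id phi); exact: d.
Qed.

Lemma circle_bound (f : R -> R) (c : R) : continuous f ->
  (forall x, circle x -> `|f x| <= c) -> `|Rintegral leb1 circle f| <= c * (2 * pi).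
Proof.
move=> cf hf; have If := circle_integrable cf.
have h := @le_normr_Rintegral _ (measurableTypeR R) R leb1 circle f circle_measurable If.
apply: le_trans h _.
have <- : Rintegral leb1 circle (fun=> c) = c * (2 * pi).
  rewrite (@Rintegral_cst _ (measurableTypeR R) R leb1 circle circle_measurable).
  by have -> : fine (leb1 circle) = 2 * pi by exact: (congr1 fine leb1_circle).
apply: (@le_Rintegral _ (measurableTypeR R) R leb1 circle) => //.
- exact: circle_measurable.
- exact: (integrable_norm If).
- by apply: circle_integrable => x; exact: cvg_cst.
Qed.

(** Continuity is uniform along the compact segment [0, 2 pi]. *)
Lemma uniform_fiber g p (c : R) : continuous g -> 0 < c ->
  \forall q \near p, forall phi, circle phi -> `|g (q, phi) - g (p, phi)| < c.
Proof.
move=> cg c0; have c2 : 0 < c / 2 by lra.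
have cK : compact (`[0, 2 * pi]%classic : set R) by exact: segment_compact.
have := (compact_near_coveringP _).1 cK _ (nbhs p)
  (fun q phi => `|g (q, phi) - g (p, phi)| < c) _.
have h : forall x : R, `[0, 2 * pi]%classic x ->
    \forall x' \near x & i \near nbhs p, `|g (i, x') - g (p, x')| < c.
  move=> x _; have /cvgrPdist_lt /(_ _ c2) := cg (p, x).
  move=> [[A B] /= [An Bn] AB]; exists (B, A) => //= -[y q] /= [By Aq].
  have h1 := AB (q, y) (conj Aq By); have h2 := AB (p, y) (conj (nbhs_singleton An) By).
  rewrite /= in h1 h2.
  rewrite (_ : g (q, y) - g (p, y) = (g (p, x) - g (p, y)) - (g (p, x) - g (q, y))); last by ring.
  by apply: le_lt_trans (ler_normB _ _) _; lra.
move=> /(_ _ h); apply: filterS => q hq phi /=; rewrite /circle /= in_itv /= => /andP[a b].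
by apply: hq; rewrite /= in_itv /= a ltW.
Qed.

Definition lin2 (a b : R) h : R := a * h.1 + b * h.2.

Lemma is_diff_lin2 a b p : is_diff p (lin2 a b) (lin2 a b).
Proof.
have d1 := @is_diff_fst R R R p; have d2 := @is_diff_snd R R R p.
exact: (is_diffD (is_diffZ a d1) (is_diffZ b d2)).
Qed.

Lemma derive_horizontal g x h : differentiable g x ->
  'D_((h, 0) : space) g x = lin2 ('D_((1, 0, 0) : space) g x) ('D_((0, 1, 0) : space) g x) h.
Proof.
move=> dg; rewrite !deriveE//.
have -> : ((h, 0) : space) = h.1 *: ((1, 0, 0) : space) + h.2 *: ((0, 1, 0) : space).
  by case: h => a b; congr ((_, _), _); rewrite /= /GRing.scale /=; ring.
by rewrite linearD !linearZ /lin2 /= ![_ *: ('d g x _)]mulrC.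
Qed.

(** The mean value theorem along the segment from p to p + h, at a fixed angle. *)
Lemma mvt_horizontal g p h (phi : R) : smooth g -> exists2 t : R, 0 <= t <= 1 &
  g (h + p, phi) - g (p, phi) = 'D_((h, 0) : space) g (t *: h + p, phi).
Proof.
move=> sg; pose L (t : R) : space := (t *: h + p, phi).
have dL t : is_diff t L (fun t => (t *: h, 0)).
  have d1 : is_diff t ( *:%R^~ h) ( *:%R^~ h) by exact: is_diff_scalel.
  have d2 := is_diffD d1 (is_diff_cst p t).
  have d3 := is_diff_pair d2 (is_diff_cst phi t).
  by apply: is_diff_eq d3 _; apply/funext => x; rewrite /= addr0.
have dG t : is_derive t (1 : R) (g \o L) ('D_((h, 0) : space) g (L t)).
  have dg := smooth_differentiable (L t) sg.
  apply: DeriveDef.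
    apply: diff_derivable; apply: differentiable_comp => //; by case: (dL t).
  by rewrite (derive_comp_affine (1 : R) dg (dL t)) scale1r.
have [|t t01 e] := @MVT_segment R (g \o L) (fun t => 'D_((h, 0) : space) g (L t)) 0 1 ler01.
  apply: continuous_subspaceT => t; apply: differentiable_continuous.
  by apply/derivable1_diffP; case: (dG t).
exists t; first by move: t01; rewrite in_itv.
by move: e; rewrite /L /= scale1r scale0r add0r subr0 mulr1.
Qed.

Lemma RcircleB (f g : R -> R) : continuous f -> continuous g ->
  Rintegral leb1 circle (fun x => f x - g x) =
  Rintegral leb1 circle f - Rintegral leb1 circle g.
Proof.
move=> cf cg; exact: (@RintegralB _ (measurableTypeR R) R leb1 circle f g
  circle_measurable (circle_integrable cf) (circle_integrable cg)).
Qed.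

Lemma RcircleD (f g : R -> R) : continuous f -> continuous g ->
  Rintegral leb1 circle (fun x => f x + g x) =
  Rintegral leb1 circle f + Rintegral leb1 circle g.
Proof.
move=> cf cg; exact: (@RintegralD _ (measurableTypeR R) R leb1 circle f g
  circle_measurable (circle_integrable cf) (circle_integrable cg)).
Qed.

Lemma RcircleZ (c : R) (f : R -> R) : continuous f ->
  Rintegral leb1 circle (fun x => c * f x) = c * Rintegral leb1 circle f.
Proof.
move=> cf; exact: (@RintegralZl _ (measurableTypeR R) R leb1 circle f c
  circle_measurable (circle_integrable cf)).
Qed.

Lemma circle_integral_lin2 (gr gz : space -> R) p h : continuous gr -> continuous gz ->
  lin2 (circle_integral gr p) (circle_integral gz p) h =
  circle_integral (fun x => lin2 (gr x) (gz x) h) p.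
Proof.
move=> cr cz; have c3 := @continuous_fiber _ p cr; have c4 := @continuous_fiber _ p cz.
have ck (f : R -> R) (k : R) : continuous f -> continuous (fun x => k * f x).
  by move=> cf x; apply: cvgM; [exact: cvg_cst|exact: cf].
have d3 := ck _ h.1 c3; have d4 := ck _ h.2 c4.
rewrite /lin2 (mulrC _ h.1) (mulrC _ h.2) /circle_integral.
rewrite -(RcircleZ h.1 c3) -(RcircleZ h.2 c4) -(RcircleD d3 d4).
by apply: eq_Rintegral => phi _; rewrite mulrC (mulrC h.2).
Qed.

(** The mean value theorem bounds the remainder at each angle by the oscillation
    of the partial derivatives, which is uniformly small. *)
Lemma circle_integral_diff_gen g (gr gz : space -> R) p : smooth g ->
  continuous gr -> continuous gz ->
  (forall x h, 'D_((h, 0) : space) g x = lin2 (gr x) (gz x) h) ->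
  is_diff p (circle_integral g) (lin2 (circle_integral gr p) (circle_integral gz p)).
Proof.
move=> sg cr cz dg; have cg := smooth_continuous sg.
set L := lin2 _ _; have [dL eL] := @is_diff_lin2 (circle_integral gr p) (circle_integral gz p) 0.
have cL : continuous ('d L 0).
  move=> x; rewrite eL; apply: differentiable_continuous.
  by case: (is_diff_lin2 (circle_integral gr p) (circle_integral gz p) x).
have pi0 : (pi : R) != 0 by rewrite gt_eqF// pi_gt0.
have gen1 (q a b : R) : q != 0 -> a / (2 * q) * b = a / (4 * q) * b + a / (4 * q) * b.
  by move=> ?; field.
have gen2 (q a b : R) : q != 0 -> a / (2 * q) * b * (2 * q) = a * b.
  by move=> ?; field.
have pi4 : 0 < 4 * pi :> R by rewrite mulr_gt0// pi_gt0.
have D0 : is_diff p (circle_integral g) ('d L 0 : {linear _ -> _}); last first.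
  by move: D0; rewrite eL.
apply: is_diff_eps => // eps e0; have e4 := divr_gt0 e0 pi4.
  have U := @filterI _ _ (nbhs_filter p) _ _ (uniform_fiber p cr e4) (uniform_fiber p cz e4).
  have /nbhs_normP[d /= d0 hd] := U.
  apply/nbhs_normP; exists d => //= h; rewrite /ball_ /= sub0r normrN => hh.
  have -> : 'd L 0 h = L h by exact: (congr1 (@^~ h) eL).
  have bd phi : circle phi -> `|g (h + p, phi) - g (p, phi) - lin2 (gr (p, phi)) (gz (p, phi)) h|
      <= eps / (2 * pi) * `|h|.
    move=> cphi; have [t /andP[t0 t1] ->] := mvt_horizontal p h phi sg.
    rewrite dg.
    have : ball_ Num.Def.normr p d (t *: h + p).
      rewrite /ball_ /= opprD addrCA subrr addr0 normrN normrZ ger0_norm//.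
      by apply: le_lt_trans hh; rewrite ler_piMl.
    move=> /hd[/(_ _ cphi) h1 /(_ _ cphi) h2].
    rewrite (_ : _ - _ = (gr (t *: h + p, phi) - gr (p, phi)) * h.1 +
      (gz (t *: h + p, phi) - gz (p, phi)) * h.2); last by rewrite /lin2; ring.
    have n1 : `|h.1| <= `|h| by rewrite prod_normE le_max lexx.
    have n2 : `|h.2| <= `|h| by rewrite prod_normE le_max lexx orbT.
    apply: le_trans (ler_normD _ _) _; rewrite !normrM.
    have -> : eps / (2 * pi) * `|h| = eps / (4 * pi) * `|h| + eps / (4 * pi) * `|h|.
      exact: gen1.
    by apply: lerD; apply: ler_pM => //; exact: ltW.
  have c1 := @continuous_fiber _ (h + p) cg; have c2 := @continuous_fiber _ p cg.
  have c3 := @continuous_fiber _ p cr; have c4 := @continuous_fiber _ p cz.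
  have ck (f : R -> R) (k : R) : continuous f -> continuous (fun x => f x * k).
    by move=> cf x; apply: cvgM; [exact: cf|exact: cvg_cst].
  have c5 : continuous (fun phi => lin2 (gr (p, phi)) (gz (p, phi)) h).
    by move=> x; apply: cvgD; exact: ck.
  have c6 : continuous (fun phi => g (h + p, phi) - g (p, phi)).
    by move=> x; apply: cvgB; [exact: c1|exact: c2].
  have c7 : continuous (fun phi => g (h + p, phi) - g (p, phi) - lin2 (gr (p, phi)) (gz (p, phi)) h).
    by move=> x; apply: cvgB; [exact: c6|exact: c5].
  have := circle_bound c7 bd; rewrite RcircleB// RcircleB//.
  have -> : Rintegral leb1 circle (fun phi => lin2 (gr (p, phi)) (gz (p, phi)) h) = L h.
    by rewrite /L circle_integral_lin2.
  have -> : eps / (2 * pi) * `|h| * (2 * pi) = eps * `|h|.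
    exact: gen2.
  by [].
Qed.

Lemma circle_integral_diff g p : smooth g ->
  is_diff p (circle_integral g) (lin2 (circle_integral ('D_((1, 0, 0) : space) g) p)
    (circle_integral ('D_((0, 1, 0) : space) g) p)).
Proof.
move=> sg; apply: circle_integral_diff_gen => //.
- exact: smooth_continuous (smooth_derive ((1, 0, 0) : space) sg).
- exact: smooth_continuous (smooth_derive ((0, 1, 0) : space) sg).
- by move=> x h; apply: derive_horizontal; exact: smooth_differentiable.
Qed.

Lemma derive_circle_integral g p h : smooth g ->
  'D_h (circle_integral g) p = circle_integral ('D_((h, 0) : space) g) p.
Proof.
move=> sg; have [d e] := circle_integral_diff p sg; rewrite deriveE// e.
rewrite circle_integral_lin2.
- apply: eq_Rintegral => phi _; rewrite derive_horizontal//; exact: smooth_differentiable.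
- exact: smooth_continuous (smooth_derive ((1, 0, 0) : space) sg).
- exact: smooth_continuous (smooth_derive ((0, 1, 0) : space) sg).
Qed.

(** The integrals over the circle of smooth functions form a class that is stable
    under differentiation. *)
Lemma smooth_circle_integral g : smooth g -> smooth (circle_integral g).
Proof.
move=> sg; apply: (@smooth_class _ _ (fun f => exists2 g, smooth g & f = circle_integral g)).
- by move=> f x [k sk ->]; case: (circle_integral_diff x sk).
- move=> f v [k sk ->]; exists ('D_((v, 0) : space) k); first exact: smooth_derive.
  by apply/funext => p; exact: derive_circle_integral.
- by exists g.
Qed.

End CircleIntegral.

(** * Fourier coefficients *)

Section Fourier.
Context {R : realType}.
Notation leb1 := (@lebesgue_measure R).
Notation circle := (@circle R).
Notation space := (R * R * R)%type.
Notation ReC := (@complex.Re R).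
Notation ImC := (@complex.Im R).
Notation ci := circle_integral.
Variable m : int.
Implicit Types (g : space -> R) (u : space -> R[i]) (p h : R * R).

(** The fundamental theorem of calculus over one period. *)
Lemma circle_integral_periodic g p : smooth g -> g (p, 2 * pi) = g (p, 0) ->
  ci ('D_((0, 0, 1) : space) g) p = 0.
Proof.
move=> sg per; set dg := 'D__ g; pose L (t : R) : space := (p, t).
have sdg : smooth dg by exact: smooth_derive.
have cdg : continuous (fun t => dg (p, t)) := @continuous_fiber _ _ p (smooth_continuous sdg).
have dL t : is_diff t L (fun t => (0, t)).
  exact: is_diff_pair (is_diff_cst p t) (is_diff_id t).
have dG t : is_derive t (1 : R) (g \o L) (dg (L t)).
  have dg' := smooth_differentiable (L t) sg.
  apply: DeriveDef.
    by apply: diff_derivable; apply: differentiable_comp => //; case: (dL t).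
  by rewrite (derive_comp_affine (1 : R) dg' (dL t)).
have cG : continuous (g \o L) := @continuous_fiber _ _ p (smooth_continuous sg).
have pi2 : 0 < 2 * pi :> R by rewrite mulr_gt0// pi_gt0.
rewrite /ci /circle (Rintegral_itv_bndo_bndc (circle_integrable cdg)) /Rintegral.
rewrite (@continuous_FTC2 _ (fun t => dg (p, t)) (g \o L) 0 (2 * pi) pi2).
- by rewrite /= /L per subrr.
- exact: continuous_subspaceT.
- split=> [x _||]; first by have [] := dG x.
    exact/cvg_at_right_filter/cG.
  exact/cvg_at_left_filter/cG.
- by move=> x _; rewrite derive1E; have [_ ->] := dG x.
Qed.

Definition kap : R := (Num.sqrt (2 * pi))^-1.

Lemma kap2 : kap ^+ 2 * (2 * pi) = 1.
Proof.
have pi2 : 0 < 2 * pi :> R by rewrite mulr_gt0// pi_gt0.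
by rewrite /kap exprVn sqr_sqrtr ?ltW// mulVf// gt_eqF.
Qed.

(** Cm and Sm are the real and imaginary parts of the mode v_ m.  The vanishing
    terms give both the shape a cos + b sin, whose smoothness is known. *)
Definition Cm (x : R) : R := kap * cos (m%:~R * x) + 0 * sin (m%:~R * x).
Definition Sm (x : R) : R := 0 * cos (m%:~R * x) + kap * sin (m%:~R * x).

Lemma v_E x : v_ m x = (Cm x +i* Sm x)%C.
Proof.
by rewrite /v_ -/kap /Cm /Sm; apply/eqP; rewrite eq_complex /=; apply/andP; split; apply/eqP; ring.
Qed.

Lemma CS2 x : Cm x ^+ 2 + Sm x ^+ 2 = kap ^+ 2.
Proof.
transitivity (kap ^+ 2 * (cos (m%:~R * x) ^+ 2 + sin (m%:~R * x) ^+ 2)).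
  by rewrite /Cm /Sm; ring.
by rewrite cos2Dsin2 mulr1.
Qed.

Lemma smooth_Cm : smooth Cm. Proof. exact: smooth_trig. Qed.
Lemma smooth_Sm : smooth Sm. Proof. exact: smooth_trig. Qed.

Lemma cos_int_period (k : int) x : cos (k%:~R * (x + 2 * pi) : R) = cos (k%:~R * x) /\
  sin (k%:~R * (x + 2 * pi) : R) = sin (k%:~R * x).
Proof.
have e (n : nat) : n%:R * (2 * pi) = (pi *+ 2) *+ n :> R by rewrite !mulr_natl.
have [n [->|->]] : exists n : nat, k = n%:Z \/ k = - n%:Z.
  by case: k => n; [exists n; left|exists n.+1; right].
  by rewrite mulrDr -pmulrn e (@periodicn _ _ _ _ (@cosD2pi R)) (@periodicn _ _ _ _ (@sinD2pi R)).
rewrite mulrDr mulrNz -pmulrn !mulNr e.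
have c := @periodicn _ _ _ _ (@cosD2pi R) n (- (n%:R * x) - pi *+ 2 *+ n).
have s := @periodicn _ _ _ _ (@sinD2pi R) n (- (n%:R * x) - pi *+ 2 *+ n).
by rewrite -c -s subrK.
Qed.

Lemma Cm_period x : Cm (x + 2 * pi) = Cm x.
Proof. by have [e1 e2] := cos_int_period m x; rewrite /Cm e1 e2. Qed.
Lemma Sm_period x : Sm (x + 2 * pi) = Sm x.
Proof. by have [e1 e2] := cos_int_period m x; rewrite /Sm e1 e2. Qed.

Lemma derive_Cm x : 'D_(1 : R) Cm x = - (m%:~R * Sm x) /\ 'D_(1 : R) Sm x = m%:~R * Cm x.
Proof.
have d0 : is_derive x (1 : R) (fun x => m%:~R * x) (m%:~R : R).
  by apply: is_derive_eq; rewrite scaler1.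
have d1 : is_derive x (1 : R) (fun x => cos (m%:~R * x)) (- sin (m%:~R * x) * m%:~R : R).
  exact: (@is_derive1_comp _ cos (fun x => m%:~R * x)).
have d2 : is_derive x (1 : R) (fun x => sin (m%:~R * x)) (cos (m%:~R * x) * m%:~R : R).
  exact: (@is_derive1_comp _ sin (fun x => m%:~R * x)).
have [_ e1] : is_derive x (1 : R) Cm (- (m%:~R * Sm x)).
  by apply: is_derive_eq; rewrite /Sm /GRing.scale /=; ring.
have [_ e2] : is_derive x (1 : R) Sm (m%:~R * Cm x).
  by apply: is_derive_eq; rewrite /Cm /GRing.scale /=; ring.
by rewrite e1 e2.
Qed.

Lemma smooth_snd (f : R -> R) : smooth f -> smooth (fun x : space => f x.2).
Proof. by apply: (@smooth_comp_affine _ _ _ f snd snd) => x; exact: is_diff_snd. Qed.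

Lemma derive_snd (f : R -> R) (x v : space) : smooth f ->
  'D_v (fun x : space => f x.2) x = v.2 * 'D_(1 : R) f x.2.
Proof.
move=> sf; have df := smooth_differentiable (x.2 : R) sf.
rewrite (derive_comp_affine v df (@is_diff_snd R (R * R)%type R x)).
by rewrite derive_scale1//; apply: smooth_derivable.
Qed.

(** Real and imaginary part of the product of u with the conjugate of v_ m. *)
Definition re_mode u (x : space) : R := ReC (u x) * Cm x.2 + ImC (u x) * Sm x.2.
Definition im_mode u (x : space) : R := ImC (u x) * Cm x.2 - ReC (u x) * Sm x.2.

Lemma fourierE u p : fourier m u p = (ci (re_mode u) p +i* ci (im_mode u) p)%C.
Proof.
apply: cintegralE => x _; rewrite v_E /re_mode /im_mode.
case: (u (p, x)) => a b; apply/eqP; rewrite eq_complex /=; apply/andP; split; apply/eqP; ring.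
Qed.

Lemma smooth_modes u : csmooth u -> smooth (re_mode u) /\ smooth (im_mode u).
Proof.
move=> [s0 s1]; have sC := smooth_snd smooth_Cm; have sS := smooth_snd smooth_Sm.
by split; [apply: smoothD; exact: smoothM|apply: smoothB; exact: smoothM].
Qed.

Lemma csmooth_cderive u v : csmooth u -> csmooth (cderive v u).
Proof. by move=> [s0 s1]; split; exact: smooth_derive. Qed.

Lemma derive_modes u (v x : space) : csmooth u ->
  'D_v (re_mode u) x = re_mode (cderive v u) x + v.2 * (m%:~R * im_mode u x) /\
  'D_v (im_mode u) x = im_mode (cderive v u) x - v.2 * (m%:~R * re_mode u x).
Proof.
move=> [s0 s1]; have sC := smooth_snd smooth_Cm; have sS := smooth_snd smooth_Sm.
have dC := derive_snd x v smooth_Cm; have dS := derive_snd x v smooth_Sm.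
rewrite (derive_Cm x.2).1 in dC; rewrite (derive_Cm x.2).2 in dS.
pose a := ReC \o u; pose b := ImC \o u; pose C (x : space) := Cm x.2; pose S (x : space) := Sm x.2.
have da : derivable a x v by exact: smooth_derivable.
have db : derivable b x v by exact: smooth_derivable.
have dC' : derivable C x v by exact: smooth_derivable.
have dS' : derivable S x v by exact: smooth_derivable.
split.
  rewrite -[re_mode u]/(a * C + b * S) (deriveD (derivableM da dC') (derivableM db dS')).
  rewrite (deriveM da dC') (deriveM db dS') dC dS /GRing.scale /= /re_mode /im_mode /cderive /= /a /b /C /S /=; ring.
rewrite -[im_mode u]/(b * C - a * S) (deriveB (derivableM db dC') (derivableM da dS')).
rewrite (deriveM db dC') (deriveM da dS') dC dS /GRing.scale /= /re_mode /im_mode /cderive /= /a /b /C /S /=; ring.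
Qed.

Lemma circle_integral_lin (a b : R) g1 g2 p : continuous g1 -> continuous g2 ->
  ci (fun x => a * g1 x + b * g2 x) p = a * ci g1 p + b * ci g2 p.
Proof.
move=> c1 c2; have k1 := @continuous_fiber _ _ p c1; have k2 := @continuous_fiber _ _ p c2.
have ck (f : R -> R) (k : R) : continuous f -> continuous (fun x => k * f x).
  by move=> cf x; apply: cvgM; [exact: cvg_cst|exact: cf].
by rewrite /ci -(RcircleZ a k1) -(RcircleZ b k2) -(RcircleD (ck _ a k1) (ck _ b k2)).
Qed.

(** Integration by parts in the angle.  In complex notation the coefficient of
    the angular derivative of u is i m times the coefficient of u. *)
Lemma circle_integral_angular u p : csmooth u -> u (p, 2 * pi) = u (p, 0) ->
  ci (re_mode (cderive (@d_phi R) u)) p = - (m%:~R * ci (im_mode u) p) /\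
  ci (im_mode (cderive (@d_phi R) u)) p = m%:~R * ci (re_mode u) p.
Proof.
move=> su per; have [s0 s1] := smooth_modes su.
have [t0 t1] := smooth_modes (csmooth_cderive (@d_phi R) su).
have c0 := smooth_continuous s0; have c1 := smooth_continuous s1.
have e0 := smooth_continuous t0; have e1 := smooth_continuous t1.
have hC := Cm_period 0; have hS := Sm_period 0; rewrite !add0r in hC hS.
have p0 : re_mode u (p, 2 * pi) = re_mode u (p, 0) by rewrite /re_mode per hC hS.
have p1 : im_mode u (p, 2 * pi) = im_mode u (p, 0) by rewrite /im_mode per hC hS.
have := circle_integral_periodic s0 p0.
have := circle_integral_periodic s1 p1.
have -> : ci ('D_((0, 0, 1) : space) (re_mode u)) p =
    1 * ci (re_mode (cderive (@d_phi R) u)) p + m%:~R * ci (im_mode u) p.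
  rewrite -circle_integral_lin//; apply: eq_Rintegral => x _.
  by rewrite (derive_modes ((0, 0, 1) : space) (p, x) su).1 /d_phi /= !mul1r.
have -> : ci ('D_((0, 0, 1) : space) (im_mode u)) p =
    1 * ci (im_mode (cderive (@d_phi R) u)) p + - m%:~R * ci (re_mode u) p.
  rewrite -circle_integral_lin//; apply: eq_Rintegral => x _.
  by rewrite (derive_modes ((0, 0, 1) : space) (p, x) su).2 /d_phi /= !mul1r mulNr.
by rewrite !mul1r => h1 h2; split; lra.
Qed.

(** The magnetic angular derivative of the quadratic form of the layer. *)
Definition ang (omega : R) u (x : space) : R[i] :=
  (0 +i* 1)%C * cderive (@d_phi R) u x - omega%:C%C * u x.

Lemma fourier_ang omega u p : csmooth u -> u (p, 2 * pi) = u (p, 0) ->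
  fourier m (ang omega u) p = - (m%:~R + omega)%:C%C * fourier m u p.
Proof.
move=> su per; have [a1 a2] := circle_integral_angular su per; have [s0 s1] := smooth_modes su.
have [t0 t1] := smooth_modes (csmooth_cderive (@d_phi R) su).
have c0 := smooth_continuous s0; have c1 := smooth_continuous s1.
have e0 := smooth_continuous t0; have e1 := smooth_continuous t1.
rewrite !fourierE.
have -> : ci (re_mode (ang omega u)) p = -1 * ci (im_mode (cderive (@d_phi R) u)) p + - omega * ci (re_mode u) p.
  rewrite -circle_integral_lin//; apply: eq_Rintegral => x _; rewrite /re_mode /im_mode /ang.
  by case: (cderive _ _ _) (u _) => [a b] [c d] /=; ring.
have -> : ci (im_mode (ang omega u)) p = 1 * ci (re_mode (cderive (@d_phi R) u)) p + - omega * ci (im_mode u) p.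
  rewrite -circle_integral_lin//; apply: eq_Rintegral => x _; rewrite /re_mode /im_mode /ang.
  by case: (cderive _ _ _) (u _) => [a b] [c d] /=; ring.
rewrite a1 a2; apply/eqP; rewrite eq_complex /=; apply/andP; split; apply/eqP; ring.
Qed.

Lemma fourier_horizontal u p h : csmooth u ->
  ('D_h (ci (re_mode u)) p +i* 'D_h (ci (im_mode u)) p)%C = fourier m (cderive ((h, 0) : space) u) p.
Proof.
move=> su; have [s0 s1] := smooth_modes su.
rewrite fourierE !derive_circle_integral//; congr (_ +i* _)%C; apply: eq_Rintegral => x _.
  by rewrite (derive_modes ((h, 0) : space) (p, x) su).1 mul0r addr0.
by rewrite (derive_modes ((h, 0) : space) (p, x) su).2 mul0r subr0.
Qed.

Notation line := (measurableTypeR R).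
Notation sq1 := (@sqint _ line R leb1 circle (fun=> 1)).
Let mcirc : @measurable _ line circle. Proof. exact: circle_measurable. Qed.

Lemma sq1_continuous (f : R -> R) : continuous f -> sq1 f.
Proof.
move=> cf; split.
  by apply: measurable_funTS; exact: continuous_measurable_fun.
by apply: circle_integrable => x; apply: cvgM; [apply: cvgM; exact: cf|exact: cvg_cst].
Qed.

Lemma sq1_integrableM (f g : R -> R) : sq1 f -> sq1 g ->
  leb1.-integrable circle (EFin \o (fun x => f x * g x)).
Proof.
move=> sf sg; have m1 : measurable_fun circle (fun=> 1 : R) by exact: measurable_cst.
have p1 x : circle x -> 0 < (fun=> 1 : R) x by [].
have := @sqint_integrableM _ line R leb1 circle _ mcirc m1 p1 f g sf sg.
by apply: eq_integrable => // x _ /=; rewrite mulr1.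
Qed.

Lemma section_sq1 u p : @cmeasurable _ line R circle (fun phi => u (p, phi)) ->
  (\int[leb1]_(phi in circle) (sqmod (u (p, phi)))%:E < +oo)%E ->
  sq1 (fun phi => ReC (u (p, phi))) /\ sq1 (fun phi => ImC (u (p, phi))).
Proof.
move=> mu fin; have m1 : measurable_fun circle (fun=> 1 : R) by exact: measurable_cst.
have p1 x : circle x -> 0 < (fun=> 1 : R) x by [].
apply: (@L2_sqint _ line R leb1 circle mcirc _ m1 p1 (fun phi => u (p, phi))).1.
split=> //; apply: le_lt_trans fin; rewrite /sqnormL2.
by rewrite le_eqVlt; apply/orP; left; apply/eqP; apply: eq_integral => x _; rewrite mulr1.
Qed.

Lemma mode_integrable u p :
  sq1 (fun phi => ReC (u (p, phi))) -> sq1 (fun phi => ImC (u (p, phi))) ->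
  leb1.-integrable circle (EFin \o (fun phi => re_mode u (p, phi))) /\
  leb1.-integrable circle (EFin \o (fun phi => im_mode u (p, phi))).
Proof.
move=> sa sb; have sC := sq1_continuous (smooth_continuous smooth_Cm).
have sS := sq1_continuous (smooth_continuous smooth_Sm).
split.
  exact: (integrableD mcirc (sq1_integrableM sa sC) (sq1_integrableM sb sS)).
exact: (integrableB mcirc (sq1_integrableM sb sC) (sq1_integrableM sa sS)).
Qed.

(** For the coefficient T of u, |T|^2 is the integral of Re (conj(T) u conj(v)),
    which is at most half of the integral of |u|^2 plus half of |T|^2, as v is
    normalized.  The right-hand side is an extended real number because sections
    of square integrable functions can fail to be square integrable. *)
Lemma bessel u p : @cmeasurable _ line R circle (fun phi => u (p, phi)) ->
  ((sqmod (fourier m u p))%:E <= \int[leb1]_(phi in circle) (sqmod (u (p, phi)))%:E)%E.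
Proof.
(* absorbs the half of |T|^2 on the right-hand side *)
have half (x y : R) : x <= 2^-1 * y + 2^-1 * x -> x <= y by lra.
move=> mu; have [fin|nfin] := ltP (\int[leb1]_(phi in circle) (sqmod (u (p, phi)))%:E)%E +oo%E; last first.
  by apply: le_trans nfin; exact: leey.
have [sa sb] := section_sq1 mu fin; have [f0 f1] := mode_integrable sa sb.
set a := fun phi => ReC (u (p, phi)) in sa; set b := fun phi => ImC (u (p, phi)) in sb.
have aa := sq1_integrableM sa sa; have bb := sq1_integrableM sb sb.
rewrite fourierE /sqmod /=; set T0 := ci _ _; set T1 := ci _ _.
have g0 := integrableZl mcirc T0 f0; have g1 := integrableZl mcirc T1 f1.
have gg := integrableD mcirc g0 g1.
have E1 : T0 ^+ 2 + T1 ^+ 2 = Rintegral leb1 circle (fun x => T0 * re_mode u (p, x) + T1 * im_mode u (p, x)).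
  rewrite (@RintegralD _ line R leb1 circle _ _ mcirc g0 g1).
  rewrite (@RintegralZl _ line R leb1 circle _ _ mcirc f0).
  by rewrite (@RintegralZl _ line R leb1 circle _ _ mcirc f1) -!expr2.
have ab := integrableD mcirc aa bb; have hab := integrableZl mcirc (2^-1) ab.
pose c := 2^-1 * (kap ^+ 2 * (T0 ^+ 2 + T1 ^+ 2)).
have Ic : leb1.-integrable circle (EFin \o (fun=> c)).
  by apply: circle_integrable => x; exact: cvg_cst.
have hc := integrableD mcirc hab Ic.
have E2 : T0 ^+ 2 + T1 ^+ 2 <= Rintegral leb1 circle (fun x => 2^-1 * (a x * a x + b x * b x) + c).
  rewrite [leLHS]E1; apply: (@le_Rintegral _ line R leb1 circle) => // x _.
  rewrite /c /re_mode /im_mode -(CS2 x); set C := Cm x; set S := Sm x.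
  have s1 := sqr_ge0 (a x - (T0 * C - T1 * S)); have s2 := sqr_ge0 (b x - (T0 * S + T1 * C)).
  have := addr_ge0 s1 s2.
  have -> : (a x - (T0 * C - T1 * S)) ^+ 2 + (b x - (T0 * S + T1 * C)) ^+ 2 =
    a x * a x + b x * b x + (C ^+ 2 + S ^+ 2) * (T0 ^+ 2 + T1 ^+ 2)
    - 2 * (T0 * (a x * C + b x * S) + T1 * (b x * C - a x * S)) by ring.
  lra.
have E3 : Rintegral leb1 circle (fun x => 2^-1 * (a x * a x + b x * b x) + c) =
   2^-1 * Rintegral leb1 circle (fun x => a x * a x + b x * b x) + 2^-1 * (T0 ^+ 2 + T1 ^+ 2).
  rewrite (@RintegralD _ line R leb1 circle _ _ mcirc hab Ic).
  rewrite (@RintegralZl _ line R leb1 circle _ _ mcirc ab).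
  rewrite (@Rintegral_cst _ line R leb1 circle mcirc).
  have -> : fine (leb1 circle) = 2 * pi by exact: (congr1 fine (@leb1_circle R)).
  rewrite /c; have k2 := kap2; congr (_ + _).
  transitivity (2^-1 * (T0 ^+ 2 + T1 ^+ 2) * (kap ^+ 2 * (2 * pi))); first by ring.
  by rewrite k2 mulr1.
have E4 : (\int[leb1]_(phi in circle) (ReC (u (p, phi)) ^+ 2 + ImC (u (p, phi)) ^+ 2)%:E =
   (Rintegral leb1 circle (fun x => a x * a x + b x * b x))%:E)%E.
  rewrite /Rintegral fineK; last exact: (@integrable_fin_num _ line R leb1 circle mcirc _ ab).
  by apply: eq_integral => x _; rewrite !expr2.
by rewrite E4 lee_fin; apply: half; rewrite -E3.
Qed.

End Fourier.

(** * Integration over the layer *)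

Lemma sigma_finite_prod d1 d2 (T1 : measurableType d1) (T2 : measurableType d2) (R : realType)
    (m1 : {sigma_finite_measure set T1 -> \bar R})
    (m2 : {sigma_finite_measure set T2 -> \bar R}) : sigma_finite setT (m1 \x m2)%E.
Proof.
have /sigma_finiteP[F [TF ndF Foo]] := sigma_finiteT m1.
have /sigma_finiteP[G [TG ndG Goo]] := sigma_finiteT m2.
exists (fun n => F n `*` G n).
  rewrite -setXTT TF TG predeqE => -[x y]; split.
    move=> [/= [n _ Fnx] [k _ Gky]]; exists (maxn n k) => //; split.
    - by move: x Fnx; exact/subsetPset/ndF/leq_maxl.
    - by move: y Gky; exact/subsetPset/ndG/leq_maxr.
  by move=> [n _ []/= ? ?]; split; exists n.
move=> k; have [mF Fk] := Foo k; have [mG Gk] := Goo k.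
split; first exact: measurableX.
by rewrite product_measure1E// lte_mul_pinfty// ge0_fin_numE.
Qed.

Section SigmaFiniteAlias.
Context d (T : measurableType d) (R : realType) (mu : {measure set T -> \bar R}).
Hypothesis sf : sigma_finite setT mu.

(** Lets a measure with a proof of sigma-finiteness be used where the structure
    of sigma-finite measures is expected. *)
Definition sigma_finite_alias of sigma_finite setT mu : set T -> \bar R := mu.
HB.instance Definition _ := Measure.copy (sigma_finite_alias sf) mu.
HB.instance Definition _ := Measure_isSigmaFinite.Build d T R (sigma_finite_alias sf) sf.

End SigmaFiniteAlias.

Section Tonelli.
Context d1 d2 (T1 : measurableType d1) (T2 : measurableType d2) (R : realType).
Variables (m1' : {measure set T1 -> \bar R}) (m2 : {sigma_finite_measure set T2 -> \bar R}).
Variables (D1 : set T1) (D2 : set T2).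
Hypotheses (mD1 : measurable D1) (mD2 : measurable D2).
Hypothesis sf1 : sigma_finite setT m1'.

Let m1 : {sigma_finite_measure set T1 -> \bar R} := sigma_finite_alias sf1.

Lemma section_measurable d3 (T3 : measurableType d3) (f : T1 * T2 -> T3) x :
  measurable_fun (D1 `*` D2) f -> D1 x -> measurable_fun D2 (fun y => f (x, y)).
Proof.
move=> mf Dx; apply: (@measurable_comp _ _ _ _ _ _ (D1 `*` D2) f D2 (pair x)) => //.
- exact: measurableX.
- by move=> _ [y Dy <-]; split.
- by apply: measurable_funTS; exact: pair1_measurable.
Qed.

(** The theorem of Tonelli on a rectangle, by extension with 0. *)
Lemma tonelli_setX (f : T1 * T2 -> \bar R) : measurable_fun (D1 `*` D2) f ->
  (forall z, (D1 `*` D2) z -> (0 <= f z)%E) ->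
  measurable_fun D1 (fun x => \int[m2]_(y in D2) f (x, y))%E /\
  (\int[(m1' \x m2)%E]_(z in D1 `*` D2) f z = \int[m1']_(x in D1) \int[m2]_(y in D2) f (x, y))%E.
Proof.
move=> mf f0; pose g := f \_ (D1 `*` D2).
have mX : measurable (D1 `*` D2) by exact: measurableX.
have mg : measurable_fun setT g by apply/(measurable_restrictT f mX).
have g0 z : (0 <= g z)%E.
  by rewrite /g patchE; case: ifPn => // /set_mem; exact: f0.
have FE x : D1 x -> fubini_F m2 g x = (\int[m2]_(y in D2) f (x, y))%E.
  move=> Dx; rewrite /fubini_F [RHS]integral_mkcond; apply: eq_integral => y _.
  rewrite /g !patchE; congr (if _ then _ else _).
  by apply/idP/idP => /set_mem h; apply/mem_set; [case: h|split].
have mF := @measurable_fun_fubini_tonelli_F _ _ _ _ _ m2 g mg g0.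
split.
  by apply: eq_measurable_fun (measurable_funS measurableT (@subsetT _ D1) mF) => x /set_mem; exact: FE.
rewrite [LHS]integral_mkcond (@fubini_tonelli1 _ _ _ _ _ m1 m2 g mg g0).
rewrite [RHS]integral_mkcond; apply: eq_integral => x _; rewrite patchE.
case: ifPn => [/set_mem/FE //|nD]; rewrite /fubini_F integral0_eq// => y _.
rewrite /g patchE ifF//; apply/negbTE; apply: contra nD => /set_mem[? _].
exact/mem_set.
Qed.

End Tonelli.

(** * Functions with a single angular mode *)

Section Layer.
Context {R : realType}.
Variables (theta : R) (m : int).
Notation leb1 := (@lebesgue_measure R).
Notation leb2 := (@leb2 R).
Notation leb3 := (@leb3 R).
Notation line := (measurableTypeR R).
Notation plane := (line * line)%type.
Notation lspace := (plane * line)%type.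
Notation mset := (@measurable _ plane).
Notation mfun2 := (@measurable_fun _ _ plane R).
Notation mfun3 := (@measurable_fun _ _ lspace R).
Notation D := (Gui theta).
Notation L := (Lay theta).
Notation circle := (@circle R).
Notation rad2 := (@rad2 R).
Notation rad3 := (@rad3 R).
Notation fR := (R * R -> R).
Notation space := (R * R * R)%type.
Notation X := ((fR * fR) * fR)%type.
Notation sq w := (@sqint _ plane R leb2 D w).
Notation ipr := (@ip _ plane R leb2 D rad2).
Notation ReC := (@complex.Re R).
Notation ImC := (@complex.Im R).
Notation ci := circle_integral.
Notation Cm := (Cm m).
Notation Sm := (Sm m).
Notation kap := (@kap R).

Let oD : open D. Proof. exact: Gui_open. Qed.
Let mD : mset D. Proof. exact: open_measurable2. Qed.
Let mcirc : @measurable _ line circle. Proof. exact: circle_measurable. Qed.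
Let mL : @measurable _ lspace L. Proof. by apply: measurableX; [exact: mD|exact: mcirc]. Qed.
Let mrad : mfun2 D rad2.
Proof. by apply: (continuous_on_measurable2 oD) => p _; exact: continuous_rad. Qed.
Let mwinv : mfun2 D (@winv R).
Proof. by apply: (continuous_on_measurable2 oD) => p; exact: continuous_winv. Qed.
Let rad_gt0 p : D p -> 0 < rad2 p. Proof. exact: Gui_rad_gt0. Qed.

Lemma lay_tonelli (f : space -> \bar R) : @measurable_fun _ _ lspace (\bar R) L f ->
  (forall x, L x -> (0 <= f x)%E) ->
  @measurable_fun _ _ plane (\bar R) D (fun p => \int[leb1]_(phi in circle) f (p, phi))%E /\
  (\int[leb3]_(x in L) f x = \int[leb2]_(p in D) \int[leb1]_(phi in circle) f (p, phi))%E.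
Proof.
move=> mf f0; have [h1 h2] := @tonelli_setX _ _ plane line R leb2 leb1 D circle mD mcirc (@sigma_finite_prod _ _ line line R leb1 leb1) f mf f0.
split; first exact: h1.
exact: h2.
Qed.

Lemma lay_pullback (f : fR) : mfun2 D f -> mfun3 L (fun x => f x.1).
Proof.
move=> mf; apply: (@measurable_comp _ _ _ lspace plane R D f L fst) => //.
  by move=> _ [x [Dx _] <-].
exact: measurable_funTS.
Qed.

Lemma lay_pullback2 (f : R -> R) : continuous f -> mfun3 L (fun x => f x.2).
Proof.
move=> cf; apply: (@measurable_comp _ _ _ lspace line R setT f L snd) => //.
  exact: continuous_measurable_fun.
exact: measurable_funTS.
Qed.

(** The square of the normalization of the modes compensates the length of the
    circle. *)
Lemma lay_integral_radial (f : fR) : mfun2 D f -> (forall p, D p -> 0 <= f p) ->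
  (\int[leb3]_(x in L) (kap ^+ 2 * f x.1)%:E = \int[leb2]_(p in D) (f p)%:E)%E.
Proof.
move=> mf f0; have k0 : 0 <= kap ^+ 2 by exact: sqr_ge0.
have [|x [Dx _]|_ ->] := @lay_tonelli (fun x => (kap ^+ 2 * f x.1)%:E).
- by apply/measurable_EFinP; apply: measurable_funM => //; exact: lay_pullback.
- by rewrite lee_fin mulr_ge0// f0.
apply: eq_integral => p _ /=.
rewrite (@integral_cst _ line R leb1 circle mcirc).
transitivity ((kap ^+ 2 * f p)%:E * (2 * pi)%:E)%E.
  by congr (_ * _)%E; exact: leb1_circle.
by rewrite -EFinM mulrAC kap2 mul1r.
Qed.

Definition mode_fun (f0 f1 : fR) (x : space) : R[i] := (f0 x.1 +i* f1 x.1)%C * v_ m x.2.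

Lemma Re_mode_fun f0 f1 x : ReC (mode_fun f0 f1 x) = f0 x.1 * Cm x.2 - f1 x.1 * Sm x.2.
Proof. by rewrite /mode_fun v_E. Qed.
Lemma Im_mode_fun f0 f1 x : ImC (mode_fun f0 f1 x) = f0 x.1 * Sm x.2 + f1 x.1 * Cm x.2.
Proof. by rewrite /mode_fun v_E. Qed.

Lemma mode_funE f0 f1 x : mode_fun f0 f1 x =
  ((f0 x.1 * Cm x.2 - f1 x.1 * Sm x.2) +i* (f0 x.1 * Sm x.2 + f1 x.1 * Cm x.2))%C.
Proof. by rewrite /mode_fun v_E. Qed.

Lemma sqmod_mode_fun f0 f1 x : sqmod (mode_fun f0 f1 x) = kap ^+ 2 * (f0 x.1 ^+ 2 + f1 x.1 ^+ 2).
Proof. by rewrite /sqmod Re_mode_fun Im_mode_fun -(CS2 m x.2); ring. Qed.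

Lemma mode_fun_measurable f0 f1 : mfun2 D f0 -> mfun2 D f1 -> @cmeasurable _ lspace R L (mode_fun f0 f1).
Proof.
move=> m0 m1; have c := lay_pullback2 (smooth_continuous (smooth_Cm m)).
have s := lay_pullback2 (smooth_continuous (smooth_Sm m)).
have l0 := lay_pullback m0; have l1 := lay_pullback m1; split.
  have h : mfun3 L (fun x => f0 x.1 * Cm x.2 - f1 x.1 * Sm x.2).
    by apply: measurable_funB; exact: measurable_funM.
  by apply: eq_measurable_fun h => x _; rewrite -Re_mode_fun.
have h : mfun3 L (fun x => f0 x.1 * Sm x.2 + f1 x.1 * Cm x.2).
  by apply: measurable_funD; exact: measurable_funM.
by apply: eq_measurable_fun h => x _; rewrite -Im_mode_fun.
Qed.

Lemma mode_fun_norm f0 f1 : sq rad2 f0 -> sq rad2 f1 ->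
  @sqnormL2 _ lspace R leb3 L rad3 (mode_fun f0 f1) = (ipr f0 f0 + ipr f1 f1)%:E.
Proof.
move=> s0 s1; have h := @ip_ge0 _ plane R leb2 D rad2 rad_gt0.
rewrite EFinD !(@ipE _ plane R leb2 D rad2 mD mrad rad_gt0)//.
rewrite -(@ge0_integralD _ plane R leb2 D mD) //; last 4 first.
- by move=> p Dp; rewrite lee_fin; apply: (sqw_ge0 rad_gt0).
- exact: sqint_meas s0.
- by move=> p Dp; rewrite lee_fin; apply: (sqw_ge0 rad_gt0).
- exact: sqint_meas s1.
rewrite -(@lay_integral_radial (fun p => f0 p ^+ 2 * rad2 p + f1 p ^+ 2 * rad2 p)).
- by apply: eq_integral => x _; rewrite sqmod_mode_fun /rad3 /rad2; congr EFin; ring.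
- apply: measurable_funD; apply: measurable_funM => //; apply: measurable_funX.
    by case: s0.
  by case: s1.
- by move=> p Dp; apply: addr_ge0; apply: (sqw_ge0 rad_gt0).
Qed.

Lemma fourier_mode_fun f0 f1 p : fourier m (mode_fun f0 f1) p = (f0 p +i* f1 p)%C.
Proof.
rewrite fourierE.
have e (c : R) : Rintegral leb1 circle (fun=> c * kap ^+ 2) = c.
  rewrite (@Rintegral_cst _ line R leb1 circle mcirc).
  have -> : fine (leb1 circle) = 2 * pi by exact: (congr1 fine (@leb1_circle R)).
  by rewrite -mulrA kap2 mulr1.
congr (_ +i* _)%C; [rewrite -[RHS]e|rewrite -[RHS]e]; apply: eq_Rintegral => x _.
  by rewrite /re_mode Re_mode_fun Im_mode_fun /= -(CS2 m x); ring.
by rewrite /im_mode Re_mode_fun Im_mode_fun /= -(CS2 m x); ring.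
Qed.

Lemma smooth_fst (f : fR) : smooth f -> smooth (fun x : space => f x.1).
Proof. by apply: (@smooth_comp_affine _ _ _ f fst fst) => x; exact: is_diff_fst. Qed.

Lemma derive_fst (f : fR) (x v : space) : smooth f ->
  'D_v (fun x : space => f x.1) x = 'D_(v.1) f x.1.
Proof.
move=> sf; have df := smooth_differentiable (x.1 : R * R) sf.
exact: (derive_comp_affine v df (@is_diff_fst R (R * R)%type R x)).
Qed.

Lemma csmooth_mode_fun t0 t1 : smooth t0 -> smooth t1 -> csmooth (mode_fun t0 t1).
Proof.
move=> s0 s1; have l0 := smooth_fst s0; have l1 := smooth_fst s1.
have sC := smooth_snd (smooth_Cm m); have sS := smooth_snd (smooth_Sm m).
split.
  rewrite (_ : ReC \o mode_fun t0 t1 = fun x => t0 x.1 * Cm x.2 - t1 x.1 * Sm x.2); last first.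
    by apply/funext => x; rewrite -Re_mode_fun.
  by apply: smoothB; exact: smoothM.
rewrite (_ : ImC \o mode_fun t0 t1 = fun x => t0 x.1 * Sm x.2 + t1 x.1 * Cm x.2); last first.
  by apply/funext => x; rewrite -Im_mode_fun.
by apply: smoothD; exact: smoothM.
Qed.

Lemma cderive_mode_fun t0 t1 (v x : space) : smooth t0 -> smooth t1 ->
  cderive v (mode_fun t0 t1) x = mode_fun ('D_(v.1) t0) ('D_(v.1) t1) x +
    v.2%:C%C * mode_fun (fun p => - (m%:~R * t1 p)) (fun p => m%:~R * t0 p) x.
Proof.
move=> s0 s1; pose a (x : space) := t0 x.1; pose b (x : space) := t1 x.1.
pose C (x : space) := Cm x.2; pose S (x : space) := Sm x.2.
have da : derivable a x v by apply: smooth_derivable; exact: smooth_fst.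
have db : derivable b x v by apply: smooth_derivable; exact: smooth_fst.
have dC : derivable C x v by apply: smooth_derivable; apply: smooth_snd; exact: smooth_Cm.
have dS : derivable S x v by apply: smooth_derivable; apply: smooth_snd; exact: smooth_Sm.
have ea := derive_fst x v s0; have eb := derive_fst x v s1.
have eC := derive_snd x v (smooth_Cm m); have eS := derive_snd x v (smooth_Sm m).
rewrite (derive_Cm m x.2).1 in eC; rewrite (derive_Cm m x.2).2 in eS.
rewrite /cderive.
have -> : ReC \o mode_fun t0 t1 = a * C - b * S by apply/funext => y; exact: Re_mode_fun.
have -> : ImC \o mode_fun t0 t1 = a * S + b * C by apply/funext => y; exact: Im_mode_fun.
rewrite (deriveB (derivableM da dC) (derivableM db dS)) (deriveD (derivableM da dS) (derivableM db dC)).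
rewrite (deriveM da dC) (deriveM db dS) (deriveM da dS) (deriveM db dC) ea eb eC eS.
rewrite !mode_funE /GRing.scale /= /a /b /C /S.
by apply/eqP; rewrite eq_complex /=; apply/andP; split; apply/eqP; ring.
Qed.

Lemma mode_fun_Cc t0 t1 : test D t0 -> test D t1 -> Cc_Lay theta (mode_fun t0 t1).
Proof.
move=> [s0 [K0 [c0 K0D z0]]] [s1 [K1 [c1 K1D z1]]]; split.
- exact: csmooth_mode_fun.
- by move=> p phi; rewrite !mode_funE /= Cm_period Sm_period.
exists (K0 `|` K1); split; [exact: compactU|by rewrite subUset|].
by move=> p phi /not_orP[n0 n1]; rewrite mode_funE /= z0// z1// !mul0r subr0 addr0.
Qed.

Lemma derive_dir0 (t : fR) p : 'D_((0, 0) : R * R) t p = 0.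
Proof. exact: derive0. Qed.

Notation k_ omega := ((m%:~R + omega) ^+ 2).

Lemma energy_density_ge0 (k : R) (F : X) p : 0 <= k -> D p -> 0 <= energy_density k F F p.
Proof.
move=> k0 Dp; have r0 : 0 <= p.1 by exact: ltW (rad_gt0 Dp).
rewrite /energy_density /winv /rad2 -!expr2.
have ri0 : 0 <= p.1^-1 by rewrite invr_ge0.
have q (a b : R) : 0 <= b -> 0 <= a ^+ 2 * b by move=> ?; rewrite mulr_ge0 ?sqr_ge0.
by rewrite !addr_ge0 ?q// mulr_ge0 ?q.
Qed.

(** The angular derivative multiplies the mode by i m, which turns the magnetic
    term into (m + omega)^2 |t|^2 / r^2. *)
Lemma mode_fun_Q (omega : R) t0 t1 : test D t0 -> test D t1 ->
  Qform0 omega theta (mode_fun t0 t1) =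
  (energy theta 0 (k_ omega) (jet t0) (jet t0) + energy theta 0 (k_ omega) (jet t1) (jet t1))%:E.
Proof.
move=> T0 T1; set k := k_ omega; have k0 : 0 <= k by exact: sqr_ge0.
have [s0 _] := T0; have [s1 _] := T1.
have [I0 ->] := energy_integral k (form_dom_jet T0) (form_dom_jet T0).
have [I1 ->] := energy_integral k (form_dom_jet T1) (form_dom_jet T1).
rewrite -(@RintegralD _ plane R leb2 D _ _ mD I0 I1).
have I := integrableD mD I0 I1.
rewrite /Rintegral fineK; last exact: (@integrable_fin_num _ plane R leb2 D mD _ I).
set f := fun p => energy_density k (jet t0) (jet t0) p + energy_density k (jet t1) (jet t1) p.
have mf : mfun2 D f by apply/measurable_EFinP; exact: (measurable_int _ I).
rewrite -[RHS](@lay_integral_radial f mf); last first.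
  by move=> p Dp; apply: addr_ge0; exact: energy_density_ge0.
apply: eq_integral => x /set_mem[Dx _].
have r0 : x.1.1 != 0 by rewrite gt_eqF//; exact: rad_gt0 Dx.
have e0 (z w : R[i]) : z + 0%:C%C * w = z by rewrite mul0r addr0.
have er : cderive (@d_r R) (mode_fun t0 t1) x = mode_fun (dr t0) (dr t1) x.
  exact: etrans (cderive_mode_fun (@d_r R) x s0 s1) (e0 _ _).
have ez : cderive (@d_z R) (mode_fun t0 t1) x = mode_fun (dz t0) (dz t1) x.
  exact: etrans (cderive_mode_fun (@d_z R) x s0 s1) (e0 _ _).
have ep : (0 +i* 1)%C * cderive (@d_phi R) (mode_fun t0 t1) x - omega%:C%C * mode_fun t0 t1 x =
    mode_fun (fun p => - ((m%:~R + omega) * t0 p)) (fun p => - ((m%:~R + omega) * t1 p)) x.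
  rewrite (cderive_mode_fun (@d_phi R) x s0 s1) !mode_funE /d_phi /= !derive_dir0.
  by apply/eqP; rewrite eq_complex /=; apply/andP; split; apply/eqP; ring.
rewrite er ez ep (sqmod_mode_fun (dr t0)) (sqmod_mode_fun (dz t0)).
rewrite sqmod_mode_fun /f /energy_density /rad3 /rad2 /winv /jet /= /k /dr /dz; congr EFin.
set w := m%:~R + omega; set kk := kap; by field.
Qed.

Lemma energy_le (k : R) (F : X) : 0 <= k ->
  energy theta 0 k F F <= (1 + k) * energy theta 1 1 F F.
Proof.
move=> k0; have gen (u v x y : R) : 0 <= u -> 0 <= v -> 0 <= x -> 0 <= y ->
    0 * u + k * v + x + y <= (1 + k) * (1 * u + 1 * v + x + y).
  move=> u0 v0 x0 y0; have := mulr_ge0 k0 u0; have := mulr_ge0 k0 x0.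
  have := mulr_ge0 k0 y0; lra.
apply: gen; try exact: (@ip_ge0 _ plane R leb2 D rad2 rad_gt0).
by apply: (@ip_ge0 _ plane R leb2 D (@winv R)) => p Dp; rewrite invr_gt0; exact: rad_gt0.
Qed.

Lemma mode_funB (f0 f1 g0 g1 : fR) :
  (mode_fun f0 f1 \- mode_fun g0 g1)%R = mode_fun (f0 - g0) (f1 - g1).
Proof.
apply/funext => x; rewrite /= !mode_funE.
by apply/eqP; rewrite eq_complex /=; apply/andP; split; apply/eqP;
  rewrite -[(f0 - g0) x.1]/(f0 x.1 - g0 x.1) -[(f1 - g1) x.1]/(f1 x.1 - g1 x.1); ring.
Qed.

Lemma testB (t1 t2 : fR) : test D t1 -> test D t2 -> test D (t1 - t2).
Proof.
move=> T1 T2; have := test_lin (-1) T2 T1; congr test.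
by apply/funext => p; rewrite mulN1r addrC.
Qed.

Lemma jetB (t1 t2 : fR) : smooth t1 -> smooth t2 -> jet (t1 - t2) = jet t1 - jet t2.
Proof.
move=> s1 s2; have := jet_lin (-1) s2 s1; rewrite scaleN1r addrC => <-.
by congr jet; apply/funext => p; rewrite mulN1r addrC.
Qed.

Lemma cvg_EFin0 (a : nat -> R) (c : R) : (forall n, 0 <= a n <= c * n.+1%:R^-1) ->
  ((a n)%:E @[n --> \oo] --> (0 : \bar R))%E.
Proof.
move=> ha; have ca : a @ \oo --> (0 : R).
  have ch : (fun n => c * n.+1%:R^-1) @ \oo --> (0 : R).
    rewrite -[X in _ --> X](mulr0 c); apply: cvgM; first exact: cvg_cst.
    exact: cvg_harmonic.
  apply: (squeeze_cvgr (f := fun=> 0) (h := fun n => c * n.+1%:R^-1)) ch.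
    by near=> n; exact: ha.
  exact: cvg_cst.
apply: cvg_EFin; last exact: ca.
by near=> n.
Unshelve. all: by end_near. Qed.

Lemma form_dom_approx (F : X) : form_dom theta F -> exists t : nat -> fR, forall n,
  test D (t n) /\ energy theta 1 1 (F - jet (t n)) (F - jet (t n)) < n.+1%:R^-1.
Proof.
move=> [_ hF]; have /choice[t ht] : forall n : nat, exists t : fR, test D t /\
    energy theta 1 1 (F - jet t) (F - jet t) < n.+1%:R^-1.
  by move=> n; have [|t tD ht] := hF n.+1%:R^-1; [rewrite invr_gt0|exists t].
by exists t.
Qed.

Lemma jet_dist_le (F : X) t1 t2 : form_dom theta F -> test D t1 -> test D t2 ->
  energy theta 1 1 (jet (t1 - t2)) (jet (t1 - t2)) <=
  2 * energy theta 1 1 (F - jet t1) (F - jet t1) + 2 * energy theta 1 1 (F - jet t2) (F - jet t2).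
Proof.
move=> KF T1 T2; have [s1 _] := T1; have [s2 _] := T2.
have mB (x y : X) : finite_energy theta x -> finite_energy theta y -> finite_energy theta (x - y).
  by move=> ? ?; apply: (subspaceB (@finite_energy_lin R theta)).
have mZ (x : X) : finite_energy theta x -> finite_energy theta (-1 *: x).
  by move=> ?; apply: (subspaceZ (@finite_energy_lin R theta) (@finite_energy0 R theta)).
have M1 := mB _ _ (form_dom_finite_energy KF) (finite_energy_jet T1); have M2 := mB _ _ (form_dom_finite_energy KF) (finite_energy_jet T2).
have := energy_split (mZ _ M1) M2; rewrite energy_scale// sqrrN expr1n mul1r.
by rewrite jetB// scaleN1r opprB addrA subrK.
Qed.

(** Approximations of the amplitudes, times the mode, approximate the product on
    the layer: norms and forms on the layer equal those of the amplitudes. *)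
Lemma dom_Q_mode_fun (omega : R) (F0 F1 : X) : form_dom theta F0 -> form_dom theta F1 ->
  dom_Q omega theta (mode_fun F0.1.1 F1.1.1).
Proof.
move=> K0 K1; have u0 := form_dom_sq_rad K0; have u1 := form_dom_sq_rad K1.
have [m0 _] := u0; have [m1 _] := u1.
split.
  split; first exact: mode_fun_measurable.
  by rewrite mode_fun_norm// ltry.
have [t0 h0] := form_dom_approx K0; have [t1 h1] := form_dom_approx K1.
exists (fun n => mode_fun (t0 n) (t1 n)); split.
- by move=> n; apply: mode_fun_Cc; [case: (h0 n)|case: (h1 n)].
- have sqB (F : X) t : form_dom theta F -> test D t -> sq rad2 (t - F.1.1) /\
     ipr (t - F.1.1) (t - F.1.1) <= energy theta 1 1 (F - jet t) (F - jet t).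
    move=> KF T; have KJ : form_dom theta (F - jet t) by exact: (subspaceB (@form_dom_lin R theta) KF (form_dom_jet T)).
    have st : sq rad2 t := test_sqint oD T (fun p _ => @continuous_rad R p).
    have sF := form_dom_sq_rad KF; split; first exact: (@sqintB _ plane R leb2 D rad2 mD mrad rad_gt0).
    have [e _] := @energy_ge R theta true (F - jet t); apply: le_trans e.
    rewrite le_eqVlt; apply/orP; left; apply/eqP; apply: eq_Rintegral => p _.
    by rewrite -[(t - F.1.1) p]/(t p - F.1.1 p) -[(F - jet t).1.1 p]/(F.1.1 p - t p); ring.
  have e n : @sqnormL2 _ lspace R leb3 L rad3 (mode_fun (t0 n) (t1 n) \- mode_fun F0.1.1 F1.1.1)%R =
      (ipr (t0 n - F0.1.1) (t0 n - F0.1.1) + ipr (t1 n - F1.1.1) (t1 n - F1.1.1))%:E.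
    have [T0 _] := h0 n; have [T1 _] := h1 n.
    by rewrite mode_funB mode_fun_norm; [|exact: (sqB _ _ K0 T0).1|exact: (sqB _ _ K1 T1).1].
  rewrite (_ : (fun n => _) = fun n => (ipr (t0 n - F0.1.1) (t0 n - F0.1.1) +
     ipr (t1 n - F1.1.1) (t1 n - F1.1.1))%:E); last by apply/funext => n; exact: e.
  apply: (@cvg_EFin0 _ 2) => n; have [T0 n0] := h0 n; have [T1 n1] := h1 n.
  have := (sqB _ _ K0 T0).2; have := (sqB _ _ K1 T1).2.
  have p0 := @ip_ge0 _ plane R leb2 D rad2 rad_gt0 (t0 n - F0.1.1).
  have p1 := @ip_ge0 _ plane R leb2 D rad2 rad_gt0 (t1 n - F1.1.1).
  move=> q0 q1; apply/andP; split; first exact: addr_ge0.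
  rewrite mulr_natl mulr2n; apply: lerD; apply: ltW; [exact: le_lt_trans q1 n0|exact: le_lt_trans q0 n1].
move=> e e0; set k := k_ omega; have k0 : 0 <= k by exact: sqr_ge0.
have k1 : 0 < 8 * (1 + k) by rewrite mulr_gt0// ltr_wpDr.
have [M hM] : exists M : nat, forall n, (M <= n)%N -> n.+1%:R^-1 < e / (8 * (1 + k)).
  have c0 := divr_gt0 e0 k1.
  have := @cvg_harmonic R; move=> /cvgrPdist_lt /(_ _ c0)[M _ hM]; exists M => n nM.
  by have := hM n nM; rewrite /= sub0r normrN ger0_norm.
exists M => n l nM lM; rewrite mode_funB.
have [T0 n0] := h0 n; have [T1 n1] := h1 n; have [T0' n0'] := h0 l; have [T1' n1'] := h1 l.
have B0 := testB T0 T0'; have B1 := testB T1 T1'.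
rewrite mode_fun_Q// lte_fin -/k.
have := energy_le (jet (t0 n - t0 l)) k0; have := energy_le (jet (t1 n - t1 l)) k0.
have := jet_dist_le K0 T0 T0'; have := jet_dist_le K1 T1 T1'.
have := hM n nM; have := hM l lM; move: n0 n1 n0' n1'.
set a0 := energy _ _ _ (F0 - jet (t0 n)) _; set a1 := energy _ _ _ (F1 - jet (t1 n)) _.
set b0 := energy _ _ _ (F0 - jet (t0 l)) _; set b1 := energy _ _ _ (F1 - jet (t1 l)) _.
set d0 := energy _ 1 1 (jet (t0 n - t0 l)) _; set d1 := energy _ 1 1 (jet (t1 n - t1 l)) _.
set q0 := energy _ 0 k (jet (t0 n - t0 l)) _; set q1 := energy _ 0 k (jet (t1 n - t1 l)) _.
set x := n.+1%:R^-1; set y := l.+1%:R^-1; set c := e / _.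
clearbody a0 a1 b0 b1 d0 d1 q0 q1.
have ce : 8 * (1 + k) * c = e by rewrite /c mulrC mulfVK// gt_eqF.
move=> a0x a1x b0y b1y yc xc D1 D0 Q1 Q0.
have DD : d0 + d1 < 8 * c by lra.
have : (1 + k) * (d0 + d1) < (1 + k) * (8 * c) by rewrite ltr_pM2l// ltr_wpDr.
have -> : (1 + k) * (8 * c) = e by rewrite -ce; ring.
move=> E; apply: le_lt_trans E; rewrite mulrDr; exact: lerD.
Qed.

Lemma form_dom_dom_f (omega : R) (F0 F1 : X) : form_dom theta F0 -> form_dom theta F1 ->
  dom_f m omega theta (of_parts F0 F1).
Proof.
move=> K0 K1; split.
  apply/(@L2_sqint _ plane R leb2 D mD rad2 mrad rad_gt0).
  by split; [exact: form_dom_sq_rad K0|exact: form_dom_sq_rad K1].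
exists (mode_fun F0.1.1 F1.1.1); first exact: dom_Q_mode_fun.
apply: aeW => p _; by rewrite fourier_mode_fun.
Qed.

End Layer.

(** * The form domain of the fiber *)

Section FormDomainOfFiber.
Context {R : realType}.
Variables (theta : R) (m : int).
Notation leb1 := (@lebesgue_measure R).
Notation leb2 := (@leb2 R).
Notation leb3 := (@leb3 R).
Notation line := (measurableTypeR R).
Notation plane := (line * line)%type.
Notation lspace := (plane * line)%type.
Notation mset := (@measurable _ plane).
Notation mfun2 := (@measurable_fun _ _ plane R).
Notation mfun3 := (@measurable_fun _ _ lspace R).
Notation D := (Gui theta).
Notation L := (Lay theta).
Notation circle := (@circle R).
Notation rad2 := (@rad2 R).
Notation rad3 := (@rad3 R).
Notation fR := (R * R -> R).
Notation space := (R * R * R)%type.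
Notation X := ((fR * fR) * fR)%type.
Notation sq w := (@sqint _ plane R leb2 D w).
Notation ipr := (@ip _ plane R leb2 D rad2).
Notation ReC := (@complex.Re R).
Notation ImC := (@complex.Im R).
Notation ci := circle_integral.
Notation Cm := (Cm m).
Notation Sm := (Sm m).
Notation kap := (@kap R).

Let oD : open D. Proof. exact: Gui_open. Qed.
Let mD : mset D. Proof. exact: open_measurable2. Qed.
Let mcirc : @measurable _ line circle. Proof. exact: circle_measurable. Qed.
Let mrad : mfun2 D rad2.
Proof. by apply: (continuous_on_measurable2 oD) => p _; exact: continuous_rad. Qed.
Let mwinv : mfun2 D (@winv R).
Proof. by apply: (continuous_on_measurable2 oD) => p; exact: continuous_winv. Qed.
Let rad_gt0 p : D p -> 0 < rad2 p. Proof. exact: Gui_rad_gt0. Qed.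
Implicit Types (u : space -> R[i]) (p : R * R) (omega : R).
Notation T0 u := (ci (re_mode m u)).
Notation T1 u := (ci (im_mode m u)).
Notation k_ omega := ((m%:~R + omega) ^+ 2).

Lemma mode_test u : Cc_Lay theta u -> test D (T0 u) /\ test D (T1 u).
Proof.
move=> [su _ [K [cK KD u0]]]; have [s0 s1] := smooth_modes m su.
have z (p : R * R) : ~ K p -> T0 u p = 0 /\ T1 u p = 0.
  move=> nK; have e (g : space -> R) : (forall phi, g (p, phi) = 0) -> ci g p = 0.
    move=> g0; rewrite /ci /Rintegral integral0_eq// => x _; by rewrite g0.
  by split; apply: e => phi; rewrite /re_mode /im_mode u0//= !mul0r ?subrr ?addr0.
by split; (split; first exact: smooth_circle_integral); exists K; split=> // p /z[].
Qed.

Lemma smooth_sqmod u : csmooth u -> smooth (fun x : space => sqmod (u x)).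
Proof.
move=> [s0 s1]; rewrite (_ : (fun x => _) = fun x => (ReC \o u) x * (ReC \o u) x + (ImC \o u) x * (ImC \o u) x).
  by apply: smoothD; exact: smoothM.
by apply/funext => x; rewrite /sqmod !expr2.
Qed.

Lemma circle_integralE (f : space -> R) p : continuous f ->
  ((ci f p)%:E = \int[leb1]_(phi in circle) (f (p, phi))%:E)%E.
Proof.
move=> cf; have I := circle_integrable (@continuous_fiber _ _ p cf).
by rewrite /ci /Rintegral fineK//; exact: (@integrable_fin_num _ line R leb1 circle mcirc _ I).
Qed.

Lemma bessel_smooth u p : csmooth u ->
  sqmod (fourier m u p) <= ci (fun x => sqmod (u x)) p.
Proof.
move=> su; have cs := smooth_continuous (smooth_sqmod su).
rewrite -lee_fin circle_integralE//; apply: bessel.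
have [s0 s1] := su; split.
  apply: measurable_funTS; apply: continuous_measurable_fun.
  exact: (@continuous_fiber _ (ReC \o u) p (smooth_continuous s0)).
apply: measurable_funTS; apply: continuous_measurable_fun.
exact: (@continuous_fiber _ (ImC \o u) p (smooth_continuous s1)).
Qed.

Lemma csmooth_ang omega u : csmooth u -> csmooth (ang omega u).
Proof.
move=> su; have [s0 s1] := su; have [d0 d1] := csmooth_cderive (@d_phi R) su; split.
  rewrite (_ : ReC \o _ = fun x => - (ImC \o cderive (@d_phi R) u) x - omega * (ReC \o u) x).
    by apply: smoothB; [exact: smoothN|exact: smoothZ].
  apply/funext => x; rewrite /ang /=; case: (u x) => a b /=; ring.
rewrite (_ : ImC \o _ = fun x => (ReC \o cderive (@d_phi R) u) x - omega * (ImC \o u) x).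
  by apply: smoothB => //; exact: smoothZ.
apply/funext => x; rewrite /ang /=; case: (u x) => a b /=; ring.
Qed.

(** The inequality of Bessel for the radial, the axial and the magnetic angular
    derivative, integrated over the guide. *)
Lemma mode_energy_le omega u : Cc_Lay theta u ->
  ((energy theta 0 (k_ omega) (jet (T0 u)) (jet (T0 u)) +
    energy theta 0 (k_ omega) (jet (T1 u)) (jet (T1 u)))%:E <= Qform0 omega theta u)%E.
Proof.
have alg (w r q a0 a1 b0 b1 c0 c1 : R) :
    w ^+ 2 * (a0 * a0 * q) + b0 * b0 * r + c0 * c0 * r +
    (w ^+ 2 * (a1 * a1 * q) + b1 * b1 * r + c1 * c1 * r) =
    r * (b0 ^+ 2 + b1 ^+ 2) + r * (c0 ^+ 2 + c1 ^+ 2) +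
    q * ((- w * a0 - - 0 * a1) ^+ 2 + (- w * a1 + - 0 * a0) ^+ 2) by ring.
move=> Cu; have [su per _] := Cu; have [t0 t1] := mode_test Cu; set k := k_ omega.
have k0 : 0 <= k by exact: sqr_ge0.
have [I0 ->] := energy_integral k (form_dom_jet t0) (form_dom_jet t0).
have [I1 ->] := energy_integral k (form_dom_jet t1) (form_dom_jet t1).
rewrite -(@RintegralD _ plane R leb2 D _ _ mD I0 I1).
have I := integrableD mD I0 I1.
rewrite /Rintegral fineK; last exact: (@integrable_fin_num _ plane R leb2 D mD _ I).
set f := fun p => energy_density k (jet (T0 u)) (jet (T0 u)) p + energy_density k (jet (T1 u)) (jet (T1 u)) p.
have mf : mfun2 D f by apply/measurable_EFinP; exact: (measurable_int _ I).
pose A (x : space) := sqmod (cderive (@d_r R) u x); pose B (x : space) := sqmod (cderive (@d_z R) u x).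
pose C (x : space) := sqmod (ang omega u x).
have sr := csmooth_cderive (@d_r R) su; have sz := csmooth_cderive (@d_z R) su.
have sa := csmooth_ang omega su.
have cA : continuous A := smooth_continuous (smooth_sqmod sr).
have cB : continuous B := smooth_continuous (smooth_sqmod sz).
have cC : continuous C := smooth_continuous (smooth_sqmod sa).
have mcont (g : space -> R) : continuous g -> mfun3 L g.
  by move=> cg; apply: measurable_funTS; exact: continuous_measurable3.
pose J (x : space) := (A x + B x + C x / rad3 x ^+ 2) * rad3 x.
have mJ : mfun3 L J.
  have h : mfun3 L (fun x => (A x + B x + C x * (winv x.1 * winv x.1)) * rad2 x.1).
    apply: measurable_funM; last exact: lay_pullback.
    apply: measurable_funD; first by apply: measurable_funD; exact: mcont.
    apply: measurable_funM; first exact: mcont.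
    by apply: measurable_funM; exact: lay_pullback.
  by apply: eq_measurable_fun h => x _; rewrite /J /rad3 /winv expr2 invfM.
have J0 x : L x -> 0 <= J x.
  move=> [Dx _]; have r0 := rad_gt0 Dx; rewrite /J mulr_ge0 ?(ltW r0)//.
  have qA : 0 <= A x by exact: sqmod_ge0.
  have qB : 0 <= B x by exact: sqmod_ge0.
  have qC : 0 <= C x by exact: sqmod_ge0.
  have q : 0 <= (rad3 x ^+ 2)^-1 by rewrite invr_ge0 sqr_ge0.
  exact: (addr_ge0 (addr_ge0 qA qB) (mulr_ge0 qC q)).
have [|x Lx|mK E] := @lay_tonelli R theta (fun x => (J x)%:E).
- exact/measurable_EFinP.
- by rewrite lee_fin J0.
have -> : Qform0 omega theta u = (\int[leb3]_(x in L) (J x)%:E)%E by [].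
rewrite E; apply: (@ge0_le_integral _ plane R leb2 D mD) => //.
- move=> p Dp; rewrite lee_fin.
  exact: (addr_ge0 (energy_density_ge0 _ k0 Dp) (energy_density_ge0 _ k0 Dp)).
- exact/measurable_EFinP.
move=> p Dp; have r0 : 0 < p.1 := rad_gt0 Dp; have rn : p.1 != 0 by rewrite gt_eqF.
have Ep : (\int[leb1]_(phi in circle) (J (p, phi))%:E = (p.1 * ci A p + p.1 * ci B p + p.1^-1 * ci C p)%:E)%E.
  rewrite -(circle_integral_lin p.1 p.1 p cA cB).
  have cAB : continuous (fun x => p.1 * A x + p.1 * B x).
    by move=> x; apply: cvgD; (apply: cvgM; [exact: cvg_cst|]); [exact: cA|exact: cB].
  rewrite -[X in (X + _)%:E]mul1r -(circle_integral_lin 1 p.1^-1 p cAB cC) circle_integralE; last first.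
    move=> x; apply: cvgD; (apply: cvgM; [exact: cvg_cst|]); [exact: cAB|exact: cC].
  apply: eq_integral => phi _; congr EFin; rewrite /J /rad3 /=.
  by field.
rewrite Ep lee_fin.
have bA := bessel_smooth p sr; have bB := bessel_smooth p sz; have bC := bessel_smooth p sa.
have fr := fourier_horizontal m p ((1, 0) : R * R) su.
have fz := fourier_horizontal m p ((0, 1) : R * R) su.
have per0 : u (p, 2 * pi) = u (p, 0) by rewrite -(per p 0) add0r.
have fa := fourier_ang m omega su per0.
rewrite -[cderive (@d_r R) u]/(cderive (((1, 0) : R * R, 0) : space) u) -fr in bA.
rewrite -[cderive (@d_z R) u]/(cderive (((0, 1) : R * R, 0) : space) u) -fz in bB.
rewrite fa fourierE in bC.
have hA := ler_wpM2l (ltW r0) bA; have hB := ler_wpM2l (ltW r0) bB.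
have ri0 : 0 <= p.1^-1 by rewrite invr_ge0 ltW.
have hC := ler_wpM2l ri0 bC.
apply: le_trans (lerD (lerD hA hB) hC); rewrite le_eqVlt; apply/orP; left; apply/eqP.
rewrite /f /energy_density /sqmod /= /winv /rad2 /k /dr /dz.
exact: alg.
Qed.

Lemma Cc_LayB u v : Cc_Lay theta u -> Cc_Lay theta v -> Cc_Lay theta (u \- v)%R.
Proof.
move=> [[u0 u1] pu [K [cK KD hu]]] [[v0 v1] pv [K' [cK' KD' hv]]]; split.
- split.
    rewrite (_ : _ \o _ = fun x => (ReC \o u) x - (ReC \o v) x); first exact: smoothB.
    by apply/funext => x /=; case: (u x) (v x) => [a b] [c d].
  rewrite (_ : _ \o _ = fun x => (ImC \o u) x - (ImC \o v) x); first exact: smoothB.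
  by apply/funext => x /=; case: (u x) (v x) => [a b] [c d].
- by move=> p phi; rewrite /= pu pv.
exists (K `|` K'); split; [exact: compactU|by rewrite subUset|].
by move=> p phi /not_orP[n1 n2]; rewrite /= hu// hv// subrr.
Qed.

Lemma modesB u v x : re_mode m (u \- v)%R x = re_mode m u x - re_mode m v x /\
  im_mode m (u \- v)%R x = im_mode m u x - im_mode m v x.
Proof. by rewrite /re_mode /im_mode /=; case: (u x) (v x) => [a b] [c d] /=; split; ring. Qed.

Lemma mode_coefB u v : csmooth u -> csmooth v ->
  T0 (u \- v)%R = T0 u - T0 v /\ T1 (u \- v)%R = T1 u - T1 v.
Proof.
move=> su sv; have [u0 u1] := smooth_modes m su; have [v0 v1] := smooth_modes m sv.
have c0 := smooth_continuous u0; have c1 := smooth_continuous u1.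
have d0 := smooth_continuous v0; have d1 := smooth_continuous v1.
split; apply/funext => p.
  rewrite -[RHS]/(ci (re_mode m u) p - ci (re_mode m v) p) -[X in X - _]mul1r -[X in _ - X]mul1r -mulNr.
  rewrite -(circle_integral_lin 1 (-1) p c0 d0); apply: eq_Rintegral => x _.
  by rewrite (modesB u v (p, x)).1 mul1r mulN1r.
rewrite -[RHS]/(ci (im_mode m u) p - ci (im_mode m v) p) -[X in X - _]mul1r -[X in _ - X]mul1r -mulNr.
rewrite -(circle_integral_lin 1 (-1) p c1 d1); apply: eq_Rintegral => x _.
by rewrite (modesB u v (p, x)).2 mul1r mulN1r.
Qed.

Lemma ip_zero_ae (f : fR) : sq rad2 f -> ipr f f = 0 ->
  {ae leb2, forall p, D p -> f p = 0}.
Proof.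
move=> sf f0; have [mf _] := sf.
have E : (\int[leb2]_(p in D) (f p ^+ 2 * rad2 p)%:E = 0)%E.
  by rewrite -(@ipE _ plane R leb2 D rad2 mD mrad rad_gt0 f sf) f0.
have mm : @measurable_fun _ _ plane (\bar R) D (fun p => (f p ^+ 2 * rad2 p)%:E).
  by apply/measurable_EFinP; apply: measurable_funM => //; exact: measurable_funX.
have := (@ae_eq_integral_abs _ plane R leb2 D mD _ mm).1.
have -> : (\int[leb2]_(x in D) `|(f x ^+ 2 * rad2 x)%:E| = 0)%E.
  rewrite -[RHS]E; apply: eq_integral => p /set_mem Dp.
  by rewrite gee0_abs// lee_fin (sqw_ge0 rad_gt0).
move=> /(_ erefl); apply: filterS => p h Dp.
have := h Dp => -[/eqP]; rewrite mulf_eq0 sqrf_eq0 (gt_eqF (rad_gt0 Dp)) orbF => /eqP.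
by [].
Qed.

Lemma ae_zero_sq (w f : fR) : mfun2 D w -> mfun2 D f ->
  {ae leb2, forall p, D p -> f p = 0} -> sq w f /\ @ip _ plane R leb2 D w f f = 0.
Proof.
move=> mw mf f0.
have mm : @measurable_fun _ _ plane (\bar R) D (fun p => (f p ^+ 2 * w p)%:E).
  by apply/measurable_EFinP; apply: measurable_funM => //; exact: measurable_funX.
have E : (\int[leb2]_(x in D) `|(f x ^+ 2 * w x)%:E| = 0)%E.
  apply: (@ae_eq_integral_abs _ plane R leb2 D mD _ mm).2.
  by apply: filterS f0 => p h Dp; rewrite h// expr0n mul0r.
have I : leb2.-integrable D (EFin \o (fun p => f p ^+ 2 * w p)).
  by apply/integrableP; split=> //; rewrite E.
split; first by split.
apply/eqP; rewrite -normr_le0.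
have h := @le_normr_Rintegral _ plane R leb2 D (fun p => f p ^+ 2 * w p) mD I.
have -> : @ip _ plane R leb2 D w f f = Rintegral leb2 D (fun p => f p ^+ 2 * w p).
  by apply: eq_Rintegral => p _; rewrite expr2.
apply: le_trans h _; rewrite /Rintegral.
by rewrite (_ : (\int[leb2]_(x in D) (`|f x ^+ 2 * w x|)%:E = 0)%E).
Qed.

(** The triple with the other function differs by an element of norm zero. *)
Lemma form_dom_replace (F : X) (g : fR) : form_dom theta F -> sq rad2 g ->
  ipr (g - F.1.1) (g - F.1.1) = 0 -> form_dom theta ((g, F.1.2), F.2).
Proof.
move=> KF sg g0; have sF := form_dom_sq_rad KF; have [mF hF] := KF.
have sd := @sqintB _ plane R leb2 D rad2 mD mrad rad_gt0 _ _ sg sF.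
have [md _] := sd.
have ae0 := ip_zero_ae sd g0.
have mwt : mfun2 D (@wtot R) by apply: measurable_funD.
have wt0 p : D p -> 0 < wtot p.
  by move=> Dp; rewrite addr_gt0 ?rad_gt0 ?invr_gt0 ?rad_gt0.
have [st zt] := ae_zero_sq mwt md ae0; have [sv zv] := ae_zero_sq mwinv md ae0.
pose d : X := ((g - F.1.1, 0), 0).
have z0 : sq rad2 (0 : fR) by exact: (@sqint0 _ plane R leb2 D rad2 mD).
have Md : finite_energy theta d by split.
have Nd : energy theta 1 1 d d = 0.
  rewrite /energy /= g0 zv.
  have -> : ipr (0 : fR) 0 = 0.
    by rewrite /ip /Rintegral integral0_eq// => x _; rewrite mul0r mul0r.
  by rewrite !mulr0 !addr0.
have Ed : ((g, F.1.2), F.2) = d + F :> X.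
  by case: F @d {KF sF mF hF sd md ae0 g0 st zt sv zv Md Nd} => [[u a] b] /=; congr ((_, _), _); rewrite ?add0r// subrK.
rewrite Ed; split; first exact: (subspaceD (@finite_energy_lin R theta) Md mF).
move=> c c0; have c2 : 0 < c / 2 by lra.
have [t tD ht] := hF _ c2; exists t => //.
have MB : finite_energy theta (F - jet t) by exact: (subspaceB (@finite_energy_lin R theta) mF (finite_energy_jet tD)).
rewrite -addrA; apply: le_lt_trans (energy_split Md MB) _; rewrite Nd; lra.
Qed.

(** The inequality of Bessel is applied to s - U at almost every point of the
    guide, namely where the section of U is square integrable, so that the
    coefficient of the difference is the difference of the coefficients. *)
Lemma mode_limit_le (s U : space -> R[i]) (f : R * R -> R[i]) : Cc_Lay theta s ->
  @L2 _ lspace R leb3 L rad3 U -> @L2 _ plane R leb2 D rad2 f ->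
  aeeq leb2 D f (fourier m U) ->
  ((ipr (T0 s - (ReC \o f)) (T0 s - (ReC \o f)) +
    ipr (T1 s - (ImC \o f)) (T1 s - (ImC \o f)))%:E <=
   @sqnormL2 _ lspace R leb3 L rad3 (s \- U)%R)%E.
Proof.
move=> Cs [[U0 U1] Ufin] /(@L2_sqint _ plane R leb2 D mD rad2 mrad rad_gt0)[f0 f1] ae_f.
have [[s0 s1] _ _] := Cs; have [t0 t1] := mode_test Cs.
have st t : test D t -> sq rad2 t by move=> tD; exact: (test_sqint oD tD (fun p _ => @continuous_rad R p)).
have d0 := @sqintB _ plane R leb2 D rad2 mD mrad rad_gt0 _ _ (st _ t0) f0.
have d1 := @sqintB _ plane R leb2 D rad2 mD mrad rad_gt0 _ _ (st _ t1) f1.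
have mcont (g : space -> R) : smooth g -> mfun3 L g.
  by move=> sg; apply: measurable_funTS; apply: continuous_measurable3; exact: smooth_continuous.
have ms : @cmeasurable _ lspace R L s by split; exact: mcont.
have msU : @cmeasurable _ lspace R L (s \- U)%R.
  split.
    have h : mfun3 L (fun x => ReC (s x) - ReC (U x)) by apply: measurable_funB => //; case: ms.
    by apply: eq_measurable_fun h => x _ /=; case: (s x) (U x) => [a b] [c d].
  have h : mfun3 L (fun x => ImC (s x) - ImC (U x)) by apply: measurable_funB => //; case: ms.
  by apply: eq_measurable_fun h => x _ /=; case: (s x) (U x) => [a b] [c d].
have mrad3 : mfun3 L rad3 by apply: lay_pullback.
have mden (v : space -> R[i]) : @cmeasurable _ lspace R L v -> mfun3 L (fun x => sqmod (v x) * rad3 x).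
  by move=> [v0 v1]; apply: measurable_funM => //; apply: measurable_funD; exact: measurable_funX.
have den0 (v : space -> R[i]) x : L x -> (0 <= (sqmod (v x) * rad3 x)%:E)%E.
  by move=> [Dx _]; rewrite lee_fin mulr_ge0 ?sqmod_ge0// ltW//; exact: rad_gt0 Dx.
have ton (v : space -> R[i]) : @cmeasurable _ lspace R L v ->
  @measurable_fun _ _ plane (\bar R) D (fun p => \int[leb1]_(phi in circle) (sqmod (v (p, phi)) * p.1)%:E)%E /\
  (@sqnormL2 _ lspace R leb3 L rad3 v = \int[leb2]_(p in D) \int[leb1]_(phi in circle) (sqmod (v (p, phi)) * p.1)%:E)%E.
  move=> mv; apply: (@lay_tonelli R theta (fun x => (sqmod (v x) * rad3 x)%:E)) => [|x Lx].
    by apply/measurable_EFinP; exact: mden.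
  exact: den0.
have sect (v : space -> R[i]) p : @cmeasurable _ lspace R L v -> D p ->
    @cmeasurable _ line R circle (fun phi => v (p, phi)).
  by move=> [v0 v1] Dp; split; [exact: (@section_measurable _ _ plane line D circle mD mcirc _ R (ReC \o v) p v0 Dp)
    |exact: (@section_measurable _ _ plane line D circle mD mcirc _ R (ImC \o v) p v1 Dp)].
have pull (v : space -> R[i]) p : @cmeasurable _ lspace R L v -> D p ->
  (\int[leb1]_(phi in circle) (sqmod (v (p, phi)) * p.1)%:E =
   (p.1)%:E * \int[leb1]_(phi in circle) (sqmod (v (p, phi)))%:E)%E.
  move=> mv Dp; have [v0 v1] := sect _ _ mv Dp; have r0 : 0 < p.1 := rad_gt0 Dp.
  rewrite -(@ge0_integralZl _ line R leb1 circle mcirc).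
  - by apply: eq_integral => x _; rewrite -EFinM mulrC.
  - by apply/measurable_EFinP; apply: measurable_funD; exact: measurable_funX.
  - by move=> x _; rewrite lee_fin sqmod_ge0.
  - by rewrite lee_fin ltW.
have mU : @cmeasurable _ lspace R L U by split.
have [mIU EU] := ton _ mU; have [mIs Es] := ton _ msU.
have gU p : D p -> (0 <= \int[leb1]_(phi in circle) (sqmod (U (p, phi)) * p.1)%:E)%E.
  by move=> Dp; apply: integral_ge0 => x cx; exact: (den0 U (p, x) (conj Dp cx)).
have gs p : D p -> (0 <= \int[leb1]_(phi in circle) (sqmod ((s \- U)%R (p, phi)) * p.1)%:E)%E.
  by move=> Dp; apply: integral_ge0 => x cx; exact: (den0 (s \- U)%R (p, x) (conj Dp cx)).
have IU : leb2.-integrable D (fun p => \int[leb1]_(phi in circle) (sqmod (U (p, phi)) * p.1)%:E)%E.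
  apply/integrableP; split=> //.
  rewrite (_ : (\int[leb2]_(x in D) _ = @sqnormL2 _ lspace R leb3 L rad3 U)%E)//.
  by rewrite EU; apply: eq_integral => p /set_mem Dp; rewrite gee0_abs// gU.
(* by Tonelli almost every section of U is square integrable *)
have ae_U := integrable_ae mD IU.
rewrite EFinD !(@ipE _ plane R leb2 D rad2 mD mrad rad_gt0)//.
rewrite -(@ge0_integralD _ plane R leb2 D mD) //; last 4 first.
- by move=> p Dp; rewrite lee_fin; apply: (sqw_ge0 rad_gt0).
- exact: sqint_meas d0.
- by move=> p Dp; rewrite lee_fin; apply: (sqw_ge0 rad_gt0).
- exact: sqint_meas d1.
rewrite Es; apply: (@ae_ge0_le_integral _ plane R leb2 D mD) => //.
- by move=> p Dp; rewrite -EFinD lee_fin; apply: addr_ge0; apply: (sqw_ge0 rad_gt0).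
- by apply: emeasurable_funD; [exact: sqint_meas d0|exact: sqint_meas d1].
apply: filterS2 ae_f ae_U => p hf hU Dp; have r0 : 0 < p.1 := rad_gt0 Dp.
rewrite pull// -EFinD.
have finU : (\int[leb1]_(phi in circle) (sqmod (U (p, phi)))%:E < +oo)%E.
  have := hU Dp; rewrite pull//; case: (\int[_]_(_ in _) _)%E => [r| |] //.
    by move=> _; exact: ltry.
  by rewrite mulry gtr0_sg// mul1e.
have [ua ub] := section_sq1 (sect _ _ mU Dp) finU.
have [IU0 IU1] := mode_integrable m ua ub.
have [c0 c1] := smooth_modes m (conj s0 s1).
have Is0 := circle_integrable (@continuous_fiber _ _ p (smooth_continuous c0)).
have Is1 := circle_integrable (@continuous_fiber _ _ p (smooth_continuous c1)).
have E0 : ci (re_mode m (s \- U)%R) p = T0 s p - T0 U p.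
  rewrite -(@RintegralB _ line R leb1 circle _ _ mcirc Is0 IU0).
  by apply: eq_Rintegral => x _; rewrite (modesB s U (p, x)).1.
have E1 : ci (im_mode m (s \- U)%R) p = T1 s p - T1 U p.
  rewrite -(@RintegralB _ line R leb1 circle _ _ mcirc Is1 IU1).
  by apply: eq_Rintegral => x _; rewrite (modesB s U (p, x)).2.
have := bessel m (sect _ _ msU Dp); rewrite fourierE E0 E1 => B.
have B' : ((p.1)%:E * (sqmod ((T0 s p - T0 U p) +i* (T1 s p - T1 U p))%C)%:E <=
   (p.1)%:E * \int[leb1]_(phi in circle) (sqmod ((s \- U)%R (p, phi)))%:E)%E.
  by apply: lee_wpmul2l => //; rewrite lee_fin ltW.
apply: le_trans B'; rewrite -EFinM lee_fin.
have := hf Dp; rewrite fourierE => Ef.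
rewrite -[(T0 s - (ReC \o f)) p]/(T0 s p - ReC (f p)) -[(T1 s - (ImC \o f)) p]/(T1 s p - ImC (f p)).
by rewrite Ef /sqmod /= /rad2 -mulrDl mulrC lexx.
Qed.

Hypothesis htheta : 0 < theta < pi / 2.

Lemma coercive_mode omega (F : X) : 4^-1 <= k_ omega -> form_dom theta F ->
  energy theta 1 1 F F <= 8 * energy theta 0 (k_ omega) F F.
Proof.
move=> k4 KF; have := energy_coercive htheta KF k4 ltr01.
by rewrite subr0 minxx oppr0 mul1r mulrC ler_pdivrMr// mulrC.
Qed.

(** The coefficients of an approximating sequence of the layer form a Cauchy
    sequence in the energy norm.  Its limit in the space of triples has the
    function f as first entry, because the coefficients also converge to f in the
    space of square integrable functions. *)
Lemma dom_f_form_dom omega (f : R * R -> R[i]) : 4^-1 <= k_ omega ->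
  dom_f m omega theta f -> exists F0 F1, [/\ form_dom theta F0, form_dom theta F1 & f = of_parts F0 F1].
Proof.
have quart (x y d : R) : x < d / 4 -> y < d / 4 -> 2 * x + 2 * y <= d by lra.
move=> k4 [L2f [U [L2U [s [hs cvs cau]]] ae_f]].
have ts n := mode_test (hs n).
have cs n : csmooth (s n) by case: (hs n).
have dist n l : jet (T0 (s n)) - jet (T0 (s l)) = jet (T0 (s n \- s l)%R) /\
    jet (T1 (s n)) - jet (T1 (s l)) = jet (T1 (s n \- s l)%R).
  have [-> ->] := mode_coefB (cs n) (cs l).
  by rewrite !jetB//; [case: (ts n) => _ []|case: (ts l) => _ []|case: (ts n) => -[]|case: (ts l) => -[]].
(* the form of the layer controls the energy norm of the coefficients *)
have bnd c : 0 < c -> exists M : nat, forall n l : nat, (M <= n)%N -> (M <= l)%N ->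
    energy theta 1 1 (jet (T0 (s n \- s l)%R)) (jet (T0 (s n \- s l)%R)) +
    energy theta 1 1 (jet (T1 (s n \- s l)%R)) (jet (T1 (s n \- s l)%R)) < c.
  move=> c0; have c8 : 0 < c / 8 by lra.
  have [M hM] := cau _ c8; exists M => n l nM lM.
  have C := Cc_LayB (hs n) (hs l); have [t0 t1] := mode_test C.
  have := le_lt_trans (mode_energy_le omega C) (hM n l nM lM); rewrite lte_fin => h.
  have := coercive_mode k4 (form_dom_jet t0); have := coercive_mode k4 (form_dom_jet t1); move: h.
  set a := energy _ 0 _ _ _; set b := energy _ 0 _ _ _; set a' := energy _ _ _ _ _.
  set b' := energy _ _ _ _ _; clearbody a b a' b'; lra.
have N0 (x : X) : 0 <= energy theta 1 1 x x.
  rewrite /energy !mul1r; apply: addr_ge0; last exact: (@ip_ge0 _ plane R leb2 D rad2 rad_gt0).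
  apply: addr_ge0; last exact: (@ip_ge0 _ plane R leb2 D rad2 rad_gt0).
  apply: addr_ge0; first exact: (@ip_ge0 _ plane R leb2 D rad2 rad_gt0).
  by apply: (@ip_ge0 _ plane R leb2 D (@winv R)) => p Dp; rewrite invr_gt0; exact: rad_gt0.
have [||F0 KF0 lim0] := @form_dom_complete R theta (fun n => jet (T0 (s n))).
- by move=> n; apply: form_dom_jet; case: (ts n).
- move=> c /bnd[M hM]; exists M => n l nM lM; rewrite (dist n l).1.
  by apply: le_lt_trans (hM n l nM lM); rewrite lerDl.
have [||F1 KF1 lim1] := @form_dom_complete R theta (fun n => jet (T1 (s n))).
- by move=> n; apply: form_dom_jet; case: (ts n).
- move=> c /bnd[M hM]; exists M => n l nM lM; rewrite (dist n l).2.
  by apply: le_lt_trans (hM n l nM lM); rewrite lerDr.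
have [f0 f1] := (@L2_sqint _ plane R leb2 D mD rad2 mrad rad_gt0 f).1 L2f.
have pos := @ip_ge0 _ plane R leb2 D rad2 rad_gt0.
have conv c : 0 < c -> exists M : nat, forall n : nat, (M <= n)%N ->
    ipr (T0 (s n) - (ReC \o f)) (T0 (s n) - (ReC \o f)) < c /\
    ipr (T1 (s n) - (ImC \o f)) (T1 (s n) - (ImC \o f)) < c.
  move=> c0; have : \forall n \near \oo, (@sqnormL2 _ lspace R leb3 L rad3 (s n \- U)%R < c%:E)%E.
    have h : nbhs (0 : \bar R)%E [set y : \bar R | (y < c%:E)%E].
      by apply: open_ereal_lt'; rewrite lte_fin.
    exact: (cvs _ h).
  move=> [M _ hM]; exists M => n nM; have := hM n nM.
  move=> /(le_lt_trans (mode_limit_le (hs n) L2U L2f ae_f)); rewrite lte_fin => h.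
  split; apply: le_lt_trans h; first by rewrite lerDl; exact: pos.
  by rewrite lerDr; exact: pos.
have zero (t : nat -> fR) (F : X) (g : fR) : (forall n, test D (t n)) -> form_dom theta F -> sq rad2 g ->
    (forall c : R, 0 < c -> exists M : nat, forall n, (M <= n)%N -> energy theta 1 1 (jet (t n) - F) (jet (t n) - F) < c) ->
    (forall c : R, 0 < c -> exists M : nat, forall n, (M <= n)%N -> ipr (t n - g) (t n - g) < c) ->
    ipr (g - F.1.1) (g - F.1.1) = 0.
  move=> tt KF sg h1 h2; apply/eqP; rewrite eq_le pos andbT.
  apply/ler_addgt0Pl => c c0; rewrite addr0.
  have c4 : 0 < c / 4 by lra.
  have [M1 hM1] := h1 _ c4; have [M2 hM2] := h2 _ c4.
  set n := maxn M1 M2; have g1 := hM1 n (leq_maxl _ _); have e2 := hM2 n (leq_maxr _ _).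
  have st : sq rad2 (t n) := test_sqint oD (tt n) (fun p _ => @continuous_rad R p).
  have h := @ip_split _ plane R leb2 D rad2 mD mrad rad_gt0 g (t n) F.1.1 sg st (form_dom_sq_rad KF).
  have e3 : ipr (g - t n) (g - t n) = ipr (t n - g) (t n - g).
    apply: eq_Rintegral => p _; rewrite -[(g - t n) p]/(g p - t n p) -[(t n - g) p]/(t n p - g p); ring.
  have [e4 _] := @energy_ge R theta true (jet (t n) - F).
  have e5 : ipr (t n - F.1.1) (t n - F.1.1) < c / 4 by exact: le_lt_trans e4 g1.
  by apply: le_trans h _; rewrite e3; exact: quart.
have z0 : ipr ((ReC \o f) - F0.1.1) ((ReC \o f) - F0.1.1) = 0.
  apply: (zero (fun n => T0 (s n))) => //; first by move=> n; case: (ts n).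
  by move=> c /conv[M hM]; exists M => n /hM[].
have z1 : ipr ((ImC \o f) - F1.1.1) ((ImC \o f) - F1.1.1) = 0.
  apply: (zero (fun n => T1 (s n))) => //; first by move=> n; case: (ts n).
  by move=> c /conv[M hM]; exists M => n /hM[].
exists (((ReC \o f), F0.1.2), F0.2), (((ImC \o f), F1.1.2), F1.2).
split; [exact: form_dom_replace|exact: form_dom_replace|].
by apply/funext => p; rewrite /of_parts /=; case: (f p).
Qed.

End FormDomainOfFiber.

(** * The resolvent set *)

Section Resolvent.
Context {R : realType}.
Variables (theta omega : R) (m : int).
Hypothesis htheta : 0 < theta < pi / 2.
Hypothesis form_coef : 4^-1 <= (m%:~R - omega) ^+ 2.
Hypothesis domain_coef : 4^-1 <= (m%:~R + omega) ^+ 2.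
Notation leb2 := (@leb2 R).
Notation plane := (measurableTypeR R * measurableTypeR R)%type.
Notation mset := (@measurable _ plane).
Notation mfun2 := (@measurable_fun _ _ plane R).
Notation D := (Gui theta).
Notation rad2 := (@rad2 R).
Notation fR := (R * R -> R).
Notation X := ((fR * fR) * fR)%type.
Notation sq w := (@sqint _ plane R leb2 D w).
Notation ipr := (@ip _ plane R leb2 D rad2).
Notation ReC := (@complex.Re R).
Notation ImC := (@complex.Im R).
Notation L2D := (@L2 _ plane R leb2 D rad2).
Notation A := (fiber m omega theta).
Notation e0 := (energy theta 0 ((m%:~R - omega) ^+ 2)).
Notation norm2 f := (ipr (ReC \o f) (ReC \o f) + ipr (ImC \o f) (ImC \o f)).
Implicit Types (f u v : R * R -> R[i]).

Let oD : open D. Proof. exact: Gui_open. Qed.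
Let mD : mset D. Proof. exact: open_measurable2. Qed.
Let mrad : mfun2 D rad2.
Proof. by apply: (continuous_on_measurable2 oD) => p _; exact: continuous_rad. Qed.
Let rad_gt0 p : D p -> 0 < rad2 p. Proof. exact: Gui_rad_gt0. Qed.

Let ipr_lin (a : R) (f g h : fR) : sq rad2 f -> sq rad2 g -> sq rad2 h ->
  ipr (a *: f + g) h = a * ipr f h + ipr g h.
Proof. exact: (@ip_lin _ plane R leb2 D rad2 mD mrad rad_gt0 a f g h). Qed.
Let sqr_lin (a : R) (f g : fR) : sq rad2 f -> sq rad2 g -> sq rad2 (a *: f + g).
Proof. exact: (@sqint_lin _ plane R leb2 D rad2 mD mrad rad_gt0 a f g). Qed.
Let pos (f : fR) : 0 <= ipr f f. Proof. exact: (@ip_ge0 _ plane R leb2 D rad2 rad_gt0). Qed.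
Let L2P f : L2D f <-> sq rad2 (ReC \o f) /\ sq rad2 (ImC \o f).
Proof. exact: (@L2_sqint _ plane R leb2 D mD rad2 mrad rad_gt0 f). Qed.

Lemma shifted_parts (lam : R[i]) f u :
  (ReC \o (fun p => f p + lam * u p) = ReC lam *: (ReC \o u) + (- ImC lam *: (ImC \o u) + (ReC \o f)) :> fR) /\
  (ImC \o (fun p => f p + lam * u p) = ReC lam *: (ImC \o u) + (ImC lam *: (ReC \o u) + (ImC \o f)) :> fR).
Proof.
split; apply/funext => p; rewrite /=.
  rewrite -[RHS]/(ReC lam * ReC (u p) + (- ImC lam * ImC (u p) + ReC (f p))).
  by case: lam (f p) (u p) => [a b] [c d] [x y] /=; ring.
rewrite -[RHS]/(ReC lam * ImC (u p) + (ImC lam * ReC (u p) + ImC (f p))).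
by case: lam (f p) (u p) => [a b] [c d] [x y] /=; ring.
Qed.

Lemma shifted_L2 lam f u : L2D f -> L2D u -> L2D (fun p => f p + lam * u p).
Proof.
move=> /L2P[f0 f1] /L2P[u0 u1]; apply/L2P; have [-> ->] := shifted_parts lam f u.
by split; apply: sqr_lin => //; exact: sqr_lin.
Qed.

Lemma shifted_ip lam f u (g : fR) : L2D f -> L2D u -> sq rad2 g ->
  ipr (ReC \o (fun p => f p + lam * u p)) g =
    ReC lam * ipr (ReC \o u) g - ImC lam * ipr (ImC \o u) g + ipr (ReC \o f) g /\
  ipr (ImC \o (fun p => f p + lam * u p)) g =
    ReC lam * ipr (ImC \o u) g + ImC lam * ipr (ReC \o u) g + ipr (ImC \o f) g.
Proof.
move=> /L2P[f0 f1] /L2P[u0 u1] sg; have [-> ->] := shifted_parts lam f u.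
have h0 := sqr_lin (- ImC lam) u1 f0; have h1 := sqr_lin (ImC lam) u0 f1.
rewrite (ipr_lin (ReC lam) u0 h0 sg) (ipr_lin _ u1 f0 sg).
by rewrite (ipr_lin (ReC lam) u1 h1 sg) (ipr_lin _ u0 f1 sg); split; ring.
Qed.

Lemma young (c : R) (f g : fR) : 0 < c -> sq rad2 f -> sq rad2 g ->
  2 * ipr f g <= c^-1 * ipr f f + c * ipr g g.
Proof.
move=> c0 sf sg; have sgf := sqr_lin (- c) sg sf; have := pos (- c *: g + f).
have sc (x y : fR) : ipr x y = ipr y x by exact: ipC.
rewrite (ipr_lin (- c) sg sf sgf) (sc g (- c *: g + f)) (sc f (- c *: g + f)).
rewrite (ipr_lin (- c) sg sf sg) (ipr_lin (- c) sg sf sf) (sc g f).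
move: (ipr f f) (ipr g g) (ipr f g) => x y z h.
have ci : 0 <= c^-1 by rewrite invr_ge0 ltW.
have h3 : 0 <= (c^-1 * c) * (c * y) - 2 * (c^-1 * c) * z + c^-1 * x.
  by apply: le_trans (mulr_ge0 ci h) _; rewrite le_eqVlt; apply/orP; left; apply/eqP; ring.
by move: h3; rewrite mulVf ?gt_eqF// mul1r mulr1 => ?; lra.
Qed.

(** The real part of the equation tested with u itself reads
    form(u) - Re lam |u|^2 = Re (f, u).  The left-hand side is at least
    (1 - Re lam) |u|^2 by the Poincare inequality. *)
Lemma resolvent_bound (lam : R[i]) f u : ReC lam < 1 -> L2D f ->
  A u (fun p => f p + lam * u p) ->
  (1 - ReC lam) ^+ 2 * norm2 u <= norm2 f.
Proof.
move=> lam1 L2f [du L2g /(_ u du)].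
have L2u : L2D u by case: du.
have [F0 [F1 [K0 K1 uE]]] := dom_f_form_dom htheta domain_coef du.
rewrite (@innerL2E _ plane R leb2 D mD rad2 mrad rad_gt0 _ _ L2g L2u).
have [u0 u1] := (L2P u).1 L2u; have [f0 f1] := (L2P f).1 L2f.
rewrite (shifted_ip lam L2f L2u u0).1 (shifted_ip lam L2f L2u u1).2.
rewrite {1 2}uE (fiber_formE m omega K0 K1 K0 K1) => /(congr1 ReC) /=.
have P0 := form_dom_poincare htheta K0; have P1 := form_dom_poincare htheta K1.
have up (F : X) : form_dom theta F -> energy theta 0 4^-1 F F <= e0 F F.
  move=> KF; rewrite /energy !mul0r !add0r lerD2r lerD2r ler_wpM2r//.
  by apply: (@ip_ge0 _ plane R leb2 D (@winv R)) => p Dp; rewrite invr_gt0; exact: rad_gt0.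
have Q0 := le_trans P0 (up _ K0); have Q1 := le_trans P1 (up _ K1).
have E0 : mass theta F0 F0 = ipr (ReC \o u) (ReC \o u) by rewrite uE.
have E1 : mass theta F1 F1 = ipr (ImC \o u) (ImC \o u) by rewrite uE.
rewrite E0 in Q0; rewrite E1 in Q1.
have c0 : 0 < 1 - ReC lam by rewrite subr_gt0.
have Y0 := young c0 f0 u0; have Y1 := young c0 f1 u1.
have sc : ipr (ImC \o u) (ReC \o u) = ipr (ReC \o u) (ImC \o u) by exact: ipC.
rewrite sc; move: Q0 Q1 Y0 Y1.
set a0 := ipr (ReC \o u) (ReC \o u); set a1 := ipr (ImC \o u) (ImC \o u).
set x := ipr (ReC \o u) (ImC \o u).
set b0 := ipr (ReC \o f) (ReC \o f); set b1 := ipr (ImC \o f) (ImC \o f).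
set y0 := ipr (ReC \o f) (ReC \o u); set y1 := ipr (ImC \o f) (ImC \o u).
set q0 := e0 F0 F0; set q1 := e0 F1 F1; set c := 1 - ReC lam in c0 *.
have lE : ReC lam = 1 - c by rewrite /c opprB addrC subrK.
rewrite lE; set be := ImC lam.
clearbody a0 a1 x b0 b1 y0 y1 q0 q1 be c => Q0 Q1 Y0 Y1 E.
clear - c0 Q0 Q1 Y0 Y1 E.
have h : c * (a0 + a1) <= c^-1 * (b0 + b1) by lra.
have := ler_wpM2l (ltW c0) h; rewrite !mulrA -expr2 divff ?gt_eqF// mul1r.
by [].
Qed.

(** Injectivity is the case f = 0 of the bound; surjectivity is real_resolvent for
    the real and imaginary parts of f. *)
Lemma resolvent_set_lt1 (lam : R[i]) : ReC lam < 1 ->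
  @resolvent_set _ plane R leb2 D rad2 A lam.
Proof.
move=> lam1; have c0 : 0 < (1 - ReC lam) ^+ 2 by rewrite exprn_gt0// subr_gt0.
have sq0 : sq rad2 (fun=> 0 : R) by exact: (@sqint0 _ plane R leb2 D rad2 mD).
have L20 : L2D (fun=> 0) by apply/L2P; split; exact: sq0.
split.
- move=> u Au; have L2u : L2D u by case: Au => -[].
  have Au' : A u (fun p => 0 + lam * u p).
    by move: Au; congr (A u); apply/funext => p; rewrite add0r.
  have := resolvent_bound lam1 L20 Au'.
  have z (f : fR) : (forall p, f p = 0) -> ipr f f = 0.
    by move=> f0; rewrite /ip /Rintegral integral0_eq// => p _; rewrite f0 !mul0r.
  rewrite (z (ReC \o (fun=> 0)))// addr0 pmulr_rle0// => h.
  have p0 := pos (ReC \o u); have p1 := pos (ImC \o u).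
  have [u0 u1] := (L2P u).1 L2u.
  have z0 : ipr (ReC \o u) (ReC \o u) = 0.
    by apply/eqP; rewrite eq_le p0 andbT; apply: le_trans h; rewrite lerDl.
  have z1 : ipr (ImC \o u) (ImC \o u) = 0.
    by apply/eqP; rewrite eq_le p1 andbT; apply: le_trans h; rewrite lerDr.
  apply: filterS2 (ip_zero_ae u0 z0) (ip_zero_ae u1 z1) => p h0 h1 Dp.
  have := h0 Dp; have := h1 Dp; rewrite /=; by case: (u p) => a b /= -> ->.
- move=> f L2f; have [f0 f1] := (L2P f).1 L2f.
  have [F0 [F1 [K0 K1 E0 E1]]] := real_resolvent htheta (ImC lam) form_coef lam1 f0 f1.
  have du := form_dom_dom_f m omega K0 K1; have L2u : L2D (of_parts F0 F1) by case: du.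
  have L2g := shifted_L2 lam L2f L2u.
  exists (of_parts F0 F1); split=> // v dv; have L2v : L2D v by case: dv.
  have [v0 v1] := (L2P v).1 L2v.
  have [G0 [G1 [KG0 KG1 vE]]] := dom_f_form_dom htheta domain_coef dv.
  rewrite (@innerL2E _ plane R leb2 D mD rad2 mrad rad_gt0 _ _ L2g L2v).
  have [-> ->] := shifted_ip lam L2f L2u v0; have [-> ->] := shifted_ip lam L2f L2u v1.
  rewrite {1}vE (fiber_formE m omega K0 K1 KG0 KG1).
  rewrite (E0 _ KG0) (E1 _ KG1) (E1 _ KG0) (E0 _ KG1) vE /mass.
  rewrite -[ReC \o of_parts F0 F1]/(F0.1.1) -[ImC \o of_parts F0 F1]/(F1.1.1).
  rewrite -[ReC \o of_parts G0 G1]/(G0.1.1) -[ImC \o of_parts G0 G1]/(G1.1.1).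
  by congr (_ +i* _)%C; ring.
exists ((1 - ReC lam) ^+ 2)^-1 => u f L2f Au; have L2u : L2D u by case: Au => -[].
rewrite (@sqnormL2E _ plane R leb2 D mD rad2 mrad rad_gt0 _ L2u).
rewrite (@sqnormL2E _ plane R leb2 D mD rad2 mrad rad_gt0 _ L2f).
by rewrite -EFinM lee_fin ler_pdivlMl//; exact: resolvent_bound Au.
Qed.

End Resolvent.

Theorem proposition1p3 (R : realType) (theta omega : R) (m : int)
    (htheta : 0 < theta < pi / 2) (homega : 0 < omega <= 1 / 2)
    (hm : m <> 0) :
  (1 <= inf_sigma_fiber m omega theta)%E.
Proof.
have /andP[w0 w2] := homega.
(* an integer other than 0 is at distance at least 1/2 from omega and - omega *)
have hm1 : (m%:~R : R) <= -1 \/ 1 <= (m%:~R : R).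
  case: (m) hm => n n0; [right|left].
    by rewrite -pmulrn ler1n lt0n; apply/eqP => e; apply: n0; rewrite e.
  by rewrite NegzE mulrNz lerN2 -pmulrn ler1n.
have form_coef : 4^-1 <= (m%:~R - omega) ^+ 2 by case: hm1 => h; nra.
have domain_coef : 4^-1 <= (m%:~R + omega) ^+ 2 by case: hm1 => h; nra.
apply: le_ereal_inf_tmp => _ [lam nres <-]; rewrite lee_fin leNgt; apply/negP => lam1.
exact/nres/resolvent_set_lt1.
Qed.
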